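(* Let $(X,d,\mu)$ be a complete, doubling metric measure space supporting a $(1,1)$-Poincaré inequality such that $\mu(X)=\infty$, and let $Q>1$. Then the following conditions are equivalent. (i) $\mu$ is lower Ahlfors $Q$-regular. (ii) There exists a constant $C\ge1$ such that for all $0<\theta<1$ and $u\in L^1(X)$, $$\left(\int_X|u|^{\frac{Q}{Q-\theta}}\,d\mu\right)^{\frac{Q-\theta}{Q}}\le C\,\theta(1-\theta)\int_X\int_X\frac{|u(x)-u(y)|}{d(x,y)^\theta\,\mu(B(x,d(x,y)))}\,d\mu(y)\,d\mu(x).$$ (iii) There exist constants $C\ge1$ and $\tau\ge1$ such that for all $0<\theta<1$, all balls $B_0=B(x_0,r_0)\subset X$ and all $u\in L^1(X)$, $$\left(\int_{B_0}|u-u_{B_0}|^{\frac{Q}{Q-\theta}}\,d\mu\right)^{\frac{Q-\theta}{Q}}\le C(1-\theta)\int_{\tau B_0}\int_{\tau B_0}\frac{|u(x)-u(y)|}{d(x,y)^\theta\,\mu(B(x,d(x,y)))}\,d\mu(y)\,d\mu(x).$$ The lower Ahlfors $Q$-regularity constants in the implications (ii)$\Rightarrow$(i) and (iii)$\Rightarrow$(i) are independent of $\theta$, while the constants $C$ and $\tau$ in (ii) and (iii) may depend additionally on the doubling and $(1,1)$-Poincaré inequality constants in the implications (i)$\Rightarrow$(ii) and (i)$\Rightarrow$(iii).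
   Context: A metric measure space $(X,d,\mu)$ is a metric space with a Borel regular outer measure $\mu$. Balls $B(x,r)=\{y\in X:d(x,y)<r\}$ are open and come with a prescribed center and radius; for $B=B(x,r)$, $\lambda B:=B(x,\lambda r)$ and $\mathrm{rad}(B):=r$. The measure $\mu$ is doubling with constant $C_\mu\ge1$ if $0<\mu(B(x,2r))\le C_\mu\,\mu(B(x,r))<\infty$ for all $x\in X$, $r>0$. We write $u_B=\frac1{\mu(B)}\int_B u\,d\mu$. A Borel function $g:X\to[0,\infty]$ is an upper gradient of $u:X\to[-\infty,\infty]$ if $|u(\gamma(b))-u(\gamma(a))|\le\int_\gamma g\,ds$ for all non-constant compact rectifiable curves $\gamma:[a,b]\to X$ (with $\int_\gamma g\,ds=\infty$ required if $u(\gamma(a))$ or $u(\gamma(b))$ is not finite). $(X,d,\mu)$ supports a $(1,1)$-Poincaré inequality if there are constants $C_P,\tau_P\ge1$ such that $\frac1{\mu(B)}\int_B|u-u_B|\,d\mu\le C_P\,\mathrm{rad}(B)\,\frac1{\mu(\tau_PB)}\int_{\tau_PB}g\,d\mu$ for every ball $B$, every $u\in L^1_{\mathrm{loc}}(X)$ and every upper gradient $g$ of $u$. $\mu$ is lower Ahlfors $Q$-regular if there is $c_0>0$ such that $\mu(B(x,r))\ge c_0r^Q$ for every $x\in X$ and $0<r<2\,\mathrm{diam}(X)$; the regularity constants are $c_0$ and $Q$. Integrands of the double integrals are read as $0$ on the diagonal $x=y$. *)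

(* Defs.v *)
From HB Require Import structures.
From mathcomp Require Import all_boot all_order all_algebra.
From mathcomp Require Import all_classical all_reals all_analysis measurable_realfun.

Set Implicit Arguments.
Unset Strict Implicit.
Unset Printing Implicit Defensive.

Import Order.TTheory GRing.Theory Num.Theory.
Import numFieldNormedType.Exports.

Local Open Scope classical_set_scope.
Local Open Scope ring_scope.

(* Completeness and measurable structures are pointed in the library, so these
   are exactly the nonempty complete metric spaces. *)
#[short(type="completeMetricType")]
HB.structure Definition CompleteMetric (R : realType) :=
  {X of Metric R X & Complete X}.

Section metric_measure_space.
Context {R : realType} {X : completeMetricType R}.
Variable mu : {outer_measure set X -> \bar R}.
Implicit Types (u g : X -> \bar R) (A B : set X) (x y : X).

(* Measurability and integration with respect to mu refer to the
   sigma-algebra of all mu-measurable (Caratheodory) sets. *)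
Definition mu_measure : {measure set (caratheodory_type mu) -> \bar R} := mu.

Local Open Scope ereal_scope.

Definition borel_regular :=
  (forall A, <<s @open X >> A -> mu.-caratheodory A) /\
  (forall A, exists B, [/\ <<s @open X >> B, A `<=` B & mu B = mu A]).

Definition doubling (Cmu : R) := (1 <= Cmu)%R /\
  forall x (r : R), (0 < r)%R ->
    [/\ 0 < mu (ball x (2 * r)%R),
        mu (ball x (2 * r)%R) <= Cmu%:E * mu (ball x r) &
        mu (ball x r) < +oo].

Definition mean B u : \bar R := (mu B)^-1 * \int[mu_measure]_(x in B) u x.

Definition L1 u := mu_measure.-integrable [set: X] u.

Definition L1loc u :=
  forall x, exists2 r : R, (0 < r)%R & mu_measure.-integrable (ball x r) u.

End metric_measure_space.

Section curves.
Context {R : realType} {X : completeMetricType R}.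
Implicit Types (gamma : R -> X) (a b t : R) (u g : X -> \bar R).

Definition curve_variation gamma a b (s : seq R) : R :=
  let F := gamma \o nth b (a :: s) in
  \sum_(0 <= n < size s) mdist (F n) (F n.+1).

Definition curve_length gamma a b : \bar R :=
  ereal_sup [set (curve_variation gamma a b s)%:E | s in itv_partition a b].

Definition rectifiable_curve gamma a b :=
  [/\ a < b, {within `[a, b], continuous gamma} &
      (curve_length gamma a b < +oo)%E].

Definition nonconstant_curve gamma a b :=
  exists2 t, t \in `[a, b] & gamma t <> gamma a.

(* The point gamma t for any t such that gamma restricted to [a, t] has length
   s; it does not depend on t, gamma being constant wherever its length
   function is. *)
Definition arc_length_param gamma a b (s : R) : X :=
  gamma (xget a [set t | t \in `[a, b] /\ curve_length gamma a t = s%:E]).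

Definition line_integral gamma a b g : \bar R :=
  (\int[lebesgue_measure]_(s in `[0%R, fine (curve_length gamma a b)])
     g (arc_length_param gamma a b s))%E.

Local Open Scope ereal_scope.

(* As +oo - +oo = -oo in \bar R, the left-hand side below is +oo as soon as
   u is infinite at one of the two endpoints. *)
Definition upper_gradient u g :=
  [/\ forall x, 0 <= g x,
      measurable_fun [set: g_sigma_algebraType (@open X)] g &
      forall gamma a b, rectifiable_curve gamma a b ->
        nonconstant_curve gamma a b ->
        `|u (gamma b) - u (gamma a)| <= line_integral gamma a b g].

End curves.

Section conditions.
Context {R : realType} {X : completeMetricType R}.
Variable mu : {outer_measure set X -> \bar R}.
Implicit Types (u g : X -> \bar R) (A : set X) (x y : X).

Local Notation "\intmu_ ( x 'in' A ) f" := (\int[mu_measure mu]_(x in A) f)%E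
  (at level 36, f at level 36, x name, format "\intmu_ ( x  'in'  A )  f").

Local Open Scope ereal_scope.

Definition poincare11 (CP tauP : R) := [/\ (1 <= CP)%R, (1 <= tauP)%R &
  forall x (r : R), (0 < r)%R -> forall u g, L1loc mu u -> upper_gradient u g ->
    mean mu (ball x r) (fun y => `|u y - mean mu (ball x r) u|) <=
    (CP * r)%:E * mean mu (ball x (tauP * r)%R) g].

Definition diam : \bar R := ereal_sup [set (mdist p.1 p.2)%:E | p in [set: X * X]].

Definition lower_ahlfors_with (Q c0 : R) := (0 < c0)%R /\
  forall x (r : R), (0 < r)%R -> r%:E < 2%:E * diam ->
    (c0 * r `^ Q)%:E <= mu (ball x r).

Definition frac_kernel (theta : R) u x y : \bar R :=
  if x == y then 0 else
  `|u x - u y| / ((mdist x y `^ theta)%:E * mu (ball x (mdist x y))).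

Definition frac_energy (theta : R) A u : \bar R :=
  \intmu_(x in A) \intmu_(y in A) frac_kernel theta u x y.

Definition frac_sobolev_with (Q C : R) := (1 <= C)%R /\
  forall theta : R, (0 < theta < 1)%R -> forall u, L1 mu u ->
    (\intmu_(x in [set: X]) (`|u x| `^ (Q / (Q - theta)))) `^ ((Q - theta) / Q)
    <= (C * theta * (1 - theta))%:E * frac_energy theta [set: X] u.

Definition frac_poincare_with (Q C tau : R) := [/\ (1 <= C)%R, (1 <= tau)%R &
  forall theta : R, (0 < theta < 1)%R ->
  forall x0 (r0 : R), (0 < r0)%R -> forall u, L1 mu u ->
    (\intmu_(x in ball x0 r0)
       (`|u x - mean mu (ball x0 r0) u| `^ (Q / (Q - theta))))
      `^ ((Q - theta) / Q)
    <= (C * (1 - theta))%:E * frac_energy theta (ball x0 (tau * r0)%R) u].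

Definition lower_ahlfors (Q : R) := exists c0, lower_ahlfors_with Q c0.

Definition frac_sobolev (Q : R) := exists C, frac_sobolev_with Q C.

Definition frac_poincare (Q : R) := exists C tau, frac_poincare_with Q C tau.

Definition standing (Cmu CP tauP : R) :=
  [/\ borel_regular mu, doubling mu Cmu, poincare11 CP tauP &
      mu [set: X] = +oo].

End conditions.

(* Main.v *)
(** Let f : X -> [0, 1].  Averaging f at scale t gives a locally Lipschitz function
    whose local slope is an upper gradient bounded by C / t times the mean
    oscillation of f at scale 4 t.  The (1,1)-Poincaré inequality, applied to it and
    chained over shrinking balls, bounds the measure m of {f = 1} by
    C max(1, m^(1/Q) / t) times the total oscillation of f at scale 4 t.  Summed
    over dyadic t with weights t^(-theta), the oscillations are at most a constant
    times the fractional energy, because reverse doubling makes the kernel sums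
    geometric; the weight sums over t > m^(1/Q) and t < m^(1/Q) produce the factors
    theta and 1 - theta.  This weak-type estimate, applied to
    the truncations of |u| (or of the two parts of u - c, with c a median) between
    dyadic levels, adds up to the strong one.  Conversely, at theta = 1/2 a cutoff
    function of B(x, r) has energy at most C r^(-1/2) mu(B(x, r)).

    The integrands of the energies are not known to be measurable, and their
    integrals are lower integrals; superadditivity of these is all that is used,
    Tonelli's theorem never is. *)

(* The obstacle is uniformity in theta: the factors theta and 1 - theta must survive with constants
   free of theta. In the forward direction, upper bounds therefore never sum powers of the scale:
   the powers are replaced by their largest value, and decay over the scales comes from reverse
   doubling alone, that is, from the Poincaré inequality and mu(X) = +oo. The powers are summed only
   in lower bounds, where they give 1 / theta over large scales and 1 / (1 - theta) over small ones.
   A local estimate sees only scales up to the radius of its ball, which is why (iii) has no factor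
   theta.

   The radius m^(1/Q) is the one at which the bound c0 r^Q for volumes becomes comparable with m. In
   the chain of averages, radii above it are handled pointwise by lower regularity and radii below
   it by a covering; fixed weights with sum less than 1 decide which radius is responsible for a
   given point.

   Averaging f is the price for having a usable upper gradient; the points where f and its average
   differ noticeably are themselves controlled by the oscillation. *)
Require Import Defs.
From mathcomp Require Import all_boot all_order all_algebra.
From mathcomp Require Import all_classical all_reals all_analysis measurable_realfun.
From mathcomp Require Import ring lra.
Import Order.TTheory GRing.Theory Num.Theory.
Import numFieldNormedType.Exports.
Local Open Scope classical_set_scope.
Local Open Scope ring_scope.
Set Implicit Arguments.
Unset Strict Implicit.
Unset Printing Implicit Defensive.

(** * Integrals of nonnegative functions that need not be measurable *)

Section lower_integral.
Local Open Scope ereal_scope.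
Context d (T : measurableType d) (R : realType).
Variable mu : {measure set T -> \bar R}.
Implicit Types (f g : T -> \bar R) (D : set T).

Import HBNNSimple.

Lemma ge0_sintegral_le f D (h : {nnsfun T >-> R}) :
  (forall x, D x -> 0 <= f x) -> (forall x, (h x)%:E <= (f \_ D) x) ->
  sintegral mu h <= \int[mu]_(x in D) f x.
Proof.
move=> f0 hf; rewrite ge0_integralE//.
by apply: ereal_sup_ubound; exists h.
Qed.

Lemma ge0_integral_le_ub f D c : (forall x, D x -> 0 <= f x) ->
  (forall h : {nnsfun T >-> R}, (forall x, (h x)%:E <= (f \_ D) x) ->
    sintegral mu h <= c) -> \int[mu]_(x in D) f x <= c.
Proof.
move=> f0 hf; rewrite ge0_integralE//.
by apply: ge_ereal_sup => _ [h fh <-]; exact: hf.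
Qed.

Lemma le_lower_integral D f g : (forall x, D x -> 0 <= f x) ->
  (forall x, D x -> f x <= g x) ->
  \int[mu]_(x in D) f x <= \int[mu]_(x in D) g x.
Proof.
move=> f0 fg; apply: ge0_integral_le_ub => // h hf.
apply: ge0_sintegral_le => [x Dx|x]; first exact: le_trans (f0 _ Dx) (fg _ Dx).
apply: le_trans (hf x) _; rewrite /patch; case: ifPn => //.
by rewrite inE; exact: fg.
Qed.

Lemma lower_integral_subset A D f : A `<=` D -> (forall x, D x -> 0 <= f x) ->
  \int[mu]_(x in A) f x <= \int[mu]_(x in D) f x.
Proof.
move=> AD f0; apply: ge0_integral_le_ub => [x /AD|h hf]; first exact: f0.
apply: ge0_sintegral_le => // x; apply: le_trans (hf x) _.
rewrite /patch; case: ifPn => xA; case: ifPn => xD //.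
  by rewrite inE in xA; move: xD; rewrite notin_setE => /(_ (AD _ xA)).
by apply: f0; rewrite inE in xD.
Qed.

(** Simple functions below f and below g add up to one below f + g. Infinite integrals are split off
    so that a finite one can be moved across the inequality. *)
Lemma lower_integralD_ge D f g : (forall x, D x -> 0 <= f x) ->
  (forall x, D x -> 0 <= g x) ->
  \int[mu]_(x in D) f x + \int[mu]_(x in D) g x <=
  \int[mu]_(x in D) (f x + g x).
Proof.
move=> f0 g0.
have fg0 x : D x -> 0 <= f x + g x by move=> Dx; rewrite adde_ge0 ?f0 ?g0.
have [gfin|] := boolP (\int[mu]_(x in D) g x == +oo).
  rewrite (eqP gfin) addey; last first.
    by rewrite gt_eqF// (lt_le_trans (ltNyr 0))// integral_ge0.
  rewrite -(eqP gfin); apply: le_lower_integral => // x Dx.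
  by rewrite leeDr// f0.
rewrite -ltey => gfin.
have gfn : \int[mu]_(x in D) g x \is a fin_num.
  by rewrite ge0_fin_numE// integral_ge0.
rewrite -leeBrDr//.
apply: ge0_integral_le_ub => // h hf; rewrite leeBrDr//.
(* A simple function below f may have an infinite integral; being below f + g as well, it then makes
   the right-hand side infinite. *)
have hfn : sintegral mu h \is a fin_num \/ sintegral mu h = +oo.
  have := sintegral_ge0 mu h; case: (sintegral mu h) => //=.
    by left.
  by right.
case: hfn => hfn.
  rewrite addeC -leeBrDr//; apply: ge0_integral_le_ub => // k kg.
  rewrite leeBrDr// addeC -sintegralD.
  apply: (@ge0_sintegral_le _ _ ((h \+ k)%R)) => // x.
  have := hf x; have := kg x; rewrite /patch; case: ifPn => _ kx hx /=.
    by rewrite EFinD leeD.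
  by rewrite EFinD -[leRHS]adde0 leeD.
rewrite hfn addye; last first.
  by rewrite gt_eqF// (lt_le_trans (ltNyr 0))// integral_ge0.
rewrite -hfn; apply: ge0_sintegral_le => // x; apply: le_trans (hf x) _.
rewrite /patch; case: ifPn => // xD.
by rewrite leeDl// g0//; rewrite inE in xD.
Qed.

Lemma lower_integral_sum_ge D (I : Type) (s : seq I) (F : I -> T -> \bar R) :
  (forall i x, D x -> 0 <= F i x) ->
  \sum_(i <- s) \int[mu]_(x in D) F i x <=
  \int[mu]_(x in D) \sum_(i <- s) F i x.
Proof.
move=> F0; elim: s => [|i s ih].
  by rewrite big_nil integral_ge0// => x _; rewrite big_nil.
rewrite big_cons [leRHS](eq_integral (fun x => F i x + \sum_(j <- s) F j x)); last first.
  by move=> x _; rewrite big_cons.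
apply: le_trans (lower_integralD_ge _ _); first by rewrite leeD2l.
  by move=> x; exact: F0.
by move=> x Dx; rewrite sume_ge0// => j _; exact: F0.
Qed.

Lemma lower_integralZl_ge D f (c : R) : (0 <= c)%R ->
  (forall x, D x -> 0 <= f x) ->
  c%:E * \int[mu]_(x in D) f x <= \int[mu]_(x in D) (c%:E * f x).
Proof.
move=> c0 f0; have [->|cn0] := eqVneq c 0%R.
  by rewrite mul0e integral_ge0// => x Dx; rewrite mul0e.
have cp : (0 < c)%R by rewrite lt_neqAle eq_sym cn0.
rewrite muleC -lee_pdivlMr//.
apply: ge0_integral_le_ub => // h hf; rewrite lee_pdivlMr// muleC -sintegralrM.
apply: (@ge0_sintegral_le _ _ (mul_nnsfun (cst_nnsfun T (NngNum c0)) h)) => [x Dx|x /=].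
  by rewrite mule_ge0// ?f0// lee_fin.
have := hf x; rewrite /patch; case: ifPn => _ hx.
  by rewrite EFinM lee_wpmul2l// lee_fin.
have -> : h x = 0%R by apply/eqP; rewrite eq_le -!lee_fin hx/= lee_fin fun_ge0.
by rewrite mulr0.
Qed.

(** The missing inequality is the previous lemma applied with c^-1. *)
Lemma lower_integralZl D f (c : R) : (0 <= c)%R ->
  (forall x, D x -> 0 <= f x) ->
  \int[mu]_(x in D) (c%:E * f x) = c%:E * \int[mu]_(x in D) f x.
Proof.
move=> c0 f0; apply/eqP; rewrite eq_le lower_integralZl_ge// andbT.
have [->|cn0] := eqVneq c 0%R.
  by rewrite mul0e integral0_eq// => x Dx; rewrite mul0e.
have cp : (0 < c)%R by rewrite lt_neqAle eq_sym cn0.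
rewrite -lee_pdivrMl//; apply: le_trans (lower_integralZl_ge _ _) _.
- by rewrite invr_ge0.
- by move=> x Dx; rewrite mule_ge0// ?f0// lee_fin.
apply: le_lower_integral => x Dx.
  by rewrite !mule_ge0// ?f0// lee_fin ?invr_ge0.
by rewrite muleA -EFinM mulVf// mul1e.
Qed.

(** Chebyshev's inequality, with measurability asked of the set A only. *)
Lemma lower_integral_ge_cst A D f (c : R) : (0 <= c)%R -> measurable A ->
  A `<=` D -> (forall x, D x -> 0 <= f x) -> (forall x, A x -> c%:E <= f x) ->
  c%:E * mu A <= \int[mu]_(x in D) f x.
Proof.
move=> c0 mA AD f0 cf; rewrite -integral_cst//.
apply: le_trans (lower_integral_subset AD f0).
by apply: le_lower_integral => // x _; rewrite lee_fin.
Qed.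

Lemma lower_integral_disjoint A B D f : A `<=` D -> B `<=` D ->
  A `&` B = set0 -> (forall x, D x -> 0 <= f x) ->
  \int[mu]_(x in A) f x + \int[mu]_(x in B) f x <= \int[mu]_(x in D) f x.
Proof.
move=> AD BD AB f0.
rewrite 2!(integral_mkcond _ f).
apply: le_trans (lower_integralD_ge _ _) _.
- by move=> x _; apply: erestrict_ge0 => y /AD; exact: f0.
- by move=> x _; apply: erestrict_ge0 => y /BD; exact: f0.
rewrite (integral_mkcond D); apply: le_lower_integral => x _.
  by rewrite adde_ge0//; apply: erestrict_ge0 => y ?; apply: f0; [exact: AD|exact: BD].
rewrite /patch; case: ifPn => xA; case: ifPn => xB; case: ifPn => xD;
  rewrite ?adde0 ?add0e//.
- by move/seteqP : AB => [/(_ x)]; rewrite !inE in xA xB => /(_ (conj xA xB)).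
- by move/seteqP : AB => [/(_ x)]; rewrite !inE in xA xB => /(_ (conj xA xB)).
- by rewrite inE in xA; move: xD; rewrite notin_setE => /(_ (AD _ xA)).
- by rewrite inE in xB; move: xD; rewrite notin_setE => /(_ (BD _ xB)).
- by apply: f0; rewrite inE in xD.
Qed.

Lemma lower_integral_disjoint_sum (I : eqType) (s : seq I) (A : I -> set T) D f :
  uniq s -> (forall i, i \in s -> A i `<=` D) ->
  (forall i j, i \in s -> j \in s -> i != j -> A i `&` A j = set0) ->
  (forall x, D x -> 0 <= f x) ->
  \sum_(i <- s) \int[mu]_(x in A i) f x <= \int[mu]_(x in D) f x.
Proof.
elim: s D => [|i s ih] D /=; first by move=> _ _ _ f0; rewrite big_nil integral_ge0.
move=> /andP[si us] AD Adis f0; rewrite big_cons.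
apply: (@le_trans _ _ (\int[mu]_(x in A i) f x +
    \int[mu]_(x in D `\` A i) f x)).
  rewrite leeD2l// ih//.
  - move=> j js x Ajx; split; first by apply: (AD j) => //; rewrite inE js orbT.
    move=> Aix; have : (A i `&` A j) x by [].
    rewrite Adis ?inE ?eqxx ?js ?orbT//.
    by apply: contraNneq si => ->.
  - by move=> j k js ks; apply: Adis; rewrite inE ?js ?ks orbT.
  - by move=> x [Dx _]; exact: f0.
apply: lower_integral_disjoint => //.
- by apply: AD; rewrite inE eqxx.
- by rewrite setDE setICA setICr setI0.
Qed.

End lower_integral.

Lemma measure_exhaust d (T : measurableType d) (R : realType)
    (mu : {measure set T -> \bar R}) (A : set T) (F : nat -> set T) (a : \bar R) :
  (forall n, measurable (F n)) -> (forall n m, (n <= m)%N -> F n `<=` F m) ->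
  A = \bigcup_n F n -> (a < mu A)%E -> exists n, (a < mu (F n))%E.
Proof.
move=> mF ndF AF aA; apply: contrapT => na.
have mU : measurable (\bigcup_n F n) by exact: bigcup_measurable.
have cvg : mu \o F @ \oo --> mu (\bigcup_n F n).
  by apply: nondecreasing_cvg_mu => // n m nm; apply/subsetPset; exact: ndF.
have : (mu (\bigcup_n F n) <= a)%E.
  rewrite -(cvg_lim _ cvg)//; apply: lime_le.
    by apply/cvg_ex; exists (mu (\bigcup_n F n)).
  by apply: nearW => n; rewrite leNgt; apply/negP => h; apply: na; exists n.
by rewrite leNgt -AF aA.
Qed.

(** * Local slopes as upper gradients *)

Section polygons.
Context {R : realType} {X : completeMetricType R}.
Implicit Types (gamma : R -> X) (a b c t : R) (s : seq R).

(** Recursive form of [curve_variation], suited to induction on the partition. *)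
Fixpoint polygon_length gamma a s : R :=
  if s is y :: s' then mdist (gamma a) (gamma y) + polygon_length gamma y s'
  else 0.

Lemma curve_variationE gamma a b s :
  curve_variation gamma a b s = polygon_length gamma a s.
Proof.
elim: s a => [|y s ih] a; first by rewrite /curve_variation/= big_geq.
by rewrite /curve_variation/= big_nat_recl//= -ih.
Qed.

Lemma polygon_length_cat gamma a s1 s2 : polygon_length gamma a (s1 ++ s2) =
  polygon_length gamma a s1 + polygon_length gamma (last a s1) s2.
Proof.
elim: s1 a => [|y s1 ih] a; first by rewrite add0r.
by rewrite /= ih addrA.
Qed.

Lemma polygon_length_ge0 gamma a s : 0 <= polygon_length gamma a s.
Proof. by elim: s a => [|y s ih] a//=; rewrite addr_ge0// mdist_ge0. Qed.

Lemma polygon_length_le gamma a b s : itv_partition a b s ->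
  ((polygon_length gamma a s)%:E <= curve_length gamma a b)%E.
Proof.
by move=> abs; apply: ereal_sup_ubound; exists s; rewrite ?curve_variationE.
Qed.

Lemma curve_length_le gamma a b x :
  (forall s, itv_partition a b s -> ((polygon_length gamma a s)%:E <= x)%E) ->
  (curve_length gamma a b <= x)%E.
Proof.
move=> h; apply: ge_ereal_sup => _ [s abs <-].
by rewrite curve_variationE h.
Qed.

Lemma itv_partition_catP a b c s1 s2 : itv_partition a b s1 ->
  itv_partition b c s2 -> itv_partition a c (s1 ++ s2).
Proof.
move=> [p1 /eqP l1] [p2 /eqP l2].
by split; rewrite ?cat_path ?last_cat l1 ?p1 ?l2.
Qed.

Lemma itv_partition_refl a s : itv_partition a a s -> s = [::].
Proof.
case: s => // y s [/= /andP[ay yp] /eqP la].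
have : y <= last y s.
  elim: s y yp {ay la} => //= z s ih y /andP[yz zs].
  by rewrite (le_trans (ltW yz))// ih.
by rewrite la leNgt ay.
Qed.

Lemma itv_partition_exists a b : a <= b -> exists s, itv_partition a b s.
Proof.
rewrite le_eqVlt => /predU1P[->|ab]; first by exists [::]; split.
by exists [:: b]; split => //=; rewrite ab.
Qed.

Lemma curve_length_ge0 gamma a b : a <= b -> (0 <= curve_length gamma a b)%E.
Proof.
move=> /itv_partition_exists[s abs].
by apply: le_trans (polygon_length_le gamma abs); rewrite lee_fin polygon_length_ge0.
Qed.

Lemma curve_length_refl gamma a : curve_length gamma a a = 0%E.
Proof.
apply/eqP; rewrite eq_le curve_length_ge0// andbT.
by apply: curve_length_le => s /itv_partition_refl ->.
Qed.

Lemma curve_length_cat gamma a c b : a <= c -> c <= b ->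
  (curve_length gamma a b < +oo)%E ->
  (curve_length gamma a c + curve_length gamma c b <= curve_length gamma a b)%E.
Proof.
move=> ac cb fin.
have h s : itv_partition a c s -> ((polygon_length gamma a s)%:E +
    curve_length gamma c b <= curve_length gamma a b)%E.
  move=> acs; rewrite -leeBrDl//; apply: curve_length_le => s' cbs'.
  rewrite leeBrDl//; apply: le_trans (polygon_length_le _ (itv_partition_catP acs cbs')).
  by rewrite polygon_length_cat; case: acs => _ /eqP ->.
have fR : curve_length gamma c b \is a fin_num.
  rewrite ge0_fin_numE ?curve_length_ge0//.
  have [s acs] := itv_partition_exists ac.
  apply: le_lt_trans fin; apply: le_trans (h _ acs).
  by rewrite leeDr// lee_fin polygon_length_ge0.
rewrite -leeBrDr//; apply: curve_length_le => s /h.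
by rewrite leeBrDr.
Qed.

(** By the triangle inequality a new vertex does not shorten a polygon. Partitions are strictly
    increasing, so c = a needs an empty first part. *)
Lemma itv_partition_insert gamma a c b s : a <= c -> c <= b ->
  itv_partition a b s -> exists s1 s2, [/\ itv_partition a c s1,
    itv_partition c b s2 &
    polygon_length gamma a s <= polygon_length gamma a s1 + polygon_length gamma c s2].
Proof.
elim: s a => [|y s ih] a ac cb.
  move=> /itv_partition_nil ab; move: ac cb; rewrite ab => bc cb.
  have -> : c = b by apply/eqP; rewrite eq_le bc cb.
  by exists [::], [::]; split; rewrite ?addr0.
move=> [/= /andP[ay yp] l].
have [yc|cy] := leP y c.
  have [s1 [s2 [[p1 l1] p2 le12]]] := ih y yc cb (conj yp l).
  exists (y :: s1), s2; split => //=; last by rewrite -addrA lerD2l.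
  by split => //=; rewrite ay p1.
have [ca|ca] := eqVneq a c.
  exists [::], (y :: s); split => //=; first by split => //=; rewrite ca.
    by split => //=; rewrite cy yp.
  by rewrite add0r ca.
exists [:: c], (y :: s); split => //=; first by split => //=; rewrite lt_neqAle ca ac.
  by split => //=; rewrite cy yp.
by rewrite addr0 addrA lerD2r metric_triangle.
Qed.

Lemma curve_length_le_cat gamma a c b : a <= c -> c <= b ->
  (curve_length gamma a b <= curve_length gamma a c + curve_length gamma c b)%E.
Proof.
move=> ac cb; apply: curve_length_le => s abs.
have [s1 [s2 [p1 p2 h]]] := itv_partition_insert gamma ac cb abs.
apply: (@le_trans _ _ (polygon_length gamma a s1 + polygon_length gamma c s2)%:E).
  by rewrite lee_fin.
by rewrite EFinD leeD// polygon_length_le.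
Qed.

Lemma curve_length_ge_mdist gamma a b : a <= b ->
  ((mdist (gamma a) (gamma b))%:E <= curve_length gamma a b)%E.
Proof.
rewrite le_eqVlt => /predU1P[->|ab]; first by rewrite mdistxx curve_length_ge0.
have ab1 : itv_partition a b [:: b] by split => //=; rewrite ab.
by apply: le_trans (polygon_length_le gamma ab1); rewrite /= addr0.
Qed.

End polygons.

Section rectifiable.
Context {R : realType} {X : completeMetricType R}.
Variables (gamma : R -> X) (a b : R).
Hypothesis rect : rectifiable_curve gamma a b.

Let ab : a <= b. Proof. by case: rect => /ltW. Qed.

Let len c t := fine (curve_length gamma c t).

Lemma rectifiable_length_fin c t : a <= c -> c <= t -> t <= b ->
  curve_length gamma c t \is a fin_num.
Proof.
move=> ac ct tb; case: rect => _ _ fin.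
rewrite ge0_fin_numE ?curve_length_ge0//; apply: le_lt_trans fin.
apply: (@le_trans _ _ (curve_length gamma a t)).
  apply: (@le_trans _ _ (curve_length gamma a c + curve_length gamma c t)%E).
    by rewrite leeDr// curve_length_ge0.
  apply: curve_length_cat => //; case: rect => _ _; apply: le_lt_trans.
  apply: curve_length_le => s ats.
  have [s' tbs'] := itv_partition_exists tb.
  apply: le_trans (polygon_length_le _ (itv_partition_catP ats tbs')).
  by rewrite polygon_length_cat lee_fin lerDl polygon_length_ge0.
apply: curve_length_le => s ats.
have [s' tbs'] := itv_partition_exists tb.
apply: le_trans (polygon_length_le _ (itv_partition_catP ats tbs')).
by rewrite polygon_length_cat lee_fin lerDl polygon_length_ge0.
Qed.

Lemma rectifiable_lengthE c t : a <= c -> c <= t -> t <= b ->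
  curve_length gamma c t = (len c t)%:E.
Proof. by move=> ac ct tb; rewrite fineK// rectifiable_length_fin. Qed.

Lemma rectifiable_lengthD c t r : a <= c -> c <= t -> t <= r -> r <= b ->
  len c r = len c t + len t r.
Proof.
move=> ac ct tr rb; apply: EFin_inj; rewrite EFinD -!rectifiable_lengthE//.
- apply/eqP; rewrite eq_le curve_length_le_cat// curve_length_cat//.
  by rewrite rectifiable_lengthE ?ltry// (le_trans ct).
- exact: le_trans ac ct.
- exact: le_trans tr rb.
- exact: le_trans ct tr.
Qed.

Lemma rectifiable_mdist c t : a <= c -> c <= t -> t <= b ->
  mdist (gamma c) (gamma t) <= len c t.
Proof.
move=> ac ct tb; rewrite -lee_fin -rectifiable_lengthE//.
exact: curve_length_ge_mdist.
Qed.


Let cont t (e : R) : a <= t <= b -> 0 < e -> exists2 d : R, 0 < d &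
  forall r, a <= r <= b -> `|t - r| < d -> mdist (gamma t) (gamma r) < e.
Proof.
move=> tab e0; case: rect => _ /subspace_continuousP cg _.
have tab' : [set` `[a, b]] t by rewrite /= in_itv.
have /nbhs_ballP[d d0 H] := cg _ tab' _ (nbhsx_ballx (gamma t) e e0).
exists d => // r rab trd.
have rab' : [set` `[a, b]] r by rewrite /= in_itv.
have : ball (gamma t) e (gamma r) := H r trd rab'.
by rewrite ballEmdist.
Qed.

Lemma rectifiable_length_adherent c t (e : R) : a <= c -> c <= t -> t <= b ->
  0 < e -> exists2 s, itv_partition c t s & len c t - e < polygon_length gamma c s.
Proof.
move=> ac ct tb e0.
have [_ [s cts <-]] := ub_ereal_sup_adherent e0 (rectifiable_length_fin ac ct tb).
rewrite -/(curve_length gamma c t) rectifiable_lengthE// curve_variationE => h.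
by exists s.
Qed.

(** The length of [a, t] is almost attained by a polygon. Moving its last vertex from t to a nearby
    r changes only the last edge, by less than e / 2. Hence length does not jump from the left. *)
Let left_lsc t (e : R) : a < t -> t <= b -> 0 < e -> exists2 d : R, 0 < d &
  forall r, a <= r -> t - d < r -> r < t -> len a t <= len a r + e.
Proof.
move=> at_ tb e0; have e20 : 0 < e / 2 by rewrite divr_gt0.
have [s [ps ls] hs] := rectifiable_length_adherent (lexx a) (ltW at_) tb e20.
have [d d0 dP] := cont (t := t) (e := e / 2) ltac:(rewrite (ltW at_) tb//) e20.
case/lastP: s ps ls hs => [_ /eqP/= ta|s y]; first by rewrite ta ltxx in at_.
rewrite rcons_path last_rcons => /andP[ps /[swap] /eqP -> pt].
rewrite -cats1 polygon_length_cat /= addr0 => hs.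
exists (Order.min d (t - last a s)); first by rewrite lt_min d0 subr_gt0.
move=> r ar tr rt.
have [tdr pr] : t - d < r /\ last a s < r.
  move: tr; rewrite ltrBlDr => tr; split.
    by rewrite ltrBlDr; apply: lt_le_trans tr _; rewrite lerD2l ge_min lexx.
  have : t < r + (t - last a s).
    by apply: lt_le_trans tr _; rewrite lerD2l ge_min lexx orbT.
  by lra.
have rb : r <= b by rewrite (le_trans (ltW rt)).
have part : itv_partition a r (rcons s r).
  by split; rewrite ?last_rcons// rcons_path ps.
have := polygon_length_le gamma part; rewrite rectifiable_lengthE// lee_fin.
rewrite -cats1 polygon_length_cat /= addr0 => hr.
have /dP : a <= r <= b by rewrite ar rb.
rewrite ger0_norm ?subr_ge0 ?(ltW rt)// => /(_ ltac:(lra)).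
rewrite metric_sym => dr.
have := metric_triangle (gamma (last a s)) (gamma r) (gamma t).
by move=> tri; lra.
Qed.

(** The same argument at the first vertex; by additivity, length does not jump from the right. *)
Let right_lsc t (e : R) : a <= t -> t < b -> 0 < e -> exists2 d : R, 0 < d &
  forall r, r <= b -> r < t + d -> t < r -> len t b <= len r b + e.
Proof.
move=> at_ tb e0; have e20 : 0 < e / 2 by rewrite divr_gt0.
have [s [ps ls] hs] := rectifiable_length_adherent at_ (ltW tb) (lexx b) e20.
have [d d0 dP] := cont (t := t) (e := e / 2) ltac:(rewrite (ltW tb) at_//) e20.
case: s ps ls hs => [_ /eqP/= ta|y s /= /andP[ty ps] ls hs].
  by rewrite ta ltxx in tb.
exists (Order.min d (y - t)); first by rewrite lt_min d0 subr_gt0.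
move=> r rb rt tr.
have [tdr pr] : r < t + d /\ r < y.
  split; first by apply: lt_le_trans rt _; rewrite lerD2l ge_min lexx.
  have : r < t + (y - t).
    by apply: lt_le_trans rt _; rewrite lerD2l ge_min lexx orbT.
  by rewrite addrC subrK.
have ar : a <= r by rewrite (le_trans at_)// ltW.
have part : itv_partition r b (y :: s) by split => //=; rewrite pr ps.
have := polygon_length_le gamma part; rewrite rectifiable_lengthE// lee_fin /= => hr.
have /dP : a <= r <= b by rewrite ar rb.
rewrite ler0_norm ?subr_le0 ?(ltW tr)// => /(_ ltac:(lra)) dr.
have := metric_triangle (gamma t) (gamma r) (gamma y).
by move=> tri; lra.
Qed.

Let len_ge0 c t : c <= t -> 0 <= len c t.
Proof. by move=> ct; rewrite fine_ge0// curve_length_ge0. Qed.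

(** Intermediate value argument at the supremum of the parameters with length at most l: [left_lsc]
    shows that the supremum still has this property, [right_lsc] that its length is not smaller than
    l. *)
Lemma rectifiable_length_surj (l : R) : 0 <= l <= len a b ->
  exists t, a <= t <= b /\ curve_length gamma a t = l%:E.
Proof.
move=> /andP[l0 lL].
pose S := [set t | a <= t <= b /\ len a t <= l].
have Sa : S a by split; rewrite ?lexx ?ab// /len curve_length_refl.
have Sb : ubound S b by move=> t [/andP[]].
have supS : has_sup S by split; [exists a|exists b].
have as_ : a <= sup S by apply: ub_le_sup => //; exists b.
have sb : sup S <= b by apply: ge_sup => //; exists a.
exists (sup S); split; first by rewrite as_ sb.
rewrite rectifiable_lengthE//; congr (_%:E); apply/eqP; rewrite eq_le; apply/andP; split.
  have [[]//|nS] := pselect (S (sup S)).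
  have as' : a < sup S by rewrite lt_neqAle as_ andbT; apply/eqP => e; rewrite -e in nS.
  apply/ler_addgt0Pr => e e0.
  have [d d0 dP] := left_lsc as' sb e0.
  have [r Sr dr] := sup_adherent d0 supS.
  have rS : r <= sup S by apply: ub_le_sup => //; exists b.
  have {}rS : r < sup S by rewrite lt_neqAle rS andbT; apply/eqP => re; rewrite -re in nS.
  case: Sr => /andP[ar rb] rl.
  by apply: le_trans (dP _ ar dr rS) _; rewrite lerD2r.
have [sb'|sb'] := eqVneq (sup S) b; first by rewrite sb'.
have {}sb' : sup S < b by rewrite lt_neqAle sb'.
apply/ler_addgt0Pr => e e0.
have [d d0 dP] := right_lsc as_ sb' e0.
pose r := Order.min b (sup S + d / 2).
have rb : r <= b by rewrite ge_min lexx.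
have Sr : sup S < r by rewrite lt_min sb' ltrDl divr_gt0.
have rd : r < sup S + d.
  rewrite gt_min; apply/orP; right; rewrite ltrD2l.
  by rewrite ltr_pdivrMr// ltr_pMr// ltr1n.
have lr : l < len a r.
  rewrite ltNge; apply/negP => rl.
  have : r <= sup S.
    by apply: ub_le_sup; [exists b|split => //; rewrite rb (le_trans as_)// ltW].
  by rewrite leNgt Sr.
have := dP _ rb rd Sr.
have := @rectifiable_lengthD a (sup S) b (lexx _) as_ sb (lexx _).
have := @rectifiable_lengthD a r b (lexx _) (le_trans as_ (ltW Sr)) rb (lexx _).
by lra.
Qed.

Local Notation arc := (arc_length_param gamma a b).
Local Notation L := (len a b).

(** On [0, L] the default value of [xget] is never taken, since every length is attained. *)
Lemma arc_length_paramP (l : R) : 0 <= l <= L -> exists2 t,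
  a <= t <= b & arc l = gamma t /\ len a t = l.
Proof.
move=> /rectifiable_length_surj[t [tab tl]].
have : [set t | t \in `[a, b] /\ curve_length gamma a t = l%:E] !=set0.
  by exists t; rewrite /= in_itv/=.
rewrite /arc_length_param => /xgetPex /=.
set t' := xget _ _ => /(_ a)[]; rewrite in_itv/= => t'ab t'l.
by exists t' => //; split => //; rewrite /len t'l.
Qed.

Lemma arc_length_param_lip (l l' : R) : 0 <= l -> l <= l' -> l' <= L ->
  mdist (arc l) (arc l') <= l' - l.
Proof.
move=> l0 ll' l'L.
have [|t /andP[at_ tb] [-> tl]] := @arc_length_paramP l; first by rewrite l0 (le_trans ll').
have [|t' /andP[at' tb'] [-> tl']] := @arc_length_paramP l'; first by rewrite (le_trans l0).
have [tt|tt] := leP t t'.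
  have := rectifiable_lengthD (lexx a) at_ tt tb'.
  by have := rectifiable_mdist at_ tt tb'; lra.
have := rectifiable_lengthD (lexx a) at' (ltW tt) tb.
by have := rectifiable_mdist at' (ltW tt) tb; rewrite metric_sym; lra.
Qed.

Lemma arc_length_param0 : arc 0 = gamma a.
Proof.
have [|t /andP[at_ tb] [-> tl]] := @arc_length_paramP 0.
  by rewrite lexx len_ge0.
apply/esym/mdist_positivity/eqP; rewrite eq_le mdist_ge0 andbT.
by apply: le_trans (rectifiable_mdist _ _ _) _; rewrite ?tl ?lexx.
Qed.

Lemma arc_length_paramL : arc L = gamma b.
Proof.
have [|t /andP[at_ tb] [-> tl]] := @arc_length_paramP L.
  by rewrite lexx len_ge0.
apply/mdist_positivity/eqP; rewrite eq_le mdist_ge0 andbT.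
apply: le_trans (rectifiable_mdist at_ tb (lexx _)) _.
have := rectifiable_lengthD (lexx a) at_ tb (lexx _).
by rewrite tl; lra.
Qed.

End rectifiable.

(** * Slopes at a fixed scale *)

Section local_slope.
Context {R : realType} {X : completeMetricType R}.
Implicit Types (v : X -> R) (z : X) (t : R).

(* The diagonal pairs contribute 0, as x / 0 = 0. *)
Definition local_slope t v z : \bar R :=
  ereal_sup [set (`|v p.1 - v p.2| / mdist p.1 p.2)%:E | p in ball z t `*` ball z t].

Lemma local_slope_ge t v z p q : ball z t p -> ball z t q ->
  ((`|v p - v q| / mdist p q)%:E <= local_slope t v z)%E.
Proof. by move=> zp zq; apply: ereal_sup_ubound; exists (p, q). Qed.

Lemma local_slope_le t v z x : (forall p q, ball z t p -> ball z t q ->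
    ((`|v p - v q| / mdist p q)%:E <= x)%E) -> (local_slope t v z <= x)%E.
Proof. by move=> h; apply: ge_ereal_sup => _ [[p q] [/= zp zq] <-]; exact: h. Qed.

Lemma local_slope_ge0 t v z : 0 < t -> (0 <= local_slope t v z)%E.
Proof.
move=> t0; have zz := ball_center z (PosNum t0).
by apply: le_trans (local_slope_ge v zz zz); rewrite lee_fin divr_ge0// mdist_ge0.
Qed.

(** A pair of points witnessing a large slope at z lies in open balls around z, hence in those
    around nearby centres too: the slope is lower semicontinuous, and so Borel, for arbitrary v. *)
Lemma open_local_slope_gt t v (c : R) : open [set z | (c%:E < local_slope t v z)%E].
Proof.
rewrite openE => z /= cz.
have [_ [[p q] [/= zp zq] <-] cpq] := ereal_sup_gt cz.
move: (zp) (zq); rewrite !ballEmdist/= => dp dq.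
pose e := Order.min (t - mdist z p) (t - mdist z q).
have e0 : 0 < e by rewrite lt_min !subr_gt0 dp dq.
apply/nbhs_ballP; exists e => // y; rewrite ballEmdist/= => zy.
apply: lt_le_trans cpq _; apply: local_slope_ge; rewrite ballEmdist/=.
  apply: le_lt_trans (metric_triangle _ z _) _; rewrite metric_sym -ltrBrDr.
  by apply: lt_le_trans zy _; rewrite ge_min lexx.
apply: le_lt_trans (metric_triangle _ z _) _; rewrite metric_sym -ltrBrDr.
by apply: lt_le_trans zy _; rewrite ge_min lexx orbT.
Qed.

Lemma measurable_local_slope t v :
  measurable_fun [set: g_sigma_algebraType (@open X)] (local_slope t v).
Proof.
apply: (measurability _ (ErealGenOInfty.measurableE R)) => _ /= -[_ [r ->] <-].
rewrite setTI; apply: sub_sigma_algebra.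
rewrite (_ : _ @^-1` _ = [set z | (r%:E < local_slope t v z)%E]).
  exact: open_local_slope_gt.
by apply/seteqP; split => z /=; rewrite in_itv/= andbT.
Qed.

(** The arc-length curve is cut into pieces shorter than t. Both ends of a piece are within t of
    each of its points, so the slope is at least the difference quotient along the whole piece. The
    function v may be discontinuous, as in [annulus_nonempty]. *)
Lemma upper_gradient_local_slope t v : 0 < t ->
  upper_gradient (EFin \o v) (local_slope t v).
Proof.
move=> t0; split; [by move=> x; exact: local_slope_ge0|exact: measurable_local_slope|].
move=> gamma a b rect _; have ab : a <= b by case: rect => /ltW.
rewrite -(arc_length_param0 rect) -(arc_length_paramL rect) /line_integral.
set L := fine _; set arc := arc_length_param gamma a b => /=.
have L0 : 0 <= L by rewrite fine_ge0// curve_length_ge0.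
set h := fun s => local_slope t v (arc s).
have h0 s : (0 <= h s)%E by exact: local_slope_ge0.
pose N := (Num.truncn (L / t)).+1.
have Nt : L / N%:R < t.
  by rewrite ltr_pdivrMr ?ltr0n// mulrC -ltr_pdivrMr// truncnS_gt.
pose dl := L / N%:R; have dlt : dl < t by [].
have dl0 : 0 <= dl by rewrite divr_ge0.
(* Half-open intervals make consecutive pieces disjoint, so that their lower integrals can be
   added. *)
have claim n : (n <= N)%N -> ((`|v (arc (n%:R * dl)) - v (arc 0)|)%:E <=
    \int[lebesgue_measure]_(s in `[0%R, (n%:R * dl)%R[) h s)%E.
  elim: n => [|n ih] nN; first by rewrite mul0r subrr normr0 integral_ge0.
  pose x := n%:R * dl; pose y := n.+1%:R * dl.
  rewrite -/x -/y; have xy : y = x + dl by rewrite /y -natr1 mulrDl mul1r.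
  have x0 : 0 <= x by rewrite mulr_ge0.
  have yL : y <= L.
    have -> : L = N%:R * dl by rewrite /dl mulrC divfK// pnatr_eq0.
    by rewrite ler_wpM2r// ler_nat.
  apply: (@le_trans _ _ (\int[lebesgue_measure]_(s in `[0%R, x[) h s +
      \int[lebesgue_measure]_(s in `[x, y[) h s)%E); last first.
    apply: lower_integral_disjoint => //.
    - by apply: subset_itvl; rewrite bnd_simp xy lerDl.
    - by apply: subset_itvr; rewrite bnd_simp.
    - apply/seteqP; split => s //= []; rewrite !in_itv/= => /andP[_ sx] /andP[xs _].
      by rewrite leNgt sx in xs.
  apply: (@le_trans _ _ (`|v (arc x) - v (arc 0)|%:E + `|v (arc y) - v (arc x)|%:E)%E).
    by rewrite -EFinD lee_fin [leRHS]addrC ler_distD.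
  apply: leeD; first exact: ih (ltnW nN).
  have [d0|dn0] := eqVneq dl 0.
    by rewrite xy d0 addr0 subrr normr0 integral_ge0.
  have dp : 0 < dl by rewrite lt_neqAle eq_sym dn0.
  have -> : `|v (arc y) - v (arc x)|%:E =
      ((`|v (arc y) - v (arc x)| / dl)%:E * lebesgue_measure `[x, y[%classic)%E.
    rewrite lebesgue_measure_itv/= lte_fin xy ltrDl dp -EFinD addrAC subrr add0r.
    by rewrite -EFinM divfK.
  apply: lower_integral_ge_cst => //; first by rewrite divr_ge0.
  move=> s /=; rewrite in_itv/= => /andP[xs sy].
  have mx : mdist (arc x) (arc s) <= s - x.
    by apply: (arc_length_param_lip rect) => //; rewrite (le_trans (ltW sy)).
  have my : mdist (arc s) (arc y) <= y - s.
    by apply: (arc_length_param_lip rect) => //; rewrite ?(le_trans x0)// ltW.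
  have mxy : mdist (arc x) (arc y) <= dl.
    by have := metric_triangle (arc x) (arc s) (arc y); lra.
  have bx : ball (arc s) t (arc x) by rewrite ballEmdist/= metric_sym; lra.
  have by_ : ball (arc s) t (arc y) by rewrite ballEmdist/=; lra.
  apply: le_trans (local_slope_ge v by_ bx); rewrite lee_fin.
  have [e|e] := eqVneq (mdist (arc y) (arc x)) 0.
    by rewrite (mdist_positivity _ _ e) subrr normr0 !mul0r.
  rewrite ler_wpM2l// lef_pV2 ?posrE//; first by rewrite metric_sym.
  by rewrite lt_neqAle eq_sym e mdist_ge0.
have := claim N (leqnn _).
have -> : N%:R * dl = L by rewrite /dl mulrC divfK// pnatr_eq0.
move=> /le_trans; apply.
by apply: lower_integral_subset => //; exact: subset_itv_co_cc.
Qed.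

End local_slope.

(** * Doubling measures and mollification *)

Lemma max0_dist (R : realDomainType) (a b : R) :
  `|Num.max 0 a - Num.max 0 b| <= `|a - b|.
Proof.
rewrite /Num.max; case: ltP => a0; case: ltP => b0; rewrite ?subr0 ?sub0r ?subrr ?normr0// ?normrN.
  by rewrite !ger0_norm; lra.
by rewrite gtr0_norm// ltr0_norm; lra.
Qed.

Lemma ler_pdiv (F : realFieldType) (a b c d : F) : 0 <= a -> a <= b -> 0 < c ->
  c <= d -> a / d <= b / c.
Proof.
move=> a0 ab c0 cd; have d0 : 0 < d by exact: lt_le_trans cd.
by apply: ler_pM => //; rewrite ?invr_ge0 ?(ltW d0)// lef_pV2 ?posrE.
Qed.

Section ball_measure.
Context {R : realType} {X : completeMetricType R}.
Variables (mu : {outer_measure set X -> \bar R}) (Cmu : R).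
Hypothesis breg : borel_regular mu.
Hypothesis dbl : doubling mu Cmu.
Implicit Types (x y z p q : X) (r s t : R).

Definition vol x r : R := fine (mu (ball x r)).

Lemma open_mball x r : open (ball x r).
Proof.
rewrite openE => y; rewrite ballEmdist/= => xy.
apply/nbhs_ballP; exists (r - mdist x y) => /=; first by rewrite subr_gt0.
move=> z; rewrite !ballEmdist/= => yz.
by have := metric_triangle x y z; lra.
Qed.

Lemma ball_sub x y r s : mdist x y + r <= s -> ball y r `<=` ball x s.
Proof.
by move=> h z; rewrite !ballEmdist/= => yz; have := metric_triangle x y z; lra.
Qed.

Lemma cara_open (A : set X) : open A -> measurable (A : set (caratheodory_type mu)).
Proof. by move=> oA; apply: (proj1 breg); exact: sub_sigma_algebra. Qed.

Lemma cara_ball x r : measurable (ball x r : set (caratheodory_type mu)).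
Proof. exact/cara_open/open_mball. Qed.

Lemma cara_measurable_fun_gt (f : X -> R) :
  (forall c, measurable ([set x | c < f x] : set (caratheodory_type mu))) ->
  measurable_fun [set: caratheodory_type mu] f.
Proof.
move=> h; apply: (measurability _ (RGenOInfty.measurableE R)) => _ /= -[_ [r ->] <-].
rewrite setTI; rewrite (_ : _ @^-1` _ = [set z | r < f z]); first exact: h.
by apply/seteqP; split => z /=; rewrite in_itv/= andbT.
Qed.

Lemma cara_lipschitz_fun (f : X -> R) (t L : R) : 0 < t ->
  (forall p q, mdist p q < t -> `|f p - f q| <= L * mdist p q) ->
  measurable_fun [set: caratheodory_type mu] f.
Proof.
move=> t0 lip; apply: cara_measurable_fun_gt => c; apply: cara_open.
rewrite openE => x /= cx; apply/nbhs_ballP.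
pose e := Order.min t ((f x - c) / (`|L| + 1)).
have e0 : 0 < e by rewrite lt_min t0 divr_gt0// subr_gt0.
exists e => // y; rewrite ballEmdist/= => xy.
have xt : mdist x y < t by apply: lt_le_trans xy _; rewrite ge_min lexx.
have xe : mdist x y < (f x - c) / (`|L| + 1).
  by apply: lt_le_trans xy _; rewrite ge_min lexx orbT.
rewrite ltr_pdivlMr// in xe.
have := lip _ _ xt; have := ler_norm L; have := ler_norm (f x - f y).
have := mdist_ge0 x y => d0 ab Ll ll.
have : L * mdist x y <= `|L| * mdist x y by rewrite ler_wpM2r.
by nra.
Qed.

Lemma mdist_lip x p q : `|mdist x p - mdist x q| <= mdist p q.
Proof.
have h y z : mdist x y - mdist x z <= mdist y z.
  by rewrite lerBlDr addrC [mdist y z]metric_sym metric_triangle.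
by rewrite ler_norml h andbT lerNl opprB [mdist p q]metric_sym h.
Qed.

Lemma cara_mdist x : measurable_fun [set: caratheodory_type mu] (mdist x).
Proof.
apply: (@cara_lipschitz_fun _ 1 1) => // p q _.
by rewrite mul1r mdist_lip.
Qed.

Lemma Cmu_ge1 : 1 <= Cmu. Proof. by case: dbl. Qed.

Lemma Cmu_gt0 : 0 < Cmu. Proof. exact: lt_le_trans Cmu_ge1. Qed.

Lemma mu_ballE x r : mu (ball x r) = (vol x r)%:E.
Proof.
rewrite /vol; have [r0|r0] := ltP 0 r.
  rewrite fineK// ge0_fin_numE ?outer_measure_ge0//.
  by case: dbl => _ /(_ x _ r0)[].
rewrite (_ : ball x r = set0) ?outer_measure0//.
apply/seteqP; split => y //; rewrite ballEmdist/= => xy.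
by have := mdist_ge0 x y; lra.
Qed.

Lemma mu_measure_ballE x r : mu_measure mu (ball x r) = (vol x r)%:E.
Proof. exact: mu_ballE. Qed.

Lemma vol_gt0 x r : 0 < r -> 0 < vol x r.
Proof.
move=> r0; rewrite -lte_fin -mu_ballE.
have r20 : 0 < r / 2 by rewrite divr_gt0.
by case: dbl => _ /(_ x _ r20)[]; rewrite mulrC divfK.
Qed.

Lemma vol_ge0 x r : 0 <= vol x r.
Proof. by rewrite fine_ge0// outer_measure_ge0. Qed.

Lemma vol_le x y r s : mdist x y + r <= s -> vol y r <= vol x s.
Proof.
by move=> /ball_sub sub; rewrite -lee_fin -!mu_ballE le_outer_measure.
Qed.

Lemma vol_double x r : 0 < r -> vol x (2 * r) <= Cmu * vol x r.
Proof.
by move=> r0; case: dbl => _ /(_ x _ r0)[_]; rewrite !mu_ballE -EFinM lee_fin.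
Qed.

Lemma vol_double_exp n x r : 0 < r -> vol x (2 ^+ n * r) <= Cmu ^+ n * vol x r.
Proof.
move=> r0; elim: n => [|n ih]; first by rewrite !expr0 !mul1r.
rewrite !exprS -mulrA (le_trans (vol_double _ _))//.
  by rewrite mulr_gt0// exprn_gt0.
by rewrite -[leRHS]mulrA ler_wpM2l// ltW// Cmu_gt0.
Qed.

Lemma vol_cmp n x y r s : 0 < s -> mdist x y + r <= 2 ^+ n * s ->
  vol y r <= Cmu ^+ n * vol x s.
Proof. by move=> s0 /vol_le/le_trans; apply; exact: vol_double_exp. Qed.

Lemma ball_integrable (c : R) x r (f : X -> R) :
  measurable_fun [set: caratheodory_type mu] f -> (forall y, `|f y| <= c) ->
  (mu_measure mu).-integrable (ball x r) (EFin \o f).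
Proof.
move=> mf fc; apply: measurable_bounded_integrable.
- exact: cara_ball.
- by rewrite mu_measure_ballE ltry.
- exact: measurable_funTS.
- by exists c; split; [exact: num_real|move=> M cM y _; exact: le_trans (ltW cM)].
Qed.

Lemma Rintegral_support (D : set X) (f : X -> R) : (forall y, ~ D y -> f y = 0) ->
  \int[mu_measure mu]_(y in D) f y = \int[mu_measure mu]_y f y.
Proof.
move=> h; rewrite Rintegral_mkcond; congr (Rintegral _ _ _); apply/funext => y.
by rewrite /patch; case: ifPn => //; rewrite notin_setE => /h ->.
Qed.

End ball_measure.

Arguments ball_integrable {R X mu Cmu} breg dbl c {x r f} _ _.

Section mollification.
Context {R : realType} {X : completeMetricType R}.
Variables (mu : {outer_measure set X -> \bar R}) (Cmu : R).
Hypothesis breg : borel_regular mu.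
Hypothesis dbl : doubling mu Cmu.
Variables (f : X -> R) (t : R).
Hypothesis mf : measurable_fun [set: caratheodory_type mu] f.
Hypothesis f01 : forall x, 0 <= f x <= 1.
Hypothesis t0 : 0 < t.
Implicit Types (x y z p q : X).

Local Notation V := (vol mu).
Local Notation "\intR_ ( y 'in' D ) F" := (\int[mu_measure mu]_(y in D) F)
  (at level 36, F at level 36, y name).

Definition oscillation x (r a : R) : R :=
  (vol mu x r)^-1 * \int[mu_measure mu]_(y in ball x r) `|f y - a|.

Definition tent p y : R := Num.max 0 (1 - mdist p y / (2 * t)).

(** The Lipschitz weight makes this average locally Lipschitz in p; normalizing by the integral of
    the weight makes it reproduce constants. *)
Definition mollify p : R :=
  (\int[mu_measure mu]_y (tent p y * f y)) / \int[mu_measure mu]_y tent p y.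

Lemma tent_ge0 p y : 0 <= tent p y. Proof. by rewrite le_max lexx. Qed.

Let t20 : 0 < 2 * t. Proof. by rewrite mulr_gt0. Qed.

Lemma tent_le1 p y : tent p y <= 1.
Proof. by rewrite ge_max ler01 gerBl divr_ge0 ?mdist_ge0// ltW. Qed.

Lemma tent_ge_half p y : ball p t y -> 2^-1 <= tent p y.
Proof.
rewrite ballEmdist/= => py; rewrite le_max; apply/orP; right.
have : mdist p y / (2 * t) <= 2^-1 by rewrite ler_pdivrMr// mulrA mulVf// mul1r ltW.
by lra.
Qed.

Lemma tent_out p y : ~ ball p (2 * t) y -> tent p y = 0.
Proof.
rewrite ballEmdist/= => /negP; rewrite -leNgt => h; apply/max_idPl.
by rewrite subr_le0 ler_pdivlMr// mul1r.
Qed.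

Lemma tent_lip p q y : `|tent p y - tent q y| <= mdist p q / (2 * t).
Proof.
apply: le_trans (max0_dist _ _) _.
rewrite opprB addrC addrA subrK -mulrBl normrM.
rewrite [X in _ * X]ger0_norm ?invr_ge0 ?(ltW t20)// ler_wpM2r// ?invr_ge0 ?(ltW t20)//.
by rewrite 2![mdist _ y]metric_sym [mdist p q]metric_sym mdist_lip.
Qed.

Lemma measurable_tent p : measurable_fun [set: caratheodory_type mu] (tent p).
Proof.
apply: measurable_maxr => //; apply: measurable_funB => //.
by apply: measurable_funM => //; exact: cara_mdist.
Qed.

Lemma norm_f_le x y : `|f x - f y| <= 1.
Proof. by rewrite ler_norml; have /andP[] := f01 x; have /andP[] := f01 y; lra. Qed.

Section near_center.
Variables (x : X) (a : R).
Hypothesis a01 : 0 <= a <= 1.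

Local Notation D := (ball x (4 * t)).
Local Notation W := (vol mu x (4 * t)).
Let H := \intR_(y in D) `|f y - a|.
Let A p := \intR_(y in D) (tent p y * (f y - a)).
Let J p := \intR_(y in D) tent p y.

Let mfa : measurable_fun [set: caratheodory_type mu] (fun y => f y - a).
Proof. exact: measurable_funB. Qed.

Let fa1 y : `|f y - a| <= 1.
Proof. by rewrite ler_norml; have /andP[] := f01 y; case/andP: a01; lra. Qed.

Let iH : (mu_measure mu).-integrable D (EFin \o (fun y => `|f y - a|)).
Proof.
apply: (ball_integrable breg dbl (1)); last by move=> y; rewrite normr_id.
exact: measurableT_comp.
Qed.

Let itent p : (mu_measure mu).-integrable D (EFin \o tent p).
Proof.
apply: (ball_integrable breg dbl (1)); first exact: measurable_tent.
by move=> y; rewrite ger0_norm ?tent_ge0 ?tent_le1.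
Qed.

Let iA p : (mu_measure mu).-integrable D (EFin \o (fun y => tent p y * (f y - a))).
Proof.
apply: (ball_integrable breg dbl (1)).
  by apply: measurable_funM => //; exact: measurable_tent.
by move=> y; rewrite normrM mulr_ile1// ger0_norm ?tent_ge0 ?tent_le1.
Qed.

Let if_ p : (mu_measure mu).-integrable D (EFin \o (fun y => tent p y * f y)).
Proof.
apply: (ball_integrable breg dbl (1)).
  by apply: measurable_funM => //; exact: measurable_tent.
move=> y; rewrite normrM mulr_ile1// ger0_norm ?tent_ge0 ?tent_le1//;
  by case/andP: (f01 y).
Qed.

Let bound (k : X -> R) (c : R) : measurable_fun [set: caratheodory_type mu] k ->
  0 <= c -> (forall y, `|k y| <= c * `|f y - a|) -> `|\intR_(y in D) k y| <= c * H.
Proof.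
move=> mk c0 kc.
have ik : (mu_measure mu).-integrable D (EFin \o k).
  apply: (ball_integrable breg dbl (c)) => // y.
  by rewrite (le_trans (kc y))// ler_piMr.
have mD := cara_ball breg x (4 * t).
apply: le_trans (le_normr_Rintegral mD ik) _.
rewrite -RintegralZl//; apply: le_Rintegral => //.
- exact: integrable_norm.
- by apply: (integrableZl mD c iH).
Qed.

Let W0 : 0 < W. Proof. by apply: (vol_gt0 dbl); rewrite mulr_gt0. Qed.

(** The tent is at least 1/2 on B(p, t), and B(x, 4 t) lies in B(p, 8 t), three doublings away. *)
Let J_ge p : ball x t p -> W / (2 * Cmu ^+ 3) <= J p.
Proof.
rewrite ballEmdist/= => xp.
have C3 : 0 < Cmu ^+ 3 by rewrite exprn_gt0// (Cmu_gt0 dbl).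
have WV : W <= Cmu ^+ 3 * V p t.
  apply: (vol_cmp dbl) => //; rewrite metric_sym; have -> : 2 ^+ 3 = 8 :> R by ring.
  by move: t0; lra.
apply: (@le_trans _ _ (2^-1 * V p t)).
  rewrite invfM mulrCA ler_wpM2l// ?invr_ge0//.
  by rewrite ler_pdivrMr// [leRHS]mulrC.
have sub : ball p t `<=` D by apply: ball_sub; move: t0; lra.
rewrite -lee_fin fineK; last exact: (integrable_fin_num (cara_ball breg _ _) (itent p)).
rewrite EFinM -(mu_measure_ballE dbl).
apply: (@lower_integral_ge_cst _ _ _ (mu_measure mu)) => //.
- exact: cara_ball.
- by move=> y _; rewrite lee_fin tent_ge0.
- by move=> y py; rewrite lee_fin; exact: tent_ge_half.
Qed.

Let JT p : ball x t p -> \int[mu_measure mu]_y tent p y = J p.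
Proof.
rewrite ballEmdist/= => xp; rewrite /J Rintegral_support// => y nD.
apply: tent_out => py; apply: nD; move: py; apply: ball_sub.
by move: t0; lra.
Qed.

(** Taking out the constant a before averaging leaves A p, an integral of f - a; this is how the
    oscillation about a enters all later bounds. *)
Let mollifyE p : ball x t p -> mollify p = a + A p / J p.
Proof.
move=> xp; have J0 : J p != 0.
  rewrite gt_eqF// (lt_le_trans _ (J_ge xp))// divr_gt0//.
  by rewrite mulr_gt0// exprn_gt0// (Cmu_gt0 dbl).
rewrite /mollify (JT xp).
rewrite -(@Rintegral_support _ _ _ D); last first.
  move=> y nD; rewrite tent_out ?mul0r// => py; apply: nD; move: py; apply: ball_sub.
  by move: xp; rewrite ballEmdist/= => xp; move: t0; lra.
have -> : A p = \intR_(y in D) (tent p y * f y) - a * J p.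
  have mD := cara_ball breg x (4 * t).
  rewrite /A /J -RintegralZl// -RintegralB//.
    by apply: eq_Rintegral => y _; ring.
  by apply: (integrableZl mD a (itent p)).
by field.
Qed.

Let A_le p : `|A p| <= H.
Proof.
rewrite -[leRHS]mul1r; apply: bound => //.
  by apply: measurable_funM => //; exact: measurable_tent.
by move=> y; rewrite normrM ler_wpM2r// ger0_norm ?tent_ge0 ?tent_le1.
Qed.

Let A_lip p q : `|A p - A q| <= mdist p q / (2 * t) * H.
Proof.
rewrite /A -RintegralB//; last exact: cara_ball.
apply: bound => //.
- by apply: measurable_funB; apply: measurable_funM => //; exact: measurable_tent.
- by rewrite divr_ge0 ?mdist_ge0// ltW.
- by move=> y; rewrite -mulrBl normrM ler_wpM2r// tent_lip.
Qed.

Let J_lip p q : `|J p - J q| <= mdist p q / (2 * t) * W.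
Proof.
have mD := cara_ball breg x (4 * t).
rewrite /J -RintegralB//.
apply: le_trans (le_normr_Rintegral _ _) _ => //.
  by apply: (integrableB mD (itent p) (itent q)).
have -> : mdist p q / (2 * t) * W =
    \intR_(y in D) (mdist p q / (2 * t)) by rewrite Rintegral_cst.
apply: le_Rintegral => //.
- by apply: integrable_norm => //; apply: (integrableB mD (itent p) (itent q)).
- apply: (ball_integrable breg dbl `|mdist p q / (2 * t)|) => //.
- by move=> y _; exact: tent_lip.
Qed.

Let H0 : 0 <= H. Proof. by apply: Rintegral_ge0. Qed.

(** Difference of the quotients A / J. Here A is at most H and J at least a fixed fraction of W,
    with Lipschitz constants H / (2 t) and W / (2 t). The two terms cost [Cmu ^+ 3] and
    [2 * Cmu ^+ 6]. *)
Lemma mollify_lip p q : ball x t p -> ball x t q ->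
  `|mollify p - mollify q| <=
    3 * Cmu ^+ 6 / t * oscillation x (4 * t) a * mdist p q.
Proof.
move=> xp xq; rewrite (mollifyE xp) (mollifyE xq) /oscillation -/H.
set c := W / (2 * Cmu ^+ 3).
have C3 : 1 <= Cmu ^+ 3 by rewrite exprn_ege1// (Cmu_ge1 dbl).
have c0 : 0 < c by rewrite divr_gt0// mulr_gt0// (lt_le_trans ltr01).
have Jp := J_ge xp; have Jq := J_ge xq; rewrite -/c in Jp Jq.
have Jp0 : 0 < J p by exact: lt_le_trans Jp.
have Jq0 : 0 < J q by exact: lt_le_trans Jq.
have -> : a + A p / J p - (a + A q / J q) =
    (A p - A q) / J p - A q / J q * ((J p - J q) / J p).
  by field; rewrite !gt_eqF.
set e := mdist p q / (2 * t); have e0 : 0 <= e.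
  by rewrite divr_ge0 ?mdist_ge0// ltW.
apply: (@le_trans _ _ (e * H / c + H / c * (e * W / c))).
  apply: le_trans (ler_normB _ _) _; rewrite !normrM !normfV.
  rewrite (gtr0_norm Jp0) (gtr0_norm Jq0).
  apply: lerD; first by apply: ler_pdiv => //; exact: A_lip.
  apply: ler_pM; rewrite ?divr_ge0 ?(ltW Jp0) ?(ltW Jq0)//.
    by apply: ler_pdiv => //; exact: A_le.
  by apply: ler_pdiv => //; exact: J_lip.
have -> : e * H / c + H / c * (e * W / c) =
    (Cmu ^+ 3 + 2 * (Cmu ^+ 3 * Cmu ^+ 3)) / t * (W^-1 * H) * mdist p q.
  rewrite /e /c; field; rewrite gt_eqF// gt_eqF ?(vol_gt0 dbl) ?mulr_gt0//=.
  by rewrite gt_eqF// (Cmu_gt0 dbl).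
have -> : 3 * Cmu ^+ 6 = Cmu ^+ 3 * Cmu ^+ 3 + 2 * (Cmu ^+ 3 * Cmu ^+ 3) by ring.
rewrite ler_wpM2r ?mdist_ge0// ler_wpM2r//.
  by rewrite mulr_ge0// invr_ge0 ltW.
by rewrite ler_wpM2r ?invr_ge0 ?(ltW t0)// lerD2r ler_peMr// (le_trans ler01).
Qed.

Lemma mollify_dist : `|a - mollify x| <= 2 * Cmu ^+ 3 * oscillation x (4 * t) a.
Proof.
have xx : ball x t x by rewrite ballEmdist/= mdistxx.
rewrite (mollifyE xx) opprD addrA subrr add0r normrN normrM normfV /oscillation -/H.
have C3 : 0 < Cmu ^+ 3 by rewrite exprn_gt0// (Cmu_gt0 dbl).
set c := W / (2 * Cmu ^+ 3).
have c0 : 0 < c by rewrite divr_gt0// mulr_gt0.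
have Jx0 : 0 < J x by exact: lt_le_trans (J_ge xx).
apply: (@le_trans _ _ (H / c)).
  rewrite (gtr0_norm Jx0); apply: ler_pdiv => //; exact: J_ge.
by rewrite le_eqVlt; apply/orP; left; apply/eqP; rewrite /c; field; rewrite !gt_eqF// (Cmu_gt0 dbl).
Qed.

Lemma oscillation_le1 : oscillation x (4 * t) a <= 1.
Proof.
rewrite /oscillation mulrC ler_pdivrMr// mul1r.
rewrite -[leRHS]mul1r -Rintegral_cst; last exact: cara_ball.
apply: le_Rintegral => //; first exact: cara_ball.
by apply: (ball_integrable breg dbl (1)) => // y; rewrite normr1.
Qed.

End near_center.

Lemma mollify_cst_ge0 : 0 <= 3 * Cmu ^+ 6 / t.
Proof.
by rewrite divr_ge0 ?(ltW t0)// mulr_ge0// exprn_ge0// (ltW (Cmu_gt0 dbl)).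
Qed.

Lemma mollify_lipschitz p q : mdist p q < t ->
  `|mollify p - mollify q| <= 3 * Cmu ^+ 6 / t * mdist p q.
Proof.
move=> pq; have pp : ball p t p by rewrite ballEmdist/= mdistxx.
have bq : ball p t q by rewrite ballEmdist.
apply: le_trans (mollify_lip (f01 p) pp bq) _.
rewrite ler_wpM2r ?mdist_ge0//.
by rewrite ler_piMr ?oscillation_le1// mollify_cst_ge0.
Qed.

Lemma measurable_mollify : measurable_fun [set: caratheodory_type mu] mollify.
Proof.
apply: (cara_lipschitz_fun breg t0) => p q; exact: mollify_lipschitz.
Qed.

Lemma mollify_norm_le p : `|mollify p| <= 1 + 2 * Cmu ^+ 3.
Proof.
have := mollify_dist p (f01 p).
have C3 : 0 <= 2 * Cmu ^+ 3 by rewrite mulr_ge0// exprn_ge0// (ltW (Cmu_gt0 dbl)).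
have := oscillation_le1 p (f01 p) => o1 h.
have : 2 * Cmu ^+ 3 * oscillation p (4 * t) (f p) <= 2 * Cmu ^+ 3.
  by rewrite -[leRHS]mulr1 ler_wpM2l.
have := ler_distD (f p) (mollify p) 0; rewrite !subr0 [`|mollify p - _|]distrC.
have : `|f p| <= 1 by rewrite ger0_norm; case/andP: (f01 p).
by lra.
Qed.

Lemma oscillation_ge0 x r a : 0 <= oscillation x r a.
Proof. by rewrite mulr_ge0 ?invr_ge0 ?vol_ge0// Rintegral_ge0. Qed.

Lemma local_slope_mollify x : (local_slope t mollify x <=
  (3 * Cmu ^+ 6 / t * oscillation x (4 * t) (f x))%:E)%E.
Proof.
apply: local_slope_le => p q xp xq; rewrite lee_fin.
have := mdist_ge0 p q; rewrite le_eqVlt => /predU1P[<-|pq].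
  by rewrite invr0 mulr0 mulr_ge0 ?mollify_cst_ge0 ?oscillation_ge0.
by rewrite ler_pdivrMr// mollify_lip.
Qed.

End mollification.

(** * A weak-type Poincaré estimate *)

Lemma sum_geometric_half_le (R : realType) (c : R) n : 0 <= c ->
  \sum_(0 <= j < n) c * 2^-1 ^+ j <= 2 * c.
Proof.
move=> c0; have -> : \sum_(0 <= j < n) c * 2^-1 ^+ j = 2 * c - 2 * c * 2^-1 ^+ n.
  elim: n => [|n ih]; first by rewrite big_geq// expr0 mulr1 subrr.
  by rewrite big_nat_recr//= ih exprS; field.
by rewrite gerBl !mulr_ge0// exprn_ge0// invr_ge0.
Qed.

Lemma sum_seq_ge (F : realFieldType) (I : eqType) (s : seq I) (h : I -> F) (m : F) :
  {in s, forall i, m <= h i} -> (size s)%:R * m <= \sum_(i <- s) h i.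
Proof.
elim: s => [|i s ih] hs; first by rewrite big_nil mul0r.
rewrite big_cons -natr1 mulrDl mul1r addrC lerD//; first by apply: hs; rewrite inE eqxx.
by apply: ih => j js; apply: hs; rewrite inE js orbT.
Qed.

Lemma powR_exprn (R : realType) (x r : R) n : 0 <= x ->
  (x ^+ n) `^ r = (x `^ r) ^+ n.
Proof.
move=> x0; elim: n => [|n ih]; first by rewrite !expr0 powR1.
by rewrite !exprS powRM ?exprn_ge0// ih.
Qed.

Lemma powR_1B (R : realType) (x r : R) : 0 < x -> x `^ (1 - r) = x / x `^ r.
Proof.
move=> x0; rewrite powRB ?powRr1 ?(ltW x0)//.
by rewrite (gt_eqF x0) implybT.
Qed.

(** * Covering by balls of a single radius *)

Section covering.
Context {R : realType} {X : completeMetricType R}.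
Variables (mu : {outer_measure set X -> \bar R}) (Cmu : R).
Hypothesis dbl : doubling mu Cmu.
Implicit Types (x y z p q : X) (A D : set X).

Lemma outer_measure_seq_cover (s : seq X) (F : X -> set X) :
  (mu [set x | exists2 p, p \in s & F p x] <= \sum_(p <- s) mu (F p))%E.
Proof.
elim: s => [|p s ih].
  rewrite big_nil (_ : [set x | _] = set0) ?outer_measure0//.
  by apply/seteqP; split => x // [].
rewrite big_cons; apply: le_trans (leeD2l _ ih).
apply: le_trans (outer_measureU2 _ _ _); apply: le_outer_measure.
move=> x [q]; rewrite inE => /predU1P[->|qs] Fqx; first by left.
by right; exists q.
Qed.

(* A maximal disjoint family of balls of radius rho centred in A is finite since
   each of them carries at least the fraction c m0 of the integral of g. *)
Lemma single_scale_cover (g : X -> \bar R) D A (rho c m0 : R) :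
  (forall x, (0 <= g x)%E) -> 0 < rho -> 0 < c -> 0 < m0 ->
  (forall x, A x -> m0 <= vol mu x rho) ->
  (forall x, A x -> ball x rho `<=` D) ->
  (forall x, A x ->
    ((c * vol mu x rho)%:E <= \int[mu_measure mu]_(y in ball x rho) g y)%E) ->
  (c%:E * mu A <= Cmu%:E * \int[mu_measure mu]_(y in D) g y)%E.
Proof.
move=> g0 rho0 c0 m00 Am AD Ag.
have Cmu0 := Cmu_gt0 dbl.
set G := (\int[mu_measure mu]_(y in D) g y)%E.
have G0 : (0 <= G)%E by rewrite integral_ge0.
have [Goo|Gfin] := eqVneq G +oo%E; first by rewrite Goo gt0_muley ?leey// lte_fin.
have {}Gfin : G \is a fin_num by rewrite ge0_fin_numE// ltey.
pose good (s : seq X) := [/\ uniq s, {in s, forall p, A p} &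
  {in s &, forall p q, p != q -> ball p rho `&` ball q rho = set0}].
have goodle s : good s -> (\sum_(p <- s) (c * vol mu p rho)%:E <= G)%E.
  move=> [us sA sd]; apply: (@le_trans _ _
      (\sum_(p <- s) \int[mu_measure mu]_(y in ball p rho) g y)%E).
    rewrite big_seq [leRHS]big_seq; apply: lee_sum => p ps; apply: Ag; exact: sA.
  apply: lower_integral_disjoint_sum => //.
    by move=> p ps; apply: AD; exact: sA.
have goodsz s : good s -> (size s)%:R <= fine G / (c * m0).
  move=> gs; have := goodle _ gs; rewrite sumEFin -[G in (_ <= G)%E]fineK// lee_fin.
  rewrite ler_pdivlMr ?mulr_gt0//; apply: le_trans; apply: sum_seq_ge => p ps.
  by case: gs => _ sA _; rewrite ler_pM2l// Am//; exact: sA.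
pose P n := `[< exists2 s, good s & size s = n >].
have exP : exists n, P n.
  by exists 0%N; apply/asboolP; exists [::] => //; split.
have ubP n : P n -> (n <= Num.truncn (fine G / (c * m0)))%N.
  move=> /asboolP[s gs <-]; rewrite -(ler_nat R).
  have := goodsz _ gs; set b := fine G / _ => sb.
  rewrite ler_nat -ltnS -(ltr_nat R); apply: le_lt_trans sb _; exact: truncnS_gt.
case: (ex_maxnP exP ubP) => n /asboolP[s gs sn] nmax.
have [us sA sd] := gs.
(* By maximality the ball of radius rho around any point of A meets a chosen one, so the doubled
   balls cover A, at the cost of one factor [Cmu]. *)
have cov : A `<=` [set x | exists2 p, p \in s & ball p (2 * rho) x].
  move=> x Ax; apply: contrapT => nx.
  have xs p : p \in s -> ball x rho `&` ball p rho = set0.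
    move=> ps; apply/seteqP; split => z //= []; rewrite !ballEmdist/= => xz pz.
    apply: nx; exists p => //; rewrite ballEmdist/=.
    by have := metric_triangle p z x; rewrite [mdist z x]metric_sym; lra.
  suff /nmax : P n.+1 by rewrite ltnn.
  apply/asboolP; exists (x :: s); last by rewrite /= sn.
  split=> [|p|p q].
  - rewrite /= us andbT; apply/negP => /xs; apply/eqP/set0P.
    by exists x; split; rewrite ballEmdist/= mdistxx.
  - by rewrite inE => /predU1P[->//|]; exact: sA.
  - rewrite !inE => /predU1P[->|ps] /predU1P[->|qs]; rewrite ?eqxx// => pq.
    + exact: xs.
    + by rewrite setIC; exact: xs.
    + exact: sd.
apply: (@le_trans _ _ (c%:E * \sum_(p <- s) (mu (ball p (2 * rho))))%E).
  rewrite lee_pmul2l//; apply: le_trans (outer_measure_seq_cover _ _).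
  exact: le_outer_measure.
apply: (@le_trans _ _ (Cmu%:E * \sum_(p <- s) (c * vol mu p rho)%:E)%E).
  rewrite sumEFin (eq_bigr (fun p => (vol mu p (2 * rho))%:E)).
    rewrite sumEFin -!EFinM lee_fin !mulr_sumr; apply: ler_sum => p _.
    by rewrite mulrCA ler_pM2l//; exact: (vol_double dbl).
  by move=> p _; rewrite (mu_ballE dbl).
by rewrite lee_pmul2l//; exact: goodle.
Qed.

End covering.

(** * Chaining the Poincaré inequality over shrinking balls *)

Section weak_poincare.
Context {R : realType} {X : completeMetricType R}.
Variables (mu : {outer_measure set X -> \bar R}) (Cmu CP tauP c0 Q : R).
Hypothesis breg : borel_regular mu.
Hypothesis dbl : doubling mu Cmu.
Hypothesis poin : poincare11 mu CP tauP.
Hypothesis c00 : 0 < c0.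
Hypothesis Q1 : 1 < Q.
Hypothesis ahl : forall x r, 0 < r -> c0 * r `^ Q <= vol mu x r.
Implicit Types (x y z : X) (r s : R).

Definition average (v : X -> R) x r : R :=
  (vol mu x r)^-1 * \int[mu_measure mu]_(y in ball x r) v y.

Let CP1 : 1 <= CP. Proof. by case: poin. Qed.
Let CP0 : 0 < CP. Proof. exact: lt_le_trans CP1. Qed.
Let tau1 : 1 <= tauP. Proof. by case: poin. Qed.
Let tau0 : 0 < tauP. Proof. exact: lt_le_trans tau1. Qed.
Let Cmu0 : 0 < Cmu. Proof. exact: Cmu_gt0 dbl. Qed.

Lemma mean_average (v : X -> R) (M : R) x r : 0 < r ->
  measurable_fun [set: caratheodory_type mu] v -> (forall y, `|v y| <= M) ->
  mean mu (ball x r) (EFin \o v) = (average v x r)%:E.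
Proof.
move=> r0 mv vM; rewrite /mean /average (mu_ballE dbl).
rewrite inver gt_eqF ?(vol_gt0 dbl)// EFinM; congr (_ * _)%E.
rewrite fineK//.
exact: (integrable_fin_num (cara_ball breg _ _) (ball_integrable breg dbl M mv vM)).
Qed.

Section fixed_function.
Variables (v : X -> R) (g : X -> \bar R) (M : R).
Hypothesis mv : measurable_fun [set: caratheodory_type mu] v.
Hypothesis vM : forall y, `|v y| <= M.
Hypothesis ug : upper_gradient (EFin \o v) g.

Lemma upper_gradient_ge0 x : (0 <= g x)%E. Proof. by case: ug. Qed.
Local Notation g0 := upper_gradient_ge0.

(** The Poincaré inequality on the larger ball; passing from its mean oscillation to the one over
    B(y, s) costs the ratio K of the volumes. *)
Lemma average_dist (K : R) x y r s : 0 < s -> 0 < r -> ball y s `<=` ball x r ->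
  vol mu x r <= K * vol mu y s ->
  (`|average v y s - average v x r|%:E <=
   (K * (CP * r) / vol mu x (tauP * r))%:E *
     \int[mu_measure mu]_(z in ball x (tauP * r)) g z)%E.
Proof.
move=> s0 r0 sub Kv.
have Vs := vol_gt0 dbl y s0; have Vr := vol_gt0 dbl x r0.
have Vt := vol_gt0 dbl x (mulr_gt0 tau0 r0).
have K0 : 0 < K by rewrite -(pmulr_lgt0 _ Vs); exact: lt_le_trans Kv.
case: poin => _ _ /(_ x r r0 (EFin \o v) g _ ug).
have L1v : L1loc mu (EFin \o v).
  by move=> z; exists 1 => //; exact: (ball_integrable breg dbl M).
move=> /(_ L1v); rewrite (mean_average _ r0 mv vM) => h.
set a := average v x r in h *.
have mva : measurable_fun [set: caratheodory_type mu] (fun z => v z - a).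
  exact: measurable_funB.
have mna : measurable_fun [set: caratheodory_type mu] (fun z => `|v z - a|).
  exact: measurableT_comp.
have vaM z : `|v z - a| <= M + `|a| by rewrite (le_trans (ler_normB _ _))// lerD2r.
have i1 u r' : (mu_measure mu).-integrable (ball u r') (EFin \o (fun z => v z - a)).
  exact: (ball_integrable breg dbl (M + `|a|)).
have i2 u r' : (mu_measure mu).-integrable (ball u r') (EFin \o (fun z => `|v z - a|)).
  by apply: (ball_integrable breg dbl (M + `|a|)) => // z; rewrite normr_id.
rewrite (_ : (fun z => _) = EFin \o (fun z => `|v z - a|)) in h; last first.
  by apply/funext.
rewrite (@mean_average _ (M + `|a|) _ _ r0 mna) in h; last by move=> z; rewrite normr_id.
rewrite /mean (mu_ballE dbl) inver gt_eqF// in h.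
have -> : average v y s - a =
    (vol mu y s)^-1 * \int[mu_measure mu]_(z in ball y s) (v z - a).
  have mB := cara_ball breg y s.
  rewrite RintegralB//; last 2 first.
  - exact: (ball_integrable breg dbl M).
  - by apply: (ball_integrable breg dbl `|a|) => // z; rewrite ?lexx.
  rewrite Rintegral_cst// -/(vol mu y s) mulrBr mulrCA mulVf ?mulr1//.
  by rewrite gt_eqF.
have sub1 : \int[mu_measure mu]_(z in ball y s) `|v z - a| <=
    \int[mu_measure mu]_(z in ball x r) `|v z - a|.
  rewrite -lee_fin !fineK; last 2 first.
  - exact: (integrable_fin_num (cara_ball breg _ _) (i2 _ _)).
  - exact: (integrable_fin_num (cara_ball breg _ _) (i2 _ _)).
  by apply: lower_integral_subset => // z _; rewrite lee_fin.
apply: (@le_trans _ _ (K * average (fun z => `|v z - a|) x r)%:E).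
  rewrite lee_fin normrM normfV (gtr0_norm Vs) /average mulrA.
  apply: ler_pM => //; first by rewrite invr_ge0 ltW.
    by rewrite -[_ / _]invf_div lef_pV2 ?posrE ?divr_gt0// ler_pdivrMr// mulrC.
  by apply: le_trans sub1; apply: le_normr_Rintegral => //; exact: cara_ball.
rewrite EFinM; apply: (@le_trans _ _ (K%:E * ((CP * r)%:E * ((vol mu x (tauP * r))^-1%:E *
   \int[mu_measure mu]_(z in ball x (tauP * r)) g z)))%E).
  by rewrite lee_pmul2l.
by rewrite !muleA -!EFinM.
Qed.

Variables (x0 : X) (r0 : R).
Hypothesis r00 : 0 < r0.

Local Notation D := (ball x0 ((1 + 2 * tauP) * r0)).
Let G := (\int[mu_measure mu]_(z in D) g z)%E.

(** The radius 2 r0 makes the first ball around x contain B(x0, r0). The ratio 4 leaves a factor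
    2^-j after division by the weights 2^-j, so that the measures of the covered sets can be
    summed. *)
Let rk (k : nat) : R := 2 * r0 / 4 ^+ k.

Let rk0 k : 0 < rk k. Proof. by rewrite divr_gt0 ?mulr_gt0// exprn_gt0. Qed.

Let rkS k : rk k = 4 * rk k.+1.
Proof. by rewrite /rk exprS; field; rewrite expf_neq0. Qed.

Let rk_le k : rk k <= 2 * r0.
Proof.
by rewrite ler_pdivrMr ?exprn_gt0// ler_peMr ?mulr_ge0 ?(ltW r00)// exprn_ege1// ler1n.
Qed.

Let sub_D x k : ball x0 r0 x -> ball x (tauP * rk k) `<=` D.
Proof.
rewrite ballEmdist/= => xx; apply: ball_sub.
have : tauP * rk k <= tauP * (2 * r0) by rewrite ler_wpM2l ?rk_le// ltW.
by lra.
Qed.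

Let I x k := (\int[mu_measure mu]_(z in ball x (tauP * rk k)) g z)%E.

Let IG x k : ball x0 r0 x -> (I x k <= G)%E.
Proof.
move=> xx; apply: lower_integral_subset => [|z _]; [exact: sub_D|exact: g0].
Qed.

Let I0 x k : (0 <= I x k)%E.
Proof. by apply: integral_ge0 => z _; exact: g0. Qed.

Let T x k : R := Cmu ^+ 2 * (CP * rk k) / vol mu x (tauP * rk k) * fine (I x k).

Let T0 x k : 0 <= T x k.
Proof.
rewrite mulr_ge0 ?fine_ge0 ?I0// divr_ge0 ?vol_ge0// mulr_ge0 ?exprn_ge0 ?(ltW Cmu0)//.
by rewrite mulr_ge0// ltW.
Qed.

Hypothesis Gfin : (G < +oo)%E.

Let If x k : ball x0 r0 x -> I x k \is a fin_num.
Proof. by move=> /IG h; rewrite ge0_fin_numE ?I0//; exact: le_lt_trans (h k) Gfin. Qed.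

Let step0 x : ball x0 r0 x ->
  `|average v x0 r0 - average v x (rk 0)| <= T x 0.
Proof.
move=> xx; move: (xx); rewrite ballEmdist/= => dx.
rewrite -lee_fin EFinM fineK ?If//.
have rk0E : rk 0 = 2 * r0 by rewrite /rk expr0 divr1.
apply: average_dist => //.
  by apply: ball_sub; rewrite rk0E metric_sym; lra.
apply: (vol_cmp dbl) => //; rewrite rk0E.
have -> : 2 ^+ 2 = 4 :> R by ring.
by move: r00; lra.
Qed.

Let stepS x k : ball x0 r0 x ->
  `|average v x (rk k.+1) - average v x (rk k)| <= T x k.
Proof.
move=> xx; rewrite -lee_fin EFinM fineK ?If//.
apply: average_dist => //.
  by apply: ball_sub; rewrite mdistxx add0r [leRHS]rkS; have := rk0 k.+1; lra.
apply: (vol_cmp dbl) => //; rewrite mdistxx add0r rkS.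
by have -> : 2 ^+ 2 = 4 :> R by ring.
Qed.

(** [T x 0] pays both for the passage from B(x0, r0) to the first ball around x and for the first
    shrinking step; the factor 2 covers this. *)
Let chain x n : ball x0 r0 x ->
  `|average v x (rk n) - average v x0 r0| <= 2 * \sum_(0 <= k < n.+1) T x k.
Proof.
move=> xx; apply: (@le_trans _ _ (T x 0 + \sum_(0 <= k < n) T x k)).
  elim: n => [|n ih]; first by rewrite big_geq// addr0 distrC step0.
  rewrite big_nat_recr//= addrA.
  have := ler_distD (average v x (rk n)) (average v x (rk n.+1)) (average v x0 r0).
  have := stepS n xx.
  by lra.
rewrite mulrDl mul1r lerD//.
  by rewrite big_nat_recl// lerDl sumr_ge0// => k _; exact: T0.
by rewrite big_nat_recr//= lerDl.
Qed.

Hypothesis cv : forall x (e : R), 0 < e ->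
  exists2 d, 0 < d & forall y, mdist x y < d -> `|v x - v y| <= e.

Let average_near x (e : R) : 0 < e -> exists n, `|v x - average v x (rk n)| <= e.
Proof.
move=> e0; have [d d0 dv] := cv x e0.
pose n := Num.truncn (2 * r0 / d).
have rn : rk n < d.
  rewrite /rk ltr_pdivrMr ?exprn_gt0// [ltRHS]mulrC -ltr_pdivrMr//.
  apply: lt_le_trans (truncnS_gt _) _.
  by rewrite -/n -natrX ler_nat ltn_expl.
exists n; set r := rk n in rn *; have Vr := vol_gt0 dbl x (rk0 n).
have h (c : R) : \int[mu_measure mu]_(y in ball x r) c = c * vol mu x r.
  by rewrite Rintegral_cst//; exact: cara_ball.
have ic (c : R) : (mu_measure mu).-integrable (ball x r) (EFin \o (fun=> c)).
  by apply: (ball_integrable breg dbl `|c|).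
have iv : (mu_measure mu).-integrable (ball x r) (EFin \o v).
  exact: (ball_integrable breg dbl M).
have mB := cara_ball breg x r.
have near_x y : ball x r y -> `|v x - v y| <= e.
  by rewrite ballEmdist/= => xy; apply: dv; exact: lt_trans rn.
have lo : (v x - e) * vol mu x r <= \int[mu_measure mu]_(y in ball x r) v y.
  rewrite -h; apply: le_Rintegral => // y /near_x.
  by rewrite ler_norml; lra.
have hi : \int[mu_measure mu]_(y in ball x r) v y <= (v x + e) * vol mu x r.
  rewrite -h; apply: le_Rintegral => // y /near_x.
  by rewrite ler_norml; lra.
have hi' : average v x r <= v x + e by rewrite /average mulrC ler_pdivrMr.
have lo' : v x - e <= average v x r by rewrite /average mulrC ler_pdivlMr.
by rewrite ler_norml; lra.
Qed.

Variables (A : set X) (lam : R) (k1 : nat).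
Hypothesis lam0 : 0 < lam.
Hypothesis AB : A `<=` ball x0 r0.
Hypothesis Alam : forall x, A x -> lam <= `|v x - average v x0 r0|.

Let q : R := 4 `^ (1 - Q).

Let q01 : 0 < q < 1.
Proof.
rewrite /q powR_gt0//= /powR gt_eqF// -[ltRHS]expR0 ltr_expR.
by rewrite pmulr_llt0 ?ln_gt0 ?ltr1n// subr_lt0.
Qed.

(** Weights for a pigeonhole over the scales, each branch having sum at most 1/2. For k < k1 they
    are proportional to the power 1 - Q of [rk k], so that all these scales lead to the same bound;
    from k1 on, the decay 2^-j is slower than that of the radii. *)
Let weight k : R := if (k < k1)%N then q ^+ (k1 - k) * (1 - q) / 2
  else 4^-1 * 2^-1 ^+ (k - k1).

Let weight0 k : 0 <= weight k.
Proof.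
rewrite /weight; case: ifP => _; last by rewrite mulr_ge0 ?exprn_ge0.
by case/andP: q01 => q0 q1; rewrite divr_ge0// mulr_ge0 ?exprn_ge0 ?subr_ge0 ?ltW.
Qed.

Let weight_sum n : \sum_(0 <= k < n) weight k < 1.
Proof.
apply: (@le_lt_trans _ _ (\sum_(0 <= k < k1 + n) weight k)).
  rewrite addnC (big_cat_nat (leq0n n) (leq_addr _ _))/= lerDl.
  by apply: sumr_ge0 => k _; exact: weight0.
rewrite (big_cat_nat (leq0n k1) (leq_addr _ _))/=.
have [q0 q1] : 0 < q /\ q < 1 by case/andP: q01.
have -> : \sum_(0 <= k < k1) weight k = (q - q ^+ k1.+1) / 2.
  rewrite (eq_big_nat _ _ (F2 := fun k => q ^+ (k1 - k) * (1 - q) / 2)); last first.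
    by move=> k /andP[_ kk]; rewrite /weight kk.
  elim: k1 => [|m ih]; first by rewrite big_geq// expr1 subrr mul0r.
  rewrite big_nat_recl// subn0; under eq_bigr do rewrite subSS.
  by rewrite ih !exprS; field.
have -> : \sum_(k1 <= k < k1 + n) weight k = \sum_(0 <= j < n) 4^-1 * 2^-1 ^+ j.
  rewrite -{1}[k1]add0n big_addn addKn; apply: eq_big_nat => j _.
  by rewrite /weight ltnNge leq_addl/= addnK.
have := sum_geometric_half_le n (_ : 0 <= 4^-1 :> R).
move=> /(_ ltac:(by rewrite invr_ge0)).
have : 0 < q ^+ k1.+1 by rewrite exprn_gt0.
by lra.
Qed.

(** Otherwise the whole chain would move the average by less than lam / 2, whereas v x differs from
    the first average by lam and from a fine one by at most lam / 2. *)
Let scale_exists x : A x -> exists k, lam / 4 * weight k <= T x k.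
Proof.
move=> Ax; have xx := AB Ax.
have [n vn] : exists n, `|v x - average v x (rk n)| <= lam / 2.
  by apply: average_near; rewrite divr_gt0.
have := ler_distD (average v x (rk n)) (v x) (average v x0 r0).
have := Alam Ax; have := chain n xx => h1 h2 h3.
have {h1 h2 h3}big : lam / 4 <= \sum_(0 <= k < n.+1) T x k by lra.
apply: contrapT => nk.
have : \sum_(0 <= k < n.+1) T x k <= lam / 4 * \sum_(0 <= k < n.+1) weight k.
  rewrite mulr_sumr; apply: ler_sum => k _; rewrite leNgt; apply/negP => /ltW kk.
  by apply: nk; exists k.
have := weight_sum n.+1; set S := \sum_(0 <= k < _) weight k => S1.
have : lam / 4 * S < lam / 4 * 1 by rewrite ltr_pM2l// divr_gt0.
by lra.
Qed.

Let rkD k : (k <= k1)%N -> rk k = 4 ^+ (k1 - k) * rk k1.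
Proof.
move=> kk; rewrite /rk -{2}(subnK kk) exprD invfM.
by field; rewrite !expf_neq0.
Qed.

Let rkA j : rk (k1 + j) = rk k1 / 4 ^+ j.
Proof. by rewrite /rk exprD invfM mulrA. Qed.

(** Either some point of A is served by a scale k < k1, and lower regularity bounds lam, or every
    point is served by a scale k >= k1, and A is covered scale by scale. The threshold k1 is left
    free; it will be the scale of m^(1/Q). *)
Lemma weak_poincare :
  (mu A <= (32 * Cmu ^+ 3 * CP * (2 * r0 / 4 ^+ k1) / lam * fine G)%:E)%E \/
  ((0 < k1)%N /\ lam <= 8 * Cmu ^+ 2 * CP / (c0 * (1 - 4 `^ (1 - Q))) *
     (2 * r0 / 4 ^+ k1) `^ (1 - Q) * fine G).
Proof.
rewrite -/(rk k1) -/q; have [q0 q1] : 0 < q /\ q < 1 by case/andP: q01.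
have G0 : 0 <= fine G by rewrite fine_ge0// integral_ge0// => z _; exact: g0.
have GK : (fine G)%:E = G.
  by rewrite fineK// ge0_fin_numE// integral_ge0// => z _; exact: g0.
have [[x [k [Ax kk1 hT]]]|nA] :=
    pselect (exists x k, [/\ A x, (k < k1)%N & lam / 4 * weight k <= T x k]).
  right; split; first exact: leq_trans kk1.
  have rp := rk0 k; have rp1 := rk0 k1.
  have rkQ : rk k `^ (1 - Q) = q ^+ (k1 - k) * rk k1 `^ (1 - Q).
    rewrite rkD ?(ltnW kk1)// powRM ?exprn_ge0 ?(ltW rp1)//.
    by rewrite powR_exprn.
  have TG : T x k <= Cmu ^+ 2 * CP / c0 * rk k `^ (1 - Q) * fine G.
    rewrite /T; apply: ler_pM.
    - by rewrite divr_ge0 ?vol_ge0// !mulr_ge0// ltW.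
    - by rewrite fine_ge0.
    - have -> : Cmu ^+ 2 * CP / c0 * rk k `^ (1 - Q) =
          Cmu ^+ 2 * (CP * rk k) / (c0 * rk k `^ Q).
        rewrite powR_1B//; field.
        by rewrite !gt_eqF// powR_gt0.
      apply: ler_pdiv => //; first by rewrite !mulr_ge0// ltW.
        by rewrite mulr_gt0// powR_gt0.
      apply: le_trans (ahl x rp) _; apply: (vol_le dbl).
      by rewrite mdistxx add0r ler_peMl// ltW.
    - by apply: fine_le; [exact/If/AB|rewrite -GK|exact/IG/AB].
  have := le_trans hT TG; rewrite /weight kk1 rkQ => h.
  have qk : 0 < q ^+ (k1 - k) by rewrite exprn_gt0.
  have {}h : lam / 8 * (1 - q) <=
      Cmu ^+ 2 * CP / c0 * rk k1 `^ (1 - Q) * fine G.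
    rewrite -(ler_pM2l qk); apply: le_trans (le_trans _ h) _.
      by rewrite le_eqVlt; apply/orP; left; apply/eqP; field.
    by rewrite le_eqVlt; apply/orP; left; apply/eqP; ring.
  have q1' : 0 < (1 - q) / 8 by rewrite divr_gt0// subr_gt0.
  rewrite -(ler_pM2r q1'); apply: le_trans (le_trans _ h) _.
    by rewrite le_eqVlt; apply/orP; left; apply/eqP; field.
  rewrite le_eqVlt; apply/orP; left; apply/eqP; field.
  by rewrite (gt_eqF c00) andbT gt_eqF ?subr_gt0.
left.
(* Solving [lam / 4 * weight k <= T x k] for the integral of g gives this density, in the form
   expected by [single_scale_cover]. *)
pose c j := lam * 2^-1 ^+ j / (16 * Cmu ^+ 2 * CP * rk (k1 + j)).
have cj j : 0 < c j.
  by rewrite divr_gt0// ?mulr_gt0// exprn_gt0.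
pose Aj j := [set x | A x /\ (c j * vol mu x (tauP * rk (k1 + j)) <= fine (I x (k1 + j)))].
have cov : A `<=` \bigcup_j Aj j.
  move=> x Ax; have [k hk] := scale_exists Ax.
  have kk : (k1 <= k)%N.
    by rewrite leqNgt; apply/negP => kk; apply: nA; exists x, k.
  exists (k - k1)%N => //; split => //; rewrite subnKC//.
  have kkF : (k < k1)%N = false by rewrite ltnNge kk.
  move: hk; rewrite /weight kkF /T /c subnKC// => hk.
  have Vt := vol_gt0 dbl x (mulr_gt0 tau0 (rk0 k)).
  set w := Cmu ^+ 2 * (CP * rk k) / vol mu x (tauP * rk k) in hk.
  have w0 : 0 < w by rewrite divr_gt0// !mulr_gt0.
  rewrite -(ler_pM2l w0); apply: le_trans _ hk.
  rewrite le_eqVlt; apply/orP; left; apply/eqP; rewrite /w; field.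
  by rewrite !gt_eqF// ?exprn_gt0.
pose kap := 16 * Cmu ^+ 3 * CP * rk k1 / lam * fine G.
have kap0 : 0 <= kap.
  rewrite mulr_ge0// divr_ge0 ?(ltW lam0)// mulr_ge0 ?(ltW (rk0 _))//.
  by rewrite mulr_ge0 ?(ltW CP0)// mulr_ge0// exprn_ge0 ?(ltW Cmu0).
have muAj j : (mu (Aj j) <= (kap * 2^-1 ^+ j)%:E)%E.
  have tr0 : 0 < tauP * rk (k1 + j) by rewrite mulr_gt0.
  have := @single_scale_cover _ _ mu Cmu dbl g D (Aj j) (tauP * rk (k1 + j))
    (c j) (c0 * (tauP * rk (k1 + j)) `^ Q) g0 tr0 (cj j) _ _ _ _.
  move=> /(_ ltac:(by rewrite mulr_gt0// powR_gt0)) /(_ (fun x _ => ahl x tr0)).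
  move=> /(_ (fun x Ajx => @sub_D x _ (AB (proj1 Ajx)))) h.
  have {h} : (mu (Aj j) <= ((c j)^-1)%:E * (Cmu%:E * G))%E.
    rewrite lee_pdivlMl//; apply: h.
    by move=> x [Ax]; rewrite -lee_fin fineK// If//; exact: AB.
  move=> /le_trans; apply.
  rewrite -/G -GK -!EFinM lee_fin le_eqVlt; apply/orP; left; apply/eqP.
  have e4 : 4 ^+ j = 2 ^+ j * 2 ^+ j :> R by rewrite -exprMn; congr (_ ^+ _); ring.
  rewrite /c /kap rkA e4 !exprVn; field.
  by rewrite !expf_neq0// !gt_eqF.
apply: (@le_trans _ _ (\sum_(0 <= j <oo) mu (Aj j))%E).
  apply: le_trans (outer_measure_sigma_subadditive mu Aj).
  exact: le_outer_measure.
apply: lime_le; first by apply: is_cvg_nneseries => j _ _; exact: outer_measure_ge0.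
apply: nearW => n.
apply: (@le_trans _ _ (\sum_(0 <= j < n) (kap * 2^-1 ^+ j)%:E)%E).
  by apply: lee_sum => j _; exact: muAj.
rewrite sumEFin lee_fin; apply: le_trans (sum_geometric_half_le n kap0) _.
by rewrite /kap le_eqVlt; apply/orP; left; apply/eqP; ring.
Qed.

End fixed_function.
End weak_poincare.

(** * Lower bounds for the oscillation *)

Section exhaustion.
Context {R : realType} {X : completeMetricType R}.
Variables (mu : {outer_measure set X -> \bar R}) (Cmu : R).
Hypothesis breg : borel_regular mu.
Hypothesis dbl : doubling mu Cmu.
Implicit Types (x y z p q : X) (A D : set X).

Lemma ball_exhaust A x (a : R) :
  measurable (A : set (caratheodory_type mu)) -> (a%:E < mu A)%E ->
  exists r0 : R, forall r, r0 <= r -> (a%:E < mu (A `&` ball x r))%E.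
Proof.
move=> mA aA.
have AU : A = \bigcup_n (A `&` ball x n%:R).
  apply/seteqP; split => [y Ay|y [n _ []]//].
  exists (Num.truncn (mdist x y)).+1 => //; split => //.
  by rewrite ballEmdist/= truncnS_gt.
have sub (r s : R) : r <= s -> A `&` ball x r `<=` A `&` ball x s.
  by move=> rs; apply: setIS; apply: ball_sub; rewrite mdistxx add0r.
have [|n m nm|n an] := @measure_exhaust _ _ _ (mu_measure mu) A
    (fun n => A `&` ball x n%:R) a%:E _ _ AU aA.
- by move=> n; apply: measurableI => //; exact: (cara_ball breg).
- by apply: sub; rewrite ler_nat.
by exists n%:R => r /sub /(le_outer_measure mu); exact: lt_le_trans.
Qed.

Lemma vol_unbounded x (a : R) : mu [set: X] = +oo%E -> exists2 r : R, 0 < r & a < vol mu x r.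
Proof.
move=> muT; have aT : (a%:E < mu [set: X])%E by rewrite muT ltry.
have [r0 h] := ball_exhaust x (measurableT : measurable (setT : set (caratheodory_type mu))) aT.
exists (Num.max r0 1); first by rewrite lt_max ltr01 orbT.
rewrite -lte_fin -(mu_ballE dbl) -[ball _ _]setTI; apply: h.
by rewrite le_max lexx.
Qed.

End exhaustion.

(* The first term accounts for the points where f is far from its mollification;
   the other two are the constants of the two alternatives of weak_poincare,
   times that of the slope bound mollify_lip, up to numerical factors. *)
Definition osc_cst (R : realType) (Cmu CP c0 Q : R) : R :=
  32 * Cmu ^+ 3 + 3 * Cmu ^+ 6 * (1024 * Cmu ^+ 3 * CP +
    32 * Cmu ^+ 2 * CP * 2 `^ (Q - 1) / (c0 * (1 - 4 `^ (1 - Q)))).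

Section oscillation_lower_bound.
Context {R : realType} {X : completeMetricType R}.
Variables (mu : {outer_measure set X -> \bar R}) (Cmu CP tauP c0 Q : R).
Hypothesis breg : borel_regular mu.
Hypothesis dbl : doubling mu Cmu.
Hypothesis poin : poincare11 mu CP tauP.
Hypothesis c00 : 0 < c0.
Hypothesis Q1 : 1 < Q.
Hypothesis ahl : forall x r, 0 < r -> c0 * r `^ Q <= vol mu x r.
Implicit Types (x y z : X) (r s : R).

Variable f : X -> R.
Hypothesis mf : measurable_fun [set: caratheodory_type mu] f.
Hypothesis f01 : forall x, 0 <= f x <= 1.

Let CP0 : 0 < CP. Proof. by case: poin => /(lt_le_trans ltr01). Qed.
Let Cmu0 : 0 < Cmu. Proof. exact: Cmu_gt0 dbl. Qed.

Let q1 : 0 < 1 - 4 `^ (1 - Q) :> R.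
Proof.
rewrite subr_gt0 /powR gt_eqF// -[ltRHS]expR0 ltr_expR.
by rewrite pmulr_llt0 ?ln_gt0 ?ltr1n// subr_lt0.
Qed.

Let b1 := 32 * Cmu ^+ 3.
Let b2 := 1024 * Cmu ^+ 3 * CP.
Let b3 := 32 * Cmu ^+ 2 * CP * 2 `^ (Q - 1) / (c0 * (1 - 4 `^ (1 - Q))).

Let b10 : 0 <= b1. Proof. by rewrite mulr_ge0 ?ler0n// exprn_ge0// ltW. Qed.
Let b20 : 0 <= b2.
Proof.
apply: mulr_ge0 (ltW CP0); apply: mulr_ge0; first exact: ler0n.
by rewrite exprn_ge0// ltW.
Qed.
Let b30 : 0 <= b3.
Proof.
by rewrite divr_ge0 ?mulr_ge0 ?powR_ge0 ?exprn_ge0 ?(ltW Cmu0) ?(ltW CP0) ?(ltW c00) ?(ltW q1).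
Qed.

Let bE : osc_cst Cmu CP c0 Q = b1 + 3 * Cmu ^+ 6 * (b2 + b3).
Proof. by []. Qed.

Lemma osc_cst_gt0 : 0 < osc_cst Cmu CP c0 Q.
Proof.
rewrite bE ltr_wpDr ?mulr_gt0 ?exprn_gt0//.
by rewrite !mulr_ge0 ?exprn_ge0 ?(ltW Cmu0)// addr_ge0.
Qed.

Section local_bound.
Variables (x0 : X) (r0 t m : R).
Hypothesis t0 : 0 < t.
Hypothesis tr0 : t <= r0.
Hypothesis m0 : 0 < m.
Hypothesis m1 : (m%:E <= mu ([set x | f x = 1%R] `&` ball x0 r0))%E.
Hypothesis m2 : (m%:E <= 2%:E * mu ([set x | f x = 0%R] `&` ball x0 r0))%E.

Local Notation K := (1 + 2 * tauP).
Local Notation D := (ball x0 (K * r0)).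
Local Notation B := (ball x0 r0).
Local Notation osc x := (oscillation mu f x (4 * t) (f x)).
Let E := (\int[mu_measure mu]_(x in D) (osc x)%:E)%E.
Let v := mollify mu f t.
Let g := local_slope t v.
Let G := (\int[mu_measure mu]_(x in D) g x)%E.
(** The threshold radius m^(1/Q), cut off at r0 since the chain starts from the ball of radius
    r0. *)
Let s := Num.min (m `^ Q^-1) r0.

Let r00 : 0 < r0. Proof. exact: lt_le_trans tr0. Qed.
Let s0 : 0 < s. Proof. by rewrite lt_min powR_gt0// r00. Qed.

Let osc0 x : (0 <= (osc x)%:E)%E.
Proof. by rewrite lee_fin; apply: oscillation_ge0. Qed.

Let E0 : (0 <= E)%E. Proof. by apply: integral_ge0 => x _; exact: osc0. Qed.

Let g0 x : (0 <= g x)%E. Proof. exact: local_slope_ge0. Qed.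

Let GE : (G <= (3 * Cmu ^+ 6 / t)%:E * E)%E.
Proof.
rewrite -lower_integralZl//; last first.
  by rewrite divr_ge0 ?(ltW t0)// mulr_ge0// exprn_ge0// ltW.
by apply: le_lower_integral => // x _; rewrite -EFinM; exact: (local_slope_mollify breg dbl).
Qed.

Let BD : B `<=` D.
Proof.
apply: ball_sub; rewrite mdistxx add0r ler_peMl ?(ltW r00)//.
by case: poin => _ tau1 _; lra.
Qed.

Let mv : measurable_fun [set: caratheodory_type mu] v.
Proof. exact (measurable_mollify breg dbl mf f01 t0). Qed.

Let S := [set x | (4^-1 <= `|f x - v x|)%R] `&` B.
Let A := [set x | (4^-1 <= `|v x - average mu v x0 r0|)%R] `&` B.

Let mS : measurable (S : set (caratheodory_type mu)).
Proof.
apply: measurableI; last exact: (cara_ball breg).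
have mh : measurable_fun [set: caratheodory_type mu] (fun x => `|f x - v x|).
  by apply: measurableT_comp => //; apply: measurable_funB => //.
have := mh measurableT `[4^-1, +oo[%classic (measurable_itv _).
rewrite setTI; congr (measurable _).
by apply/seteqP; split => x /=; rewrite in_itv/= andbT.
Qed.

Let muS : (mu S <= (8 * Cmu ^+ 3)%:E * E)%E.
Proof.
have -> : (8 * Cmu ^+ 3)%:E = (4%:E * (2 * Cmu ^+ 3)%:E)%E :> \bar R.
  by rewrite -EFinM; congr (_%:E); ring.
rewrite -muleA -lee_pdivrMl//.
apply: (@le_trans _ _ (\int[mu_measure mu]_(x in D) (`|f x - v x|)%:E)%E).
  apply: (@lower_integral_ge_cst _ _ _ (mu_measure mu)) => //.
  - by apply: subset_trans BD => x [].
  - by move=> x [fx _]; rewrite lee_fin.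
rewrite -lower_integralZl//; last by rewrite mulr_ge0// exprn_ge0// ltW.
apply: le_lower_integral => // x _.
by rewrite -EFinM lee_fin; exact: (mollify_dist breg dbl mf f01 t0 x (f01 x)).
Qed.

(** Outside S, f = 1 forces v > 3/4 and f = 0 forces v < 1/4. The value on the other side of 1/2
    from the average of v then differs from it by at least 1/4, and either level set has enough
    measure. *)
Let SA_half : (m%:E <= 2%:E * (mu S + mu A))%E.
Proof.
have mSA (P : set X) : P `<=` S `|` A -> (mu P <= mu S + mu A)%E.
  by move=> /(le_outer_measure mu) /le_trans; apply; exact: outer_measureU2.
have [cl|cl] := leP (average mu v x0 r0) 2^-1.
  apply: (le_trans m1); apply: le_trans (mSA _ _) _; last first.
    by rewrite lee_pemull ?lee_fin ?ler1n// adde_ge0 ?outer_measure_ge0.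
  move=> x [/= fx Bx]; have [xS|xS] := leP 4^-1 `|f x - v x|; first by left.
  right; split => //=; move: xS; rewrite fx ltr_norml ler_normr => /andP[h1 h2].
  by apply/orP; left; lra.
apply: (le_trans m2); rewrite lee_pmul2l//; apply: mSA => x [/= fx Bx].
have [xS|xS] := leP 4^-1 `|f x - v x|; first by left.
right; split => //=; move: xS; rewrite fx ltr_norml ler_normr => /andP[h1 h2].
by apply/orP; right; lra.
Qed.

Let cv x (e : R) : 0 < e ->
  exists2 d, 0 < d & forall y, mdist x y < d -> `|v x - v y| <= e.
Proof.
move=> e0; pose L := 3 * Cmu ^+ 6 / t.
have L0 : 0 < L by rewrite divr_gt0// mulr_gt0// exprn_gt0.
exists (Num.min t (e / L)); first by rewrite lt_min t0 divr_gt0.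
move=> y; rewrite lt_min => /andP[xt xe].
apply: le_trans (mollify_lipschitz breg dbl mf f01 t0 xt) _.
by rewrite -/L mulrC -ler_pdivlMr// ltW.
Qed.

(** The first k with r0 / 4^k <= s. If k > 0, the preceding radius exceeds s, whence the lower
    bound; if r0 is at most m^(1/Q), then k = 0. *)
Let scale : exists k : nat, [/\ 2 * r0 / 4 ^+ k <= 2 * s &
  (0 < k)%N -> s = m `^ Q^-1 /\ s / 2 <= 2 * r0 / 4 ^+ k].
Proof.
have [rm|mr] := leP r0 (m `^ Q^-1).
  exists 0%N; split=> //; rewrite expr0 divr1 ler_pM2l//.
  by rewrite le_min rm lexx.
have sE : s = m `^ Q^-1 by rewrite /s; apply/min_idPl/ltW.
pose P k := r0 / 4 ^+ k <= s.
have exP : exists k, P k.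
  exists (Num.truncn (r0 / s)).
  rewrite /P ler_pdivrMr ?exprn_gt0// [leRHS]mulrC -ler_pdivrMr//.
  apply: le_trans (ltW (truncnS_gt _)) _.
  by rewrite -natrX ler_nat ltn_expl.
case: (ex_minnP exP) => k Pk kmin; exists k; split.
  by rewrite -mulrA ler_pM2l.
move=> k0; split => //.
have : ~~ P k.-1 by apply/negP => /kmin; rewrite -ltnS prednK// ltnn.
rewrite /P -ltNge => /ltW h; apply: le_trans (_ : (r0 / 4 ^+ k.-1) / 2 <= _).
  by rewrite ler_pM2r.
rewrite -{2}(prednK k0) exprS le_eqVlt; apply/orP; left; apply/eqP; field.
by rewrite expf_neq0.
Qed.

(** [weak_poincare] at level 1/4 for the mollification. The factor 1 / t of the slope bound becomes
    the t on the left of the second alternative. *)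
Lemma oscillation_lower_bound :
  (m%:E <= (osc_cst Cmu CP c0 Q)%:E * E)%E \/
  ((m * t)%:E <= (osc_cst Cmu CP c0 Q * s)%:E * E)%E.
Proof.
have C6 : 0 < 3 * Cmu ^+ 6 by rewrite mulr_gt0// exprn_gt0.
have [Eoo|Efin] := eqVneq E +oo%E.
  by left; rewrite Eoo gt0_muley ?leey// lte_fin osc_cst_gt0.
have EF : E \is a fin_num by rewrite ge0_fin_numE// ltey.
pose e := fine E; have EK : E = e%:E by rewrite /e fineK.
have e0 : 0 <= e by rewrite -lee_fin -EK.
have Gfin : (G < +oo)%E by apply: le_lt_trans GE _; rewrite EK -EFinM ltry.
have G0 : (0 <= G)%E by apply: integral_ge0 => x _; exact: g0.
pose h := fine G; have GK : G = h%:E by rewrite /h fineK// ge0_fin_numE.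
have he : h * t <= 3 * Cmu ^+ 6 * e.
  have := GE; rewrite GK EK -EFinM lee_fin => /(ler_wpM2r (ltW t0)) /le_trans; apply.
  by rewrite le_eqVlt; apply/orP; left; apply/eqP; field; rewrite gt_eqF.
have h0 : 0 <= h by rewrite -lee_fin -GK.
have fineS : (mu S <= (8 * Cmu ^+ 3 * e)%:E)%E by have := muS; rewrite EK -EFinM.
have [k [rks rkm]] := scale.
have := @weak_poincare _ _ mu Cmu CP tauP c0 Q breg dbl poin c00 Q1 ahl v g
  (1 + 2 * Cmu ^+ 3) mv (mollify_norm_le breg dbl mf f01 t0)
  (upper_gradient_local_slope v t0) x0 r0 r00 Gfin cv A 4^-1 k.
move=> /(_ ltac:(by rewrite invr_gt0)) /(_ (fun x => @proj2 _ _)) /(_ (fun x => @proj1 _ _)).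
rewrite -/G -/h => -[muA|[k0 lamG]].
  have : (m%:E <= (2 * (8 * Cmu ^+ 3 * e + 32 * Cmu ^+ 3 * CP * (2 * r0 / 4 ^+ k) / 4^-1 * h))%:E)%E.
    by apply: (le_trans SA_half); rewrite EFinM lee_pmul2l// EFinD leeD.
  rewrite lee_fin => hm.
  have {}hm : m <= 16 * Cmu ^+ 3 * e + 512 * Cmu ^+ 3 * CP * s * h.
    apply: (le_trans hm); rewrite mulrDr lerD//.
      by rewrite le_eqVlt; apply/orP; left; apply/eqP; ring.
    rewrite mulrA ler_wpM2r//.
    apply: (@le_trans _ _ (2 * (32 * Cmu ^+ 3 * CP * (2 * s) / 4^-1))); last first.
      by rewrite le_eqVlt; apply/orP; left; apply/eqP; field.
    rewrite ler_pM2l// ler_pM2r// ler_pM2l// mulr_gt0// mulr_gt0 ?ltr0n//.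
    exact: exprn_gt0.
  (* If the part coming from S is at least m / 2, the bound holds without the factor s / t;
     otherwise the part coming from A is. *)
  have [hc|hc] := leP (m / 2) (16 * Cmu ^+ 3 * e).
    left; rewrite EK -EFinM lee_fin bE.
    apply: (@le_trans _ _ (b1 * e)); first by rewrite /b1; lra.
    by rewrite ler_wpM2r// lerDl !mulr_ge0 ?exprn_ge0 ?(ltW Cmu0)// addr_ge0.
  right; rewrite EK -EFinM lee_fin.
  have {hm hc}hm : m <= b2 * s * h by rewrite /b2; lra.
  apply: (@le_trans _ _ (b2 * s * (3 * Cmu ^+ 6 * e))).
    apply: (@le_trans _ _ (b2 * s * h * t)); first by rewrite ler_pM2r.
    by rewrite -mulrA ler_wpM2l// mulr_ge0// ltW.
  have -> : b2 * s * (3 * Cmu ^+ 6 * e) = 3 * Cmu ^+ 6 * b2 * s * e by ring.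
  rewrite ler_wpM2r// ler_pM2r// bE -[leLHS]add0r lerD//.
  by rewrite ler_pM2l// lerDl.
right; rewrite EK -EFinM lee_fin.
have [sE sk] := rkm k0.
have rk0 : 0 < 2 * r0 / 4 ^+ k by rewrite divr_gt0 ?mulr_gt0 ?exprn_gt0.
have sQ : s `^ Q = m.
  by rewrite sE -powRrM mulVf ?powRr1 ?(ltW m0)// gt_eqF// (lt_trans ltr01).
(* As 1 - Q < 0, the lower bound s / 2 on the radius bounds its power from above, and s^Q = m turns
   s^(1 - Q) into s / m. *)
have rkQ : (2 * r0 / 4 ^+ k) `^ (1 - Q) <= 2 `^ (Q - 1) * (s / m).
  rewrite -[1 - Q]opprB powRN.
  have -> : 2 `^ (Q - 1) * (s / m) = ((s / 2) `^ (Q - 1))^-1.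
    have -> : (s / 2) `^ (Q - 1) = s `^ (Q - 1) / 2 `^ (Q - 1).
      rewrite powRM ?(ltW s0) ?invr_ge0//; congr (_ * _).
      by rewrite -[X in X `^ _]powR_inv1// -powRrM mulN1r powRN.
    rewrite [s `^ (Q - 1)]powRB ?(gt_eqF s0) ?implybT// powRr1 ?(ltW s0)// sQ.
    by field; rewrite !gt_eqF// powR_gt0.
  rewrite lef_pV2 ?posrE ?powR_gt0// ?divr_gt0//.
  rewrite ge0_ler_powR ?nnegrE ?subr_ge0 ?(ltW Q1) ?(ltW rk0)//.
  by rewrite divr_ge0// ltW.
have {lamG}hm : m <= b3 * s * h.
  have cst0 : 0 < 8 * Cmu ^+ 2 * CP / (c0 * (1 - 4 `^ (1 - Q))).
    by rewrite divr_gt0 ?mulr_gt0// exprn_gt0.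
  have : 4^-1 <= 8 * Cmu ^+ 2 * CP / (c0 * (1 - 4 `^ (1 - Q))) * (2 `^ (Q - 1) * (s / m)) * h.
    by apply: (le_trans lamG); rewrite ler_wpM2r// ler_pM2l.
  have m4 : 0 < 4 * m by rewrite mulr_gt0.
  move=> /(ler_wpM2l (ltW m4)) => hh.
  apply: le_trans (le_trans _ hh) _.
    by rewrite le_eqVlt; apply/orP; left; apply/eqP; field.
  rewrite le_eqVlt /b3; apply/orP; left; apply/eqP; field.
  by rewrite !gt_eqF.
apply: (@le_trans _ _ (b3 * s * (3 * Cmu ^+ 6 * e))).
  apply: (@le_trans _ _ (b3 * s * h * t)); first by rewrite ler_pM2r.
  by rewrite -mulrA ler_wpM2l// mulr_ge0// ltW.
have -> : b3 * s * (3 * Cmu ^+ 6 * e) = 3 * Cmu ^+ 6 * b3 * s * e by ring.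
rewrite ler_wpM2r// ler_pM2r// bE -[leLHS]add0r lerD//.
by rewrite ler_pM2l// lerDr.
Qed.

End local_bound.
End oscillation_lower_bound.

(** * Reverse doubling and the fractional energy *)

Section reverse_doubling.
Context {R : realType} {X : completeMetricType R}.
Variables (mu : {outer_measure set X -> \bar R}) (Cmu CP tauP : R).
Hypothesis breg : borel_regular mu.
Hypothesis dbl : doubling mu Cmu.
Hypothesis poin : poincare11 mu CP tauP.
Hypothesis muT : mu [set: X] = +oo%E.
Implicit Types (x y z p q : X) (r s : R).

Let Cmu0 : 0 < Cmu. Proof. exact: Cmu_gt0 dbl. Qed.

(* Were the annulus empty, the indicator of B(x, 3r/2) would have the zero
   function as an upper gradient, hence be constant on large balls. *)
Lemma annulus_nonempty x r : 0 < r ->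
  exists y, 5 / 4 * r <= mdist x y < 7 / 4 * r.
Proof.
move=> r0; apply: contrapT => ny.
have nann y : mdist x y < 3 / 2 * r -> mdist x y < 5 / 4 * r.
  move=> h; rewrite ltNge; apply/negP => h'; apply: ny; exists y; rewrite h'/=.
  by move: h r0; lra.
have nann' y : 3 / 2 * r <= mdist x y -> 7 / 4 * r <= mdist x y.
  move=> h; rewrite leNgt; apply/negP => h'; apply: ny; exists y; rewrite h' andbT.
  by move: h r0; lra.
pose b := 3 / 2 * r.
have b0 : 0 < b by rewrite /b; move: r0; lra.
pose v : X -> R := \1_(ball x b).
have v01 y : v y = if mdist x y < b then 1 else 0.
  rewrite /v indicE ballEmdist; have [h|h] := ltP (mdist x y) b.
    by rewrite mem_set.
  by rewrite memNset//= ltNge h.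
have v1 y : `|v y| <= 1 by rewrite v01; case: ifP; rewrite ?normr1 ?normr0.
have mv : measurable_fun [set: caratheodory_type mu] v.
  by apply: measurable_indic; exact: (cara_ball breg).
have t0 : 0 < r / 8 by rewrite divr_gt0.
(* Two points less than r / 4 apart cannot lie on different sides of a gap of width r / 2. *)
have slope0 z : (local_slope (r / 8) v z <= 0)%E.
  apply: local_slope_le => p q; rewrite !ballEmdist/= => zp zq.
  have pq : mdist p q < r / 4.
    have := metric_triangle p z q; rewrite [mdist p z]metric_sym.
    by move: zp zq r0; lra.
  suff -> : v p = v q by rewrite subrr normr0 mul0r.
  rewrite !v01; case: (ltP (mdist x p) b) => hp; case: (ltP (mdist x q) b) => hq //.
    have := nann _ hp; have := nann' _ hq; have := metric_triangle x p q.
    by move: pq r0; lra.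
  have := nann _ hq; have := nann' _ hp; have := metric_triangle x q p.
  by rewrite [mdist q p]metric_sym; move: pq r0; lra.
have [r1 r10 volr1] := vol_unbounded breg dbl x (vol mu x b) muT.
have br1 : b < r1.
  rewrite ltNge; apply/negP => h; have : vol mu x r1 <= vol mu x b.
    by apply: (vol_le dbl); rewrite mdistxx add0r.
  by rewrite leNgt volr1.
case: poin => CP1 tau1 /(_ x r1 r10 (EFin \o v) (local_slope (r / 8) v)).
move=> /(_ _ (upper_gradient_local_slope v t0)).
have L1v : L1loc mu (EFin \o v).
  by move=> z; exists 1 => //; exact: (ball_integrable breg dbl 1).
move=> /(_ L1v); rewrite (mean_average breg dbl _ r10 mv v1).
set a := average mu v x r1 => h.
have {}h : (mean mu (ball x r1) (fun y => `|(EFin \o v) y - a%:E|) <= 0)%E.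
  apply: (le_trans h); rewrite /mean integral0_eq ?mule0 ?mule0// => y _.
  by apply/eqP; rewrite eq_le slope0 local_slope_ge0.
have Vr1 := vol_gt0 dbl x r10.
have int0 : (\int[mu_measure mu]_(y in ball x r1) (`|v y - a|)%:E <= 0)%E.
  rewrite /mean (mu_ballE dbl) inver gt_eqF// in h.
  have h' : (((vol mu x r1)^-1)%:E *
      \int[mu_measure mu]_(y in ball x r1) (`|v y - a|)%:E <= 0)%E := h.
  rewrite leNgt; apply/negP => int_gt0.
  have V1 : (0 < ((vol mu x r1)^-1)%:E)%E by rewrite lte_fin invr_gt0.
  by have := mule_gt0 V1 int_gt0; rewrite ltNge h'.
have mBr1 := cara_ball breg x r1.
have a1 : a = 1.
  apply/eqP; rewrite -subr_eq0 -normr_le0 distrC.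
  have : (`|1 - a|%:E * mu (ball x b) <= 0)%E.
    apply: le_trans int0; apply: (@lower_integral_ge_cst _ _ _ (mu_measure mu)) => //.
    - exact: (cara_ball breg).
    - by apply: ball_sub; rewrite mdistxx add0r ltW.
    - by move=> y; rewrite ballEmdist/= => yb; rewrite v01 yb.
  rewrite (mu_ballE dbl) -EFinM lee_fin pmulr_lle0//.
  exact: (vol_gt0 dbl).
have diff0 : (mu (ball x r1 `\` ball x b) <= 0)%E.
  rewrite -[mu _]mul1e; apply: le_trans int0.
  apply: (@lower_integral_ge_cst _ _ _ (mu_measure mu)) => //.
  - by apply: measurableD; exact: (cara_ball breg).
  - move=> y [_]; rewrite ballEmdist/= => /negP; rewrite v01 => /negbTE ->.
    by rewrite a1 sub0r normrN normr1.
have : (mu (ball x r1) <= mu (ball x b))%E.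
  apply: (@le_trans _ _ (mu (ball x b) + mu (ball x r1 `\` ball x b))%E).
    apply: le_trans (outer_measureU2 _ _ _); apply: le_outer_measure => y yr.
    by have [|] := pselect (ball x b y); [left|right].
  by rewrite -[leRHS]adde0 leeD2l.
by rewrite !(mu_ballE dbl) lee_fin leNgt volr1.
Qed.

(** For y in the annulus, B(y, r / 4) is disjoint from B(x, r), lies in B(x, 2 r), and has at least
    the fraction Cmu^-4 of its measure. *)
Lemma reverse_doubling x r : 0 < r ->
  vol mu x r <= (1 - (Cmu ^+ 4)^-1) * vol mu x (2 * r).
Proof.
move=> r0; have [y /andP[y1 y2]] := annulus_nonempty x r0.
have C4 : 0 < Cmu ^+ 4 by rewrite exprn_gt0.
have r4 : 0 < r / 4 by rewrite divr_gt0.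
have h1 : vol mu x (2 * r) <= Cmu ^+ 4 * vol mu y (r / 4).
  apply: (vol_cmp dbl) => //; rewrite metric_sym.
  have -> : 2 ^+ 4 = 16 :> R by ring.
  by move: y2 r0; lra.
have h2 : vol mu x r + vol mu y (r / 4) <= vol mu x (2 * r).
  rewrite -lee_fin EFinD -!(mu_ballE dbl).
  have dis : [disjoint ball x r & ball y (r / 4)].
    apply/eqP/seteqP; split => z //= -[]; rewrite !ballEmdist/= => xz yz.
    have := metric_triangle x z y; rewrite [mdist z y]metric_sym.
    by move: y1 r0 xz yz; lra.
  rewrite -(@measureU _ _ _ (mu_measure mu)); last 3 first.
  - exact: (cara_ball breg).
  - exact: (cara_ball breg).
  - by apply/eqP.
  apply: le_outer_measure => z [|]; apply: ball_sub; rewrite ?mdistxx.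
    by move: r0; lra.
  by move: y2 r0; lra.
rewrite mulrBl mul1r lerBrDr; apply: le_trans h2; rewrite lerD2l.
by rewrite [leLHS]mulrC ler_pdivrMr// [leRHS]mulrC.
Qed.

(** Read from the smallest ball upwards, the terms decay at least with ratio 1 - Cmu^-4, and the
    geometric series of this ratio has sum Cmu^4. *)
Lemma sum_inv_vol_le x r n : 0 < r ->
  \sum_(0 <= j < n.+1) (vol mu x (r / 2 ^+ j))^-1 <=
  Cmu ^+ 4 / vol mu x (r / 2 ^+ n).
Proof.
move=> r0; have C4 : 1 <= Cmu ^+ 4 by rewrite exprn_ege1// (Cmu_ge1 dbl).
have V0 j : 0 < vol mu x (r / 2 ^+ j).
  by apply: (vol_gt0 dbl); rewrite divr_gt0// exprn_gt0.
elim: n => [|n ih].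
  by rewrite big_nat1 ler_peMl// invr_ge0 ltW.
rewrite big_nat_recr//=; set a := vol mu x (r / 2 ^+ n) in ih *.
set b := vol mu x (r / 2 ^+ n.+1).
have ab : b <= (1 - (Cmu ^+ 4)^-1) * a.
  have := @reverse_doubling x (r / 2 ^+ n.+1); rewrite -/b.
  have -> : 2 * (r / 2 ^+ n.+1) = r / 2 ^+ n by rewrite exprS; field; rewrite expf_neq0.
  by apply; rewrite divr_gt0// exprn_gt0.
have a0 : 0 < a by exact: V0.
have b0 : 0 < b by exact: V0.
have C40 : 0 < Cmu ^+ 4 by rewrite exprn_gt0.
apply: (@le_trans _ _ (Cmu ^+ 4 / a + b^-1)); first by rewrite lerD2r.
have {}ab : Cmu ^+ 4 * b <= (Cmu ^+ 4 - 1) * a.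
  have := ler_wpM2l (ltW C40) ab; rewrite mulrA mulrBr mulr1 mulfV// gt_eqF//.
have ab0 : 0 < a * b by rewrite mulr_gt0.
rewrite -(ler_pM2r ab0).
have -> : (Cmu ^+ 4 / a + b^-1) * (a * b) = Cmu ^+ 4 * b + a.
  by field; rewrite !gt_eqF.
have -> : Cmu ^+ 4 / b * (a * b) = Cmu ^+ 4 * a by field; rewrite gt_eqF.
by lra.
Qed.

End reverse_doubling.

(** * Oscillations at all scales against the fractional kernel *)

Section oscillation_kernel.
Context {R : realType} {X : completeMetricType R}.
Variables (mu : {outer_measure set X -> \bar R}) (Cmu CP tauP : R).
Hypothesis breg : borel_regular mu.
Hypothesis dbl : doubling mu Cmu.
Hypothesis poin : poincare11 mu CP tauP.
Hypothesis muT : mu [set: X] = +oo%E.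
Implicit Types (x y z p q : X) (r s : R).
Variable f : X -> R.
Hypothesis mf : measurable_fun [set: caratheodory_type mu] f.
Hypothesis f01 : forall x, 0 <= f x <= 1.
Variable theta : R.
Hypothesis th : 0 < theta < 1.

Let Cmu0 : 0 < Cmu. Proof. exact: Cmu_gt0 dbl. Qed.

Lemma frac_kernelE (u : X -> R) x y : x != y ->
  frac_kernel mu theta (EFin \o u) x y =
  (`|u x - u y| / (mdist x y `^ theta * vol mu x (mdist x y)))%:E.
Proof.
move=> xy; rewrite /frac_kernel (negbTE xy) (mu_ballE dbl) -EFinM inver.
have d0 : 0 < mdist x y by rewrite mdist_gt0.
by rewrite gt_eqF// mulr_gt0 ?powR_gt0// (vol_gt0 dbl).
Qed.

Lemma frac_kernel_ge0 (u : X -> \bar R) x y : (0 <= frac_kernel mu theta u x y)%E.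
Proof.
rewrite /frac_kernel; case: ifPn => // xy.
have d0 : 0 < mdist x y by rewrite mdist_gt0.
rewrite mule_ge0// (mu_ballE dbl) -EFinM inver gt_eqF ?lee_fin ?invr_ge0.
  by rewrite mulr_ge0 ?powR_ge0 ?vol_ge0.
by rewrite mulr_gt0 ?powR_gt0// (vol_gt0 dbl).
Qed.

(** Each power is bounded by d^-theta and the decay over j is left to the inverse volumes, so the
    constant is independent of theta. *)
Lemma weight_sum_le x y r n : 0 < r -> x != y ->
  \sum_(0 <= j < n) (if mdist x y < r / 2 ^+ j
    then (r / 2 ^+ j) `^ (- theta) / vol mu x (r / 2 ^+ j) else 0) <=
  Cmu ^+ 4 / (mdist x y `^ theta * vol mu x (mdist x y)).
Proof.
move=> r0 xy; set d := mdist x y; have d0 : 0 < d by rewrite mdist_gt0.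
have [th0 th1] : 0 < theta /\ theta < 1 by case/andP: th.
have rj0 j : 0 < r / 2 ^+ j by rewrite divr_gt0// exprn_gt0.
have V0 j : 0 < vol mu x (r / 2 ^+ j) by exact: (vol_gt0 dbl).
have dth : 0 < d `^ theta by rewrite powR_gt0.
have Vd := vol_gt0 dbl x d0.
have C4 : 0 < Cmu ^+ 4 by rewrite exprn_gt0.
elim: n => [|n ih].
  by rewrite big_geq// divr_ge0 ?(ltW C4)// mulr_ge0 ?(ltW dth) ?(ltW Vd).
(* A last scale at or below d contributes 0 and is dropped by induction; one above d allows
   [sum_inv_vol_le] and monotonicity of volumes. *)
have [dn|dn] := ltP d (r / 2 ^+ n); last first.
  by rewrite big_nat_recr//= ltNge dn/= addr0.
apply: (@le_trans _ _ ((d `^ theta)^-1 *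
    \sum_(0 <= j < n.+1) (vol mu x (r / 2 ^+ j))^-1)).
  rewrite mulr_sumr; apply: ler_sum => j _; case: ifP => dj; last first.
    by rewrite mulr_ge0 ?invr_ge0// ltW.
  rewrite ler_wpM2r ?invr_ge0 ?(ltW (V0 _))// powRN lef_pV2 ?posrE ?powR_gt0//.
  by rewrite ge0_ler_powR ?nnegrE// ltW.
apply: (@le_trans _ _ ((d `^ theta)^-1 * (Cmu ^+ 4 / vol mu x (r / 2 ^+ n)))).
  by rewrite ler_pM2l ?invr_gt0//; exact: (sum_inv_vol_le breg dbl poin muT).
rewrite mulrCA invfM ler_pM2l// ler_pM2l ?invr_gt0// lef_pV2 ?posrE//.
by apply: (vol_le dbl); rewrite mdistxx add0r ltW.
Qed.

Lemma oscillationE x r : 0 < r -> (oscillation mu f x r (f x))%:E =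
  (\int[mu_measure mu]_(y in ball x r) ((vol mu x r)^-1 * `|f x - f y|)%:E)%E.
Proof.
move=> r0; rewrite /oscillation EFinM fineK; last first.
  apply: integrable_fin_num; first exact: (cara_ball breg).
  apply: (ball_integrable breg dbl 1).
    by apply: measurableT_comp => //; exact: measurable_funB.
  by move=> y; rewrite normr_id; exact: norm_f_le.
rewrite -lower_integralZl ?invr_ge0 ?vol_ge0//.
by apply: eq_integral => y _; rewrite -EFinM distrC.
Qed.

(** Writing all oscillations as integrals over the same ball B(x, r), with the cut-off in the
    integrand, lets superadditivity bring the sum inside. *)
Lemma sum_oscillation_le_kernel x r n : 0 < r ->
  (\sum_(0 <= j < n) ((r / 2 ^+ j) `^ (- theta) *
     oscillation mu f x (r / 2 ^+ j) (f x))%:E <=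
   (Cmu ^+ 4)%:E * \int[mu_measure mu]_(y in ball x r)
     frac_kernel mu theta (EFin \o f) x y)%E.
Proof.
move=> r0.
have rj0 j : 0 < r / 2 ^+ j by rewrite divr_gt0// exprn_gt0.
have V0 j : 0 < vol mu x (r / 2 ^+ j) by exact: (vol_gt0 dbl).
pose F j y : \bar R := if mdist x y < r / 2 ^+ j then
  ((r / 2 ^+ j) `^ (- theta) / vol mu x (r / 2 ^+ j) * `|f x - f y|)%:E else 0%E.
have F0 j y : (0 <= F j y)%E.
  by rewrite /F; case: ifP => // _; rewrite lee_fin mulr_ge0// divr_ge0 ?powR_ge0// ltW.
have FE j : (((r / 2 ^+ j) `^ (- theta) * oscillation mu f x (r / 2 ^+ j) (f x))%:E =
    \int[mu_measure mu]_(y in ball x r) F j y)%E.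
  rewrite EFinM oscillationE// -lower_integralZl ?powR_ge0//; last first.
    by move=> y _; rewrite lee_fin mulr_ge0// invr_ge0 ltW.
  rewrite [LHS]integral_mkcond [RHS]integral_mkcond; congr (integral _ _ _).
  apply/funext => y; rewrite /patch.
  have inE' s : (y \in (ball x s : set X)) = (mdist x y < s).
    by rewrite ballEmdist; apply/idP/idP; rewrite ?inE.
  rewrite !inE' /F; case: ltP => h1; case: ltP => h2 //.
    by rewrite -EFinM mulrA.
  have : r / 2 ^+ j <= r by rewrite ler_pdivrMr ?exprn_gt0// ler_peMr ?(ltW r0)// exprn_ege1// ler1n.
  by rewrite leNgt (le_lt_trans h2 h1).
rewrite (eq_bigr _ (fun j _ => FE j)).
apply: le_trans (lower_integral_sum_ge _ _ _) _ => //.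
rewrite -lower_integralZl ?exprn_ge0 ?(ltW Cmu0)//; last by move=> y _; exact: frac_kernel_ge0.
apply: le_lower_integral => y _; first by rewrite sume_ge0.
have [xy|xy] := eqVneq x y.
  rewrite big1 ?mule_ge0 ?frac_kernel_ge0 ?lee_fin ?exprn_ge0 ?(ltW Cmu0)// => j _.
  by rewrite /F -xy subrr normr0 mulr0; case: ifP.
rewrite (eq_bigr (fun j => ((if mdist x y < r / 2 ^+ j
    then (r / 2 ^+ j) `^ (- theta) / vol mu x (r / 2 ^+ j) else 0) * `|f x - f y|)%:E)); last first.
  by move=> j _; rewrite /F; case: ifP => _ //; rewrite mul0r.
rewrite sumEFin frac_kernelE// -EFinM lee_fin -mulr_suml.
rewrite [X in _ <= _ * X]mulrC mulrA ler_wpM2r//.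
exact: weight_sum_le.
Qed.

Lemma sum_oscillation_le_energy (D : set X) r n : 0 < r ->
  (\sum_(0 <= j < n) (((r / 2 ^+ j) `^ (- theta))%:E *
     \int[mu_measure mu]_(x in D) (oscillation mu f x (r / 2 ^+ j) (f x))%:E) <=
   (Cmu ^+ 4)%:E * \int[mu_measure mu]_(x in D)
     \int[mu_measure mu]_(y in ball x r) frac_kernel mu theta (EFin \o f) x y)%E.
Proof.
move=> r0; have osc0 j x : (0 <= (oscillation mu f x (r / 2 ^+ j) (f x))%:E)%E.
  by rewrite lee_fin; apply: oscillation_ge0.
have K0 x : (0 <= \int[mu_measure mu]_(y in ball x r) frac_kernel mu theta (EFin \o f) x y)%E.
  by apply: integral_ge0 => y _; exact: frac_kernel_ge0.
rewrite (eq_bigr (fun j => \int[mu_measure mu]_(x in D)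
    ((r / 2 ^+ j) `^ (- theta) * oscillation mu f x (r / 2 ^+ j) (f x))%:E)%E); last first.
  move=> j _; rewrite -lower_integralZl ?powR_ge0//.
apply: le_trans (lower_integral_sum_ge _ _ _) _ => //.
  by move=> j x _; rewrite EFinM mule_ge0// lee_fin powR_ge0.
rewrite -lower_integralZl ?exprn_ge0 ?(ltW Cmu0)//.
apply: le_lower_integral => x _; last exact: sum_oscillation_le_kernel.
by rewrite sume_ge0// => j _; rewrite EFinM mule_ge0// lee_fin powR_ge0.
Qed.

End oscillation_kernel.

(** * Weak-type fractional inequalities *)

(** 1 - 2^-a is at most a because ln 2 <= 1, and from n0 on the partial sums have reached half of
    the limit. *)
Lemma sum_geometric_powR (R : realType) (a : R) : 0 < a -> a < 1 ->
  exists n0 : nat, forall n, (n0 <= n)%N ->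
    1 / (2 * a) <= \sum_(0 <= j < n) (2 `^ (- a)) ^+ j.
Proof.
move=> a0 a1; pose q : R := 2 `^ (- a).
have q0 : 0 < q by rewrite powR_gt0.
have q1 : q < 1.
  rewrite /q /powR gt_eqF// -[ltRHS]expR0 ltr_expR.
  by rewrite pmulr_llt0 ?ln_gt0 ?ltr1n// oppr_lt0.
have qa : 1 - q <= a.
  have ln2 : ln 2 <= 1 :> R.
    have m11 : -1 < 1 :> R by lra.
    by have := le_ln1Dx m11; rewrite (_ : 1 + 1 = 2).
  have : 1 + (- a * ln 2) <= q by rewrite /q /powR gt_eqF// expR_ge1Dx.
  have : a * ln 2 <= a * 1 by rewrite ler_wpM2l// ltW.
  by lra.
have [n0 qn0] : exists n0, q ^+ n0 <= 2^-1.
  have : q ^+ n @[n --> \oo] --> (0 : R) by apply: cvg_expr; rewrite ger0_norm// ltW.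
  move=> /cvgrPdist_le /(_ 2^-1 ltac:(by rewrite invr_gt0)) [n0 _ /(_ n0 (leqnn _))].
  rewrite sub0r normrN ger0_norm ?exprn_ge0 ?(ltW q0)// => h.
  by exists n0.
exists n0 => n n0n.
have -> : \sum_(0 <= j < n) q ^+ j = (1 - q ^+ n) / (1 - q).
  have q1' : 1 - q != 0 by rewrite gt_eqF// subr_gt0.
  elim: n {n0n} => [|n ih]; first by rewrite big_geq// expr0 subrr mul0r.
  by rewrite big_nat_recr//= ih exprS; field.
have qn : q ^+ n <= 2^-1.
  by apply: le_trans qn0; apply: ler_wiXn2l => //; exact: ltW.
rewrite ler_pdivlMr ?subr_gt0// mul1r invfM.
apply: (@le_trans _ _ (2^-1 * (a^-1 * a))).
  by rewrite -mulrA ler_pM2l// ler_pM2l// invr_gt0.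
by rewrite mulVf ?gt_eqF//; lra.
Qed.

Section weak_type.
Context {R : realType} {X : completeMetricType R}.
Variables (mu : {outer_measure set X -> \bar R}) (Cmu CP tauP c0 Q : R).
Hypothesis breg : borel_regular mu.
Hypothesis dbl : doubling mu Cmu.
Hypothesis poin : poincare11 mu CP tauP.
Hypothesis muT : mu [set: X] = +oo%E.
Hypothesis c00 : 0 < c0.
Hypothesis Q1 : 1 < Q.
Hypothesis ahl : forall x r, 0 < r -> c0 * r `^ Q <= vol mu x r.
Implicit Types (x y z : X) (r s : R).

Variable f : X -> R.
Hypothesis mf : measurable_fun [set: caratheodory_type mu] f.
Hypothesis f01 : forall x, 0 <= f x <= 1.
Variable theta : R.
Hypothesis th : 0 < theta < 1.

Local Notation Co := (osc_cst Cmu CP c0 Q).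
Local Notation osc r x := (oscillation mu f x r (f x)).
Let Cmu0 : 0 < Cmu. Proof. exact: Cmu_gt0 dbl. Qed.
Let Co0 : 0 < Co. Proof. exact: (osc_cst_gt0 dbl poin c00 Q1). Qed.
Let Q0 : 0 < Q. Proof. exact: lt_trans Q1. Qed.
Let th0 : 0 < theta. Proof. by case/andP: th. Qed.
Let th1 : theta < 1. Proof. by case/andP: th. Qed.

Lemma level_measurable (c : R) :
  measurable ([set x | f x = c] : set (caratheodory_type mu)).
Proof. by have := mf measurableT (measurable_set1 c); rewrite setTI. Qed.

(** Exhaustion by balls only reaches measures below the given one, hence m / 2 and the extra factor
    2. The infinite zero set provides the second level set on a large ball. *)
Lemma oscillation_lower_bound_global t m : 0 < t -> 0 < m ->
  (m%:E <= mu [set x | f x = 1%R])%E -> mu [set x | f x = 0%R] = +oo%E ->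
  (m%:E <= (2 * Co)%:E * \int[mu_measure mu]_x (osc (4 * t) x)%:E)%E \/
  ((m * t)%:E <= (2 * Co * m `^ Q^-1)%:E * \int[mu_measure mu]_x (osc (4 * t) x)%:E)%E.
Proof.
move=> t0 m0 m1 mf0.
have m20 : 0 < m / 2 by rewrite divr_gt0.
have m2m : m / 2 < m by rewrite ltr_pdivrMr// ltr_pMr// ltr1n.
have [|r1 h1] := @ball_exhaust _ _ mu breg _ point (m / 2) (level_measurable 1).
  by apply: lt_le_trans m1; rewrite lte_fin.
have [|r2 h2] := @ball_exhaust _ _ mu breg _ point (m / 2) (level_measurable 0).
  by rewrite mf0 ltry.
pose r0 := Num.max t (Num.max r1 r2).
have tr0 : t <= r0 by rewrite le_max lexx.
have {}h1 := h1 r0 ltac:(by rewrite !le_max lexx !orbT).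
have {}h2 := h2 r0 ltac:(by rewrite !le_max lexx !orbT).
have h2' : ((m / 2)%:E <= 2%:E * mu ([set x | f x = 0%R] `&` ball point r0))%E.
  apply: le_trans (ltW h2) _; rewrite lee_pemull ?outer_measure_ge0//.
  by rewrite lee_fin ler1n.
have osc0 x : (0 <= (osc (4 * t) x)%:E)%E by rewrite lee_fin; apply: oscillation_ge0.
have := oscillation_lower_bound breg dbl poin c00 Q1 ahl mf f01 t0 tr0 m20 (ltW h1) h2'.
set E1 := (\int[_]_(_ in _) _)%E; set E2 := (\int[_]_(_ in _) _)%E.
have E12 : (E1 <= E2)%E by apply: lower_integral_subset.
have E20 : (0 <= E2)%E by exact: integral_ge0.
case=> h; [left|right].
  rewrite EFinM -muleA -lee_pdivrMl// muleC -EFinM.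
  by apply: (le_trans h); rewrite lee_pmul2l.
have sm : Num.min ((m / 2) `^ Q^-1) r0 <= m `^ Q^-1.
  rewrite ge_min; apply/orP; left.
  by rewrite ge0_ler_powR ?nnegrE ?invr_ge0 ?(ltW Q0) ?(ltW m0) ?(ltW m20) ?(ltW m2m).
have -> : (m * t)%:E = (2%:E * (m / 2 * t)%:E)%E.
  by rewrite -EFinM; congr (_%:E); field.
rewrite -[2 * Co * _]mulrA [(2 * (Co * _))%:E]EFinM -muleA.
apply: lee_wpmul2l; first by rewrite lee_fin.
apply: (le_trans h); apply: (@le_trans _ _ ((Co * Num.min ((m / 2) `^ Q^-1) r0)%:E * E2)%E).
  by rewrite lee_wpmul2l// lee_fin mulr_ge0 ?(ltW Co0)// le_min powR_ge0 (le_trans (ltW t0)).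
by rewrite lee_wpmul2r// lee_fin ler_pM2l.
Qed.

Let pow_scale s j : 0 < s -> (4 * s / 2 ^+ j) `^ (- theta) * 2^-1 ^+ j =
  (4 * s) `^ (- theta) * (2 `^ (- (1 - theta))) ^+ j.
Proof.
move=> s0; rewrite powRM ?invr_ge0 ?exprn_ge0 ?mulr_ge0 ?(ltW s0)//.
rewrite -mulrA; congr (_ * _).
rewrite -exprVn powR_exprn ?invr_ge0// -exprMn; congr (_ ^+ _).
rewrite -[X in X `^ _]powR_inv1// -powRrM mulN1r opprK.
rewrite -[X in _ * X]powR_inv1// -powRD; first by congr (_ `^ _); ring.
by rewrite pnatr_eq0 implybT.
Qed.

Let pow4 s : 0 < s -> s `^ (- theta) / 4 <= (4 * s) `^ (- theta).
Proof.
move=> s0; rewrite powRM ?(ltW s0)// [leRHS]mulrC ler_pM2l ?powR_gt0//.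
rewrite powRN lef_pV2 ?posrE ?powR_gt0//.
by rewrite ler1_powR ?ler1n// ltW.
Qed.

Lemma sum_scales_le_energy (D : set X) r n (Ce : R) (a : nat -> R) : 0 < r -> 0 < Ce ->
  (forall j, ((a j)%:E <= Ce%:E *
    \int[mu_measure mu]_(x in D) (osc (r / 2 ^+ j) x)%:E)%E) ->
  ((\sum_(0 <= j < n) (r / 2 ^+ j) `^ (- theta) * a j)%:E <= Ce%:E *
    ((Cmu ^+ 4)%:E * \int[mu_measure mu]_(x in D)
      \int[mu_measure mu]_(y in ball x r) frac_kernel mu theta (EFin \o f) x y))%E.
Proof.
move=> r0 Ce0 aE; rewrite -sumEFin.
have E0 j : (0 <= \int[mu_measure mu]_(x in D) (osc (r / 2 ^+ j) x)%:E)%E.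
  by apply: integral_ge0 => x _; rewrite lee_fin; apply: oscillation_ge0.
apply: (@le_trans _ _ (Ce%:E * \sum_(0 <= j < n) (((r / 2 ^+ j) `^ (- theta))%:E *
    \int[mu_measure mu]_(x in D) (osc (r / 2 ^+ j) x)%:E))%E).
  rewrite ge0_sume_distrr; last by move=> j _; rewrite mule_ge0// lee_fin powR_ge0.
  by apply: lee_sum => j _; rewrite EFinM muleCA lee_wpmul2l// lee_fin powR_ge0.
apply: lee_wpmul2l; first by rewrite lee_fin ltW.
exact: (sum_oscillation_le_energy breg dbl poin muT mf f01 th).
Qed.

(** The exponent is 1 - theta / Q, and s <= m^(1/Q) gives m^(-theta/Q) <= s^-theta. The 4 absorbs
    the dilation of s. *)
Let mpow m s : 0 < m -> 0 < s -> s <= m `^ Q^-1 ->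
  m `^ ((Q - theta) / Q) <= 4 * (4 * s) `^ (- theta) * m.
Proof.
move=> m0 s0 sm; apply: (@le_trans _ _ (m * s `^ (- theta))).
  have -> : (Q - theta) / Q = 1 - theta / Q by field; rewrite gt_eqF.
  rewrite powRB; last by rewrite (gt_eqF m0) implybT.
  rewrite powRr1 ?(ltW m0)// ler_pM2l// powRN lef_pV2 ?posrE ?powR_gt0//.
  rewrite mulrC powRrM ge0_ler_powR ?nnegrE ?powR_ge0 ?(ltW th0) ?(ltW s0)//.
by rewrite mulrC ler_pM2r//; have := pow4 s0; lra.
Qed.

(** At t = s / 2^j both alternatives of [oscillation_lower_bound] give m 2^-j <= Co * E j. With
    weights (4 s / 2^j)^-theta this becomes a geometric sum of size 1 / (1 - theta). The radius 5 +
    2 tauP leaves room for the inner balls of radius 4 s. *)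
Lemma weak_type_local x0 r0 m : 0 < r0 -> 0 < m ->
  (m%:E <= mu ([set x | f x = 1%R] `&` ball x0 r0))%E ->
  (m%:E <= 2%:E * mu ([set x | f x = 0%R] `&` ball x0 r0))%E ->
  ((m `^ ((Q - theta) / Q))%:E <= (8 * Co * Cmu ^+ 4 * (1 - theta))%:E *
    frac_energy mu theta (ball x0 ((5 + 2 * tauP) * r0)) (EFin \o f))%E.
Proof.
move=> r00 m0 m1 m2.
pose s := Num.min (m `^ Q^-1) r0.
have s0 : 0 < s by rewrite lt_min powR_gt0// r00.
have sr : s <= r0 by rewrite ge_min lexx orbT.
pose D := ball x0 ((1 + 2 * tauP) * r0).
set EE := frac_energy _ _ _ _.
pose E j := (\int[mu_measure mu]_(x in D) (osc (4 * s / 2 ^+ j) x)%:E)%E.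
have mE j : ((m * 2^-1 ^+ j)%:E <= Co%:E * E j)%E.
  pose t := s / 2 ^+ j.
  have t0 : 0 < t by rewrite divr_gt0// exprn_gt0.
  have ts : t <= s by rewrite ler_pdivrMr ?exprn_gt0// ler_peMr ?(ltW s0)// exprn_ege1// ler1n.
  have := oscillation_lower_bound breg dbl poin c00 Q1 ahl mf f01 t0 (le_trans ts sr) m0 m1 m2.
  rewrite (_ : 4 * t = 4 * s / 2 ^+ j); last by rewrite /t mulrA.
  rewrite -/D -/(E j) -/s => -[h|h].
    apply: le_trans h; rewrite lee_fin ler_piMr ?(ltW m0)//.
    by rewrite exprn_ile1// invr_le1 ?unitfE// ler1n.
  have -> : (m * 2^-1 ^+ j)%:E = ((s^-1)%:E * (m * t)%:E)%E.
    by rewrite -EFinM /t exprVn; congr (_%:E); field; rewrite expf_neq0 gt_eqF.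
  rewrite lee_pdivrMl//; apply: (le_trans h).
  by rewrite mulrC EFinM muleA.
have [n0 hn0] := @sum_geometric_powR R (1 - theta) ltac:(by rewrite subr_gt0) ltac:(by rewrite gtrBl).
have {hn0}hn := hn0 n0 (leqnn _).
set S := \sum_(0 <= j < n0) _ in hn.
have s40 : 0 < 4 * s by rewrite mulr_gt0.
have := sum_scales_le_energy n0 s40 Co0 mE.
set EK := (\int[_]_(_ in _) _)%E => bound.
have EKE : (EK <= EE)%E.
  have k0 x y := frac_kernel_ge0 dbl theta (EFin \o f) x y.
  apply: (@le_trans _ _ (\int[mu_measure mu]_(x in D)
      \int[mu_measure mu]_(y in ball x0 ((5 + 2 * tauP) * r0)) frac_kernel mu theta (EFin \o f) x y)%E).
    apply: le_lower_integral => x; first by move=> _; apply: integral_ge0.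
    rewrite /D ballEmdist/= => xD; apply: lower_integral_subset => //.
    by apply: ball_sub; move: xD sr; lra.
  apply: lower_integral_subset; last by move=> x _; apply: integral_ge0.
  by apply: ball_sub; rewrite mdistxx add0r ler_wpM2r ?(ltW r00)// lerD2r; lra.
have sumE : \sum_(0 <= j < n0) (4 * s / 2 ^+ j) `^ (- theta) * (m * 2^-1 ^+ j) =
    (4 * s) `^ (- theta) * m * S.
  rewrite /S mulr_sumr; apply: eq_bigr => j _.
  by rewrite mulrCA pow_scale//; ring.
rewrite sumE in bound.
have -> : (8 * Co * Cmu ^+ 4 * (1 - theta))%:E =
    ((8 * (1 - theta))%:E * (Co%:E * (Cmu ^+ 4)%:E))%E by rewrite -!EFinM; congr (_%:E); ring.
have t18 : 0 < 8 * (1 - theta) by rewrite mulr_gt0// subr_gt0.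
rewrite -muleA -lee_pdivrMl// -muleA.
apply: (@le_trans _ _ (Co%:E * ((Cmu ^+ 4)%:E * EK))%E); last first.
  apply: lee_wpmul2l; first by rewrite lee_fin ltW.
  by apply: lee_wpmul2l => //; rewrite lee_fin exprn_ge0// ltW.
apply: le_trans bound.
rewrite -EFinM lee_fin ler_pdivrMl//; apply: (le_trans (mpow m0 s0 _)).
  by rewrite ge_min lexx.
have t1 : 0 < 1 - theta by rewrite subr_gt0.
have S1 : 1 <= 2 * (1 - theta) * S.
  by move: hn; rewrite ler_pdivrMr ?mulr_gt0// [leRHS]mulrC.
have p0 : 0 < (4 * s) `^ (- theta) * m by rewrite mulr_gt0// powR_gt0.
by move: (ler_wpM2l (ltW p0) S1); lra.
Qed.

(** Scales above s = m^(1/Q) are now available too. There both alternatives give m itself, and the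
    weights sum to 1 / (2 theta); with the small scales, 1 / (2 theta) + 1 / (2 (1 - theta)) = 1 /
    (2 theta (1 - theta)). *)
Lemma weak_type_global m : 0 < m ->
  (m%:E <= mu [set x | f x = 1%R])%E -> mu [set x | f x = 0%R] = +oo%E ->
  ((m `^ ((Q - theta) / Q))%:E <= (32 * Co * Cmu ^+ 4 * (theta * (1 - theta)))%:E *
    frac_energy mu theta [set: X] (EFin \o f))%E.
Proof.
move=> m0 m1 m2.
pose s := m `^ Q^-1.
have s0 : 0 < s by rewrite powR_gt0.
have Co2 : 0 < 2 * Co by rewrite mulr_gt0.
set EE := frac_energy _ _ _ _.
have k0 x y := frac_kernel_ge0 dbl theta (EFin \o f) x y.
have [n1 hn1] := @sum_geometric_powR R (1 - theta) ltac:(by rewrite subr_gt0) ltac:(by rewrite gtrBl).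
have [n2 hn2] := @sum_geometric_powR R theta th0 th1.
have {}hn1 := hn1 n1 (leqnn _); have {}hn2 := hn2 n2.+1 (leqnSn _).
set S1 := \sum_(0 <= j < n1) _ in hn1; set S2 := \sum_(0 <= j < n2.+1) _ in hn2.
have s40 : 0 < 4 * s by rewrite mulr_gt0.
have t1 : 0 < 1 - theta by rewrite subr_gt0.
pose w : R := (4 * s) `^ (- theta) * m.
have w0 : 0 < w by rewrite mulr_gt0// powR_gt0.
(* At t = r / 2^j / 4 the two alternatives yield the fraction min(1, t / s) of m, and [a j] is a
   lower bound for it. Replacing it by 0 from n on provides the bound at every j that
   [sum_scales_le_energy] asks for. *)
have scale r n (a : nat -> R) : 0 < r ->
    (forall j, (j < n)%N -> r / 2 ^+ j / (4 * s) >= a j) -> (forall j, a j <= 1) ->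
    ((\sum_(0 <= j < n) (r / 2 ^+ j) `^ (- theta) * (m * a j))%:E <=
     (2 * Co)%:E * ((Cmu ^+ 4)%:E * EE))%E.
  move=> r0 ra a1.
  apply: (@le_trans _ _ ((\sum_(0 <= j < n) (r / 2 ^+ j) `^ (- theta) *
      (m * (if (j < n)%N then a j else 0)))%:E)).
    by rewrite lee_fin !big_mkord; apply: ler_sum => j _; rewrite ltn_ord.
  apply: le_trans (sum_scales_le_energy n r0 Co2 (D := setT) _) _.
    move=> j; set E := (\int[_]_(_ in _) _)%E.
    have E0 : (0 <= E)%E.
      by apply: integral_ge0 => x _; rewrite lee_fin; apply: oscillation_ge0.
    case: ifPn => jn; last by rewrite mulr0 mule_ge0// lee_fin ltW.
    pose t := r / 2 ^+ j / 4.
    have t0 : 0 < t by rewrite !divr_gt0// exprn_gt0.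
    have := oscillation_lower_bound_global t0 m0 m1 m2.
    rewrite (_ : 4 * t = r / 2 ^+ j); last by rewrite /t; field; rewrite expf_neq0.
    rewrite -/E -/s => -[h|h].
      by apply: le_trans h; rewrite lee_fin ler_piMr ?(ltW m0).
    apply: (@le_trans _ _ ((s^-1)%:E * (m * t)%:E)%E).
      rewrite -EFinM lee_fin mulrCA ler_pM2l//; apply: (le_trans (ra _ jn)).
      rewrite le_eqVlt; apply/orP; left; apply/eqP; rewrite /t; field.
      by rewrite expf_neq0// gt_eqF.
    rewrite lee_pdivrMl//; apply: (le_trans h).
    by rewrite mulrC EFinM muleA.
  apply: lee_wpmul2l; first by rewrite lee_fin ltW.
  apply: lee_wpmul2l; first by rewrite lee_fin exprn_ge0// ltW.
  apply: le_lower_integral => x _; first by apply: integral_ge0.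
  exact: lower_integral_subset.
have small : ((w * S1)%:E <= (2 * Co)%:E * ((Cmu ^+ 4)%:E * EE))%E.
  have -> : w * S1 = \sum_(0 <= j < n1) (4 * s / 2 ^+ j) `^ (- theta) * (m * 2^-1 ^+ j).
    rewrite /S1 mulr_sumr; apply: eq_bigr => j _.
    by rewrite [in RHS]mulrCA pow_scale// /w; ring.
  apply: scale => // j; last by rewrite exprn_ile1// invr_le1 ?unitfE// ler1n.
  move=> _; rewrite exprVn le_eqVlt; apply/orP; left; apply/eqP; field.
  by rewrite gt_eqF// expf_neq0.
(* The scales 4 s 2^i with i <= n2 are listed from the largest down, which is the order of r / 2^j;
   hence the reversal of the sum. *)
have large : ((w * S2)%:E <= (2 * Co)%:E * ((Cmu ^+ 4)%:E * EE))%E.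
  have -> : w * S2 = \sum_(0 <= j < n2.+1) (4 * s * 2 ^+ n2 / 2 ^+ j) `^ (- theta) * (m * 1).
    rewrite /S2 mulr_sumr big_nat_rev/= add0n; apply: eq_big_nat => j; rewrite ltnS /= => jn.
    rewrite subSS mulr1 /w mulrAC; congr (_ * _).
    rewrite -powR_exprn// -powRM ?exprn_ge0 ?(ltW s40)//; congr (_ `^ _).
    by rewrite -{2}(subnK jn) exprD; field; rewrite expf_neq0.
  apply: scale => //; first by rewrite mulr_gt0// exprn_gt0.
  move=> j; rewrite ltnS => jn.
  have -> : 4 * s * 2 ^+ n2 / 2 ^+ j / (4 * s) = 2 ^+ (n2 - j).
    by rewrite -{1}(subnK jn) exprD; field; rewrite gt_eqF// expf_neq0.
  by rewrite exprn_ege1// ler1n.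
have {small large}sum : ((w * (S1 + S2))%:E <= (4 * Co)%:E * ((Cmu ^+ 4)%:E * EE))%E.
  have -> : (4 * Co)%:E = ((2 * Co)%:E + (2 * Co)%:E)%E by rewrite -EFinD; congr (_%:E); ring.
  by rewrite mulrDr EFinD ge0_muleDl ?lee_fin ?(ltW Co2)// leeD.
have S12 : 1 / (2 * (theta * (1 - theta))) <= S1 + S2.
  apply: le_trans (lerD hn1 hn2); rewrite le_eqVlt; apply/orP; left; apply/eqP; field.
  by rewrite !gt_eqF.
have tt : 0 < theta * (1 - theta) by rewrite mulr_gt0.
have t8 : 0 < 8 * (theta * (1 - theta)) by rewrite mulr_gt0.
have -> : (32 * Co * Cmu ^+ 4 * (theta * (1 - theta)))%:E =
    ((8 * (theta * (1 - theta)))%:E * ((4 * Co)%:E * (Cmu ^+ 4)%:E))%E.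
  by rewrite -!EFinM; congr (_%:E); ring.
rewrite -muleA -lee_pdivrMl// -muleA; apply: le_trans sum.
rewrite -EFinM lee_fin ler_pdivrMl//; apply: (le_trans (mpow m0 s0 (lexx _))).
move: S12; rewrite ler_pdivrMr ?mulr_gt0// => /(ler_wpM2l (ltW w0)); rewrite /w.
by lra.
Qed.

End weak_type.

(** * Layer cake and dyadic truncation *)

Lemma powRD_ge (R : realType) (p x y : R) : 1 <= p -> 0 <= x -> 0 <= y ->
  x `^ p + y `^ p <= (x + y) `^ p.
Proof.
move=> p1 x0 y0; have p0 : 0 < p by exact: lt_le_trans p1.
have p10 : 0 <= p - 1 by rewrite subr_ge0.
have xy0 : 0 <= x + y by rewrite addr_ge0.
rewrite -(mulr_powRB1 x0 p0) -(mulr_powRB1 y0 p0) -(mulr_powRB1 xy0 p0) mulrDl.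
apply: lerD; apply: ler_wpM2l => //; apply: ge0_ler_powR; rewrite ?nnegrE//.
  by rewrite lerDl.
by rewrite lerDr.
Qed.

Lemma sum_powR_le (R : realType) (p : R) (x : nat -> R) n : 1 <= p ->
  (forall j, 0 <= x j) ->
  \sum_(0 <= j < n) x j `^ p <= (\sum_(0 <= j < n) x j) `^ p.
Proof.
move=> p1 x0; elim: n => [|n ih]; first by rewrite !big_geq// powR_ge0.
rewrite !big_nat_recr//=; apply: le_trans (powRD_ge p1 _ (x0 _)).
  by rewrite lerD2r.
exact: sumr_ge0.
Qed.

Section layer_cake.
Context d (T : measurableType d) (R : realType).
Variable mu : {measure set T -> \bar R}.
Variables (D : set T) (h : T -> R) (p K : R).
Hypothesis mD : measurable D.
Hypothesis mh : measurable_fun [set: T] h.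
Hypothesis h0 : forall x, 0 <= h x.
Hypothesis p1 : 1 <= p.

Let lev (c : R) := D `&` [set x | c <= h x].
Hypothesis levfin : forall c : R, 0 < c -> (mu (lev c) < +oo)%E.
Hypothesis levsum : forall (a : R) n, 0 < a ->
  \sum_(0 <= j < n) a * 2 ^+ j * fine (mu (lev (2 * (a * 2 ^+ j)))) `^ p^-1 <= K.

Let p0 : 0 < p. Proof. exact: lt_le_trans p1. Qed.

Let K0 : 0 <= K.
Proof. by have := @levsum 1 0%N ltr01; rewrite big_geq. Qed.

Lemma measurable_superlevel (c : R) : measurable [set x | c <= h x].
Proof.
have := mh measurableT (measurable_itv `[c, +oo[).
rewrite setTI; congr (measurable _).
by apply/seteqP; split => x /=; rewrite in_itv/= andbT.
Qed.

Let mhp : measurable_fun D (fun x => (h x `^ p)%:E).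
Proof.
apply/measurable_EFinP; apply: measurable_funTS.
exact: (measurableT_comp (measurable_powR p) mh).
Qed.

Let band j := [set x | 2 / 2 ^+ j <= h x /\ h x < 2 * 2 ^+ j].

Let mband j : measurable (band j).
Proof.
rewrite (_ : band j = [set x | 2 / 2 ^+ j <= h x] `&` ~` [set x | 2 * 2 ^+ j <= h x]).
  apply: measurableI; first exact: measurable_superlevel.
  by apply: measurableC; exact: measurable_superlevel.
apply/seteqP; split => x /= [h1 h2]; split => //; first by apply/negP; rewrite -ltNge.
by rewrite ltNge; apply/negP.
Qed.

Let dyadic (a : R) n (s : R) : 0 < a -> 2 * a <= s -> s < 2 * (a * 2 ^+ n) ->
  exists j, [/\ (j < n)%N, 2 * (a * 2 ^+ j) <= s & s < 4 * (a * 2 ^+ j)].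
Proof.
move=> a0; elim: n => [|n ih] h1 h2.
  by move: h2; rewrite expr0 mulr1 ltNge h1.
have [h3|h3] := ltP s (2 * (a * 2 ^+ n)).
  by have [j [jn j1 j2]] := ih h1 h3; exists j; split => //; exact: ltnW.
exists n; split => //; move: h2; rewrite exprS; lra.
Qed.

(** On the band, h lies between l and 2 l for some level l = 2 a 2^i with a = 2^-j and i < 2 j. As p
    >= 1, the sum of the p-th powers is at most the p-th power of the sum, which [levsum]
    controls. *)
Let band_bound j :
  (\int[mu]_(x in D) ((h x `^ p) * \1_(band j) x)%:E <= ((4 * K) `^ p)%:E)%E.
Proof.
pose a : R := (2 ^+ j)^-1; pose n := (j + j)%N.
have a0 : 0 < a by rewrite invr_gt0 exprn_gt0.
pose c i := (4 * (a * 2 ^+ i)) `^ p.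
have c0 i : 0 <= c i by exact: powR_ge0.
pose L i := [set x | 2 * (a * 2 ^+ i) <= h x].
have mL i : measurable (L i) by exact: measurable_superlevel.
apply: (@le_trans _ _ (\int[mu]_(x in D) \sum_(0 <= i < n) (c i * \1_(L i) x)%:E)%E).
  apply: le_lower_integral => x Dx; first by rewrite lee_fin mulr_ge0 ?powR_ge0.
  rewrite sumEFin lee_fin indicE; have [xb|xb] := boolP (x \in band j); last first.
    by rewrite mulr0 sumr_ge0// => i _; rewrite mulr_ge0.
  rewrite mulr1; move: xb; rewrite inE => -[h1 h2].
  have [||i [ni i1 i2]] := @dyadic a n (h x) a0; first by [].
    by rewrite /a /n exprD mulKf ?expf_neq0.
  rewrite (bigD1_seq i)/= ?mem_index_iota ?iota_uniq//; apply: ler_wpDr.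
    by apply: sumr_ge0 => k _; rewrite mulr_ge0.
  rewrite indicE mem_set// mulr1 /c ge0_ler_powR ?nnegrE ?(ltW p0) ?(ltW i2)//.
  by rewrite mulr_ge0// mulr_ge0 ?exprn_ge0 ?ltW.
have mcL i : measurable_fun D (fun x => (c i * \1_(L i) x)%:E).
  by apply/measurable_EFinP; apply: measurable_funM.
rewrite ge0_integral_sum//; last by move=> i x _; rewrite lee_fin mulr_ge0.
apply: (@le_trans _ _ (\sum_(0 <= i < n)
    ((4 * (a * 2 ^+ i * fine (mu (lev (2 * (a * 2 ^+ i)))) `^ p^-1)) `^ p)%:E)%E).
  apply: lee_sum => i _; rewrite (eq_integral (fun x => (c i)%:E * (\1_(L i) x)%:E)%E)//.
  rewrite lower_integralZl//; rewrite integral_indic// setIC.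
  have l0 : 0 < 2 * (a * 2 ^+ i) by rewrite !mulr_gt0// exprn_gt0.
  rewrite -/(lev _); set w := mu (lev _).
  have wE : w = (fine w)%:E by rewrite fineK// ge0_fin_numE ?measure_ge0//; exact: levfin.
  rewrite {1}wE -EFinM lee_fin.
  have -> : 4 * (a * 2 ^+ i * fine w `^ p^-1) = 4 * (a * 2 ^+ i) * fine w `^ p^-1.
    by rewrite mulrA.
  rewrite powRM ?powR_ge0//; last by rewrite mulr_ge0// mulr_ge0 ?exprn_ge0 ?ltW.
  have -> : (fine w `^ p^-1) `^ p = fine w.
    by rewrite -powRrM mulVf ?gt_eqF// powRr1// fine_ge0// measure_ge0.
  by [].
rewrite sumEFin lee_fin.
have t0 i : 0 <= 4 * (a * 2 ^+ i * fine (mu (lev (2 * (a * 2 ^+ i)))) `^ p^-1).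
  by rewrite mulr_ge0// mulr_ge0 ?powR_ge0// mulr_ge0 ?exprn_ge0 ?ltW.
apply: le_trans (sum_powR_le n p1 t0) _.
rewrite ge0_ler_powR ?nnegrE ?(ltW p0) ?sumr_ge0 ?mulr_ge0//.
by rewrite -mulr_sumr ler_pM2l// levsum.
Qed.

(** The bands increase to the set where h > 0, and the integrand vanishes elsewhere because p > 0:
    monotone convergence. *)
Lemma layer_cake : (\int[mu]_(x in D) (h x `^ p)%:E <= ((4 * K) `^ p)%:E)%E.
Proof.
pose g j x : \bar R := ((h x `^ p) * \1_(band j) x)%:E.
have mono j k : (j <= k)%N -> band j `<=` band k.
  move=> jk x [h1 h2]; split.
    apply: le_trans h1; rewrite ler_pM2l// lef_pV2 ?posrE ?exprn_gt0//.
    by rewrite ler_weXn2l// ler1n.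
  by apply: (lt_le_trans h2); rewrite ler_pM2l// ler_weXn2l// ler1n.
have lim_g x : limn (g ^~ x) = (h x `^ p)%:E.
  apply: lim_near_cst => //; have := h0 x; rewrite le_eqVlt => /predU1P[hx|hx].
    by near=> j; rewrite /g -hx powR0 ?mul0r// gt_eqF.
  have [j0 xj0] : exists j, band j x.
    pose j1 := Num.truncn (2 / h x); pose j2 := Num.truncn (h x).
    have b1 : 2 / h x < 2 ^+ (maxn j1 j2).
      apply: lt_le_trans (truncnS_gt _) _.
      rewrite -natrX ler_nat; apply: leq_trans (ltn_expl (maxn j1 j2) (ltnSn 1)).
      by rewrite ltnS leq_maxl.
    have b2 : h x < 2 ^+ (maxn j1 j2).
      apply: lt_le_trans (truncnS_gt _) _.
      rewrite -natrX ler_nat; apply: leq_trans (ltn_expl (maxn j1 j2) (ltnSn 1)).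
      by rewrite ltnS leq_maxr.
    exists (maxn j1 j2); split.
      rewrite ler_pdivrMr ?exprn_gt0// mulrC -ler_pdivrMr//; exact: ltW.
    by apply: (lt_le_trans b2); rewrite ler_peMl ?exprn_ge0// ler1n.
  near=> j; rewrite /g indicE mem_set ?mulr1//.
  by apply: (mono j0) => //; near: j; exact: nbhs_infty_ge.
rewrite (eq_integral (fun x => limn (g ^~ x))); last by move=> x _; rewrite lim_g.
have mg j : measurable_fun D (g j).
  apply/measurable_EFinP; apply: measurable_funM; first exact/measurable_EFinP.
  by apply: measurable_indic.
have g0 j x : D x -> (0 <= g j x)%E by move=> _; rewrite lee_fin mulr_ge0 ?powR_ge0.
have ndg x : D x -> {homo g ^~ x : j k / (j <= k)%N >-> (j <= k)%E}.
  move=> _ j k jk; rewrite lee_fin ler_wpM2l ?powR_ge0// !indicE.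
  have [xj|xj] := boolP (x \in band j) => //.
  by rewrite mem_set//; apply: (mono _ _ jk); rewrite inE in xj.
rewrite monotone_convergence//; apply: lime_le; last by apply: nearW => j; exact: band_bound.
apply: ereal_nondecreasing_is_cvgn => j k jk; apply: le_lower_integral => x Dx; first exact: g0.
exact: ndg.
Unshelve. all: by end_near. Qed.

End layer_cake.

(** * Truncation between dyadic levels *)

Section truncation.
Context {R : realType}.
Implicit Types (a s : R).

(** The part of s between the levels l and 2 l, rescaled to [0, 1]. *)
Definition trunc_step (l s : R) : R := Num.min 1 (Num.max 0 (s / l - 1)).

Lemma trunc_step01 l s : 0 <= trunc_step l s <= 1.
Proof. by rewrite /trunc_step ge_min lexx le_min ler01 le_max lexx. Qed.

Lemma trunc_step1 l s : 0 < l -> (trunc_step l s = 1) <-> (2 * l <= s).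
Proof.
move=> l0; rewrite /trunc_step; split => [/min_idPl|h].
  rewrite le_max (_ : (1 <= 0 :> R) = false) ?orFb; last by rewrite ler10.
  by rewrite lerBrDr ler_pdivlMr// (_ : 1 + 1 = 2).
apply/min_idPl; rewrite le_max lerBrDr ler_pdivlMr// (_ : 1 + 1 = 2)// h.
by rewrite orbT.
Qed.

Lemma trunc_step0 l s : 0 < l -> s <= l -> trunc_step l s = 0.
Proof.
move=> l0 sl; rewrite /trunc_step (max_idPl _) ?(min_idPr _)//.
by rewrite subr_le0 ler_pdivrMr// mul1r.
Qed.

Lemma trunc_stepE l s : 0 < l ->
  l * trunc_step l s = Num.min (2 * l) (Num.max s l) - l.
Proof.
move=> l0; rewrite /trunc_step.
have e : l * (s / l - 1) = s - l by field; rewrite gt_eqF.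
have [h|h] := leP 0 (s / l - 1).
  have sl : l <= s by move: h; rewrite subr_ge0 ler_pdivlMr// mul1r.
  rewrite (max_idPl sl); have [h'|h'] := leP 1 (s / l - 1).
    have s2 : 2 * l <= s by move: h'; rewrite lerBrDr ler_pdivlMr// (_ : 1 + 1 = 2).
    by rewrite (min_idPl s2); ring.
  have s2 : s <= 2 * l.
    by move: h'; rewrite ltrBlDr ltr_pdivrMr// (_ : 1 + 1 = 2)// => /ltW.
  by rewrite (min_idPr s2) e.
have sl : s <= l by move: h; rewrite subr_lt0 ltr_pdivrMr// mul1r => /ltW.
rewrite (max_idPr sl) (min_idPr (ler01)) (min_idPr _); first by ring.
by rewrite ler_peMl ?ler1n// ltW.
Qed.

Lemma sum_trunc_step a n s : 0 < a ->
  \sum_(0 <= j < n) a * 2 ^+ j * trunc_step (a * 2 ^+ j) s =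
  Num.min (a * 2 ^+ n) (Num.max s a) - a.
Proof.
move=> a0; have l0 j : 0 < a * 2 ^+ j by rewrite mulr_gt0// exprn_gt0.
elim: n => [|n ih].
  by rewrite big_geq// expr0 mulr1 (min_idPl _) ?subrr// le_max lexx orbT.
rewrite big_nat_recr//= ih trunc_stepE// (mulrCA 2) -exprS.
set l := a * 2 ^+ n; have al : a <= l by rewrite ler_peMr ?(ltW a0)// exprn_ege1// ler1n.
have -> : a * 2 ^+ n.+1 = 2 * l by rewrite /l exprS; ring.
have ll := l0 n; rewrite -/l in ll.
have [h1|h1] := leP s a.
  rewrite (max_idPr (le_trans h1 al)) (min_idPr al) (min_idPr _); last by lra.
  by rewrite (min_idPr _); lra.
have [h2|h2] := leP s l.
  have -> : Num.min (2 * l) l = l by apply/min_idPr; lra.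
  have -> : Num.min (2 * l) s = s by apply/min_idPr; lra.
  by ring.
by ring.
Qed.

Lemma trunc_step_homo l s s' : 0 < l -> s' <= s -> trunc_step l s' <= trunc_step l s.
Proof.
move=> l0 ss; rewrite /trunc_step le_min ge_min lexx/= ge_min; apply/orP; right.
rewrite ge_max !le_max lexx/= lerD2r ler_pdivrMr// divfK ?gt_eqF// ss.
by rewrite orbT.
Qed.

(** Truncations are monotone, so all differences have one sign and add up to the difference of the
    clippings of s and s' to [a, a 2^n]; clipping is 1-Lipschitz. *)
Lemma sum_trunc_step_dist a n s s' : 0 < a ->
  \sum_(0 <= j < n) a * 2 ^+ j *
    `|trunc_step (a * 2 ^+ j) s - trunc_step (a * 2 ^+ j) s'| <= `|s - s'|.
Proof.
move=> a0; have l0 j : 0 < a * 2 ^+ j by rewrite mulr_gt0// exprn_gt0.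
wlog ss : s s' / s' <= s.
  move=> h; have [/h//|/ltW /h] := leP s' s.
  by rewrite distrC; under eq_bigr do rewrite distrC.
rewrite (ger0_norm (_ : 0 <= s - s')) ?subr_ge0//.
under eq_bigr do rewrite ger0_norm ?subr_ge0 ?trunc_step_homo// mulrBr.
rewrite sumrB !sum_trunc_step// opprB addrA subrK.
set b := a * 2 ^+ n; rewrite /Num.max /Num.min.
by case: (ltP s a) => h1; case: (ltP s' a) => h2; repeat case: ltP => ?; lra.
Qed.

End truncation.

Lemma measurable_trunc_step (R : realType) (l : R) :
  measurable_fun [set: R] (trunc_step l).
Proof.
apply: measurable_minr => //; apply: measurable_maxr => //.
by apply: measurable_funB => //; exact: measurable_funM.
Qed.

(** * From weak type to strong type *)

Section median_mean.
Context d (T : measurableType d) (R : realType).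
Variable mu : {measure set T -> \bar R}.
Variables (B : set T) (w : T -> R) (V : R).
Hypothesis mB : measurable B.
Hypothesis mw : measurable_fun [set: T] w.
Hypothesis V0 : 0 < V.
Hypothesis muB : mu B = V%:E.

Let lo (c : R) := B `&` [set x | w x <= c].
Let hi (c : R) := B `&` [set x | c < w x].

Let mlo c : measurable (lo c).
Proof.
apply: measurableI => //; have := mw measurableT (measurable_itv `]-oo, c]).
by rewrite setTI.
Qed.

Let mhi c : measurable (hi c).
Proof.
apply: measurableI => //; have := mw measurableT (measurable_itv `]c, +oo[).
rewrite setTI; congr (measurable _).
by apply/seteqP; split => x /=; rewrite in_itv/= andbT.
Qed.

Let lohi c : (mu (lo c) + mu (hi c) = V%:E)%E.
Proof.
rewrite -muB -measureU//.
  congr (mu _); apply/seteqP; split => [x [[]|[]]//|x Bx].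
  by have [h|h] := leP (w x) c; [left|right].
by apply/seteqP; split => x //= [[_ /= h1] [_ /= h2]]; rewrite leNgt h2 in h1.
Qed.

Let fin_le (A : set T) : measurable A -> A `<=` B -> mu A \is a fin_num.
Proof.
move=> mA AB; rewrite ge0_fin_numE//; apply: (@le_lt_trans _ _ (mu B)).
  by apply: le_measure; rewrite ?inE.
by rewrite muB ltry.
Qed.

Let plo c := fine (mu (lo c)).

Let loE c : mu (lo c) = (plo c)%:E.
Proof. by rewrite fineK// fin_le// => x []. Qed.

Let hiE c : mu (hi c) = (V - plo c)%:E.
Proof.
have hf : mu (hi c) = (fine (mu (hi c)))%:E by rewrite fineK// fin_le// => x [].
have := lohi c; rewrite loE hf -EFinD => -[<-].
by rewrite addrAC subrr add0r.
Qed.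

Let lo_le c c' : c <= c' -> plo c <= plo c'.
Proof.
move=> cc; rewrite -lee_fin -!loE; apply: le_measure; rewrite ?inE//.
by move=> x [Bx /= h]; split => //=; exact: le_trans cc.
Qed.

Let inv_pos n : 0 < (n.+1%:R : R)^-1. Proof. by rewrite invr_gt0. Qed.

Let inv_mono n m : (n <= m)%N -> (m.+1%:R : R)^-1 <= n.+1%:R^-1.
Proof. by move=> nm; rewrite lef_pV2 ?posrE// ler_nat. Qed.

Let inv_small (e : R) : 0 < e -> exists n : nat, n.+1%:R^-1 < e.
Proof.
move=> e0; exists (Num.truncn e^-1).
by rewrite invf_plt ?posrE// truncnS_gt.
Qed.

(** The infimum of the levels below which at least half of the mass lies. Continuity from below of
    the measures of [hi (c + 1/n)] gives the first inequality; if the second failed, some level c -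
    1/n would already qualify. *)
Lemma median_exists : exists c : R,
  (V%:E <= 2%:E * mu (B `&` [set x | (w x <= c)%R]) /\
   V%:E <= 2%:E * mu (B `&` [set x | (c <= w x)%R]))%E.
Proof.
have V2 : V / 2 < V by rewrite ltr_pdivrMr// ltr_pMr// ltr1n.
have V2B : ((V / 2)%:E < mu B)%E by rewrite muB lte_fin.
pose S := [set s | V <= 2 * plo s].
have [s1 Ss1] : S !=set0.
  have [| | |n] := @measure_exhaust _ _ _ mu B (fun n => lo n%:R) (V / 2)%:E _ _ _ V2B.
  - by [].
  - by move=> n m nm x [Bx /= h]; split => //=; rewrite (le_trans h)// ler_nat.
  - apply/seteqP; split => [x Bx|x [n _ []]//].
    exists (Num.truncn (w x)).+1 => //; split => //=; exact/ltW/truncnS_gt.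
  rewrite loE lte_fin => h; exists n%:R; rewrite /S /=; lra.
have [s2 Ss2] : exists s2, lbound S s2.
  have [| | |n] := @measure_exhaust _ _ _ mu B (fun n => hi (- n%:R)) (V / 2)%:E _ _ _ V2B.
  - by [].
  - move=> n m nm x [Bx /= h]; split => //=; rewrite (le_lt_trans _ h)//.
    by rewrite lerN2 ler_nat.
  - apply/seteqP; split => [x Bx|x [n _ []]//].
    exists (Num.truncn (- w x)).+1 => //; split => //=.
    by rewrite ltrNl truncnS_gt.
  rewrite hiE lte_fin => h; exists (- n%:R) => s; rewrite /S /= leNgt => Ss.
  rewrite leNgt; apply/negP => /ltW /lo_le h'.
  by move/negP: Ss; apply; lra.
have infS : has_inf S by split; [exists s1|exists s2].
pose c := inf S.
have cS s : S s -> c <= s by move=> Ss; apply: ge_inf => //; exists s2.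
have approx e : 0 < e -> V <= 2 * plo (c + e).
  move=> e0; have [s Ss sc] := inf_adherent e0 infS.
  by apply: (le_trans Ss); rewrite ler_pM2l// lo_le// ltW.
exists c; split; rewrite leNgt; apply/negP.
  rewrite -/(lo c) loE -EFinM lte_fin => h.
  have hc : ((V / 2)%:E < mu (hi c))%E by rewrite hiE lte_fin; lra.
  have [| | |n] := @measure_exhaust _ _ _ mu (hi c) (fun n => hi (c + n.+1%:R^-1)) (V / 2)%:E _ _ _ hc.
  - by [].
  - move=> n m nm x [Bx /= h']; split => //=; rewrite (le_lt_trans _ h')//.
    by rewrite lerD2l inv_mono.
  - apply/seteqP; split => [x [Bx /= wx]|x [n _ [Bx /= h']]].
      have wc : 0 < w x - c by rewrite subr_gt0.
      by have [n hn] := inv_small wc; exists n => //; split => //=; rewrite addrC -ltrBrDr.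
    by split => //=; rewrite (lt_trans _ h')// ltrDl.
  rewrite hiE lte_fin; have := approx _ (inv_pos n); lra.
rewrite muleC => h.
have mge : measurable (B `&` [set x | c <= w x]).
  apply: measurableI => //; have := mw measurableT (measurable_itv `[c, +oo[).
  rewrite setTI; congr (measurable _).
  by apply/seteqP; split => x /=; rewrite in_itv/= andbT.
pose A := B `&` [set x | w x < c].
have mA : measurable A.
  apply: measurableI => //; have := mw measurableT (measurable_itv `]-oo, c[).
  by rewrite setTI.
have hA : ((V / 2)%:E < mu A)%E.
  have : (mu A + mu (B `&` [set x | (c <= w x)%R]) = V%:E)%E.
    rewrite -muB -measureU//.
      congr (mu _); apply/seteqP; split => [x [[]|[]]//|x Bx].
      by have [h1|h1] := ltP (w x) c; [left|right].
    by apply/seteqP; split => x //= [[_ /= h1] [_ /= h2]]; rewrite leNgt h1 in h2.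
  have fA : mu A = (fine (mu A))%:E by rewrite fineK// fin_le// => x [].
  move: h; have -> : mu (B `&` [set x | (c <= w x)%R]) = (fine (mu (B `&` [set x | (c <= w x)%R])))%:E.
    by rewrite fineK// fin_le// => x [].
  by rewrite fA -EFinM -EFinD !lte_fin => h [] h'; lra.
have [| | |n] := @measure_exhaust _ _ _ mu A (fun n => lo (c - n.+1%:R^-1)) (V / 2)%:E _ _ _ hA.
- by [].
- move=> n m nm x [Bx /= h']; split => //=; rewrite (le_trans h')//.
  by rewrite lerD2l lerN2 inv_mono.
- apply/seteqP; split => [x [Bx /= wx]|x [n _ [Bx /= h']]].
    have wc : 0 < c - w x by rewrite subr_gt0.
    by have [n hn] := inv_small wc; exists n => //; split => //=; rewrite lerBrDr addrC -lerBrDr ltW.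
  by split => //=; rewrite (le_lt_trans h')// gtrDl oppr_lt0.
rewrite loE lte_fin => h'.
have /cS : S (c - n.+1%:R^-1) by rewrite /S /=; lra.
by rewrite leNgt gtrDl oppr_lt0 inv_pos.
Qed.

Let wint := mu.-integrable B (EFin \o w).

(** The mean is within 2 M of c, where M is the p-th root of the mean of |w - c|^p allowed by A.
    Positivity of A permits negative powers of M. *)
Lemma mean_dist_powR (c p A : R) : wint -> 1 <= p -> 0 < A ->
  (\int[mu]_(x in B) (`|w x - c| `^ p)%:E <= (A `^ p)%:E)%E ->
  (\int[mu]_(x in B) (`|w x - V^-1 * \int[mu]_(y in B) w y| `^ p)%:E <=
    ((6 * A) `^ p)%:E)%E.
Proof.
move=> iw p1 A0 hA; have p0 : 0 < p by exact: lt_le_trans p1.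
set a := V^-1 * _.
pose M := A / V `^ p^-1.
have M0 : 0 < M by rewrite divr_gt0// powR_gt0.
have MV : M `^ p * V = A `^ p.
  rewrite /M powRM ?invr_ge0 ?powR_ge0 ?(ltW A0)//.
  rewrite -[(V `^ p^-1)^-1]powR_inv1 ?powR_ge0// -!powRrM.
  have -> : p^-1 * (-1 * p) = -1 by field; rewrite gt_eqF.
  by rewrite powR_inv1 ?(ltW V0)// divfK// gt_eqF.
have mwc c' : measurable_fun B (fun x => (`|w x - c'| `^ p)%:E).
  apply/measurable_EFinP; apply: measurable_funTS.
  apply: (measurableT_comp (measurable_powR p)).
  by apply: measurableT_comp => //; exact: measurable_funB.
have Bfin : (mu B < +oo)%E by rewrite muB ltry.
have icst c' : mu.-integrable B (EFin \o (cst c' : T -> R)).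
  apply/integrableP; split; first by apply/measurable_EFinP.
  by rewrite (eq_integral (cst `|c'|%:E))// integral_cst//= muB -EFinM ltry.
have iwc : mu.-integrable B (EFin \o (fun x => w x - c)).
  rewrite (_ : _ \o _ = (EFin \o w) \- (EFin \o cst c))%E; last exact/funext.
  exact: integrableB.
have p10 : 0 <= p - 1 by rewrite subr_ge0.
(* This pointwise bound takes the place of Hölder's inequality in passing from p-th powers to first
   powers. *)
have z_le z : 0 <= z -> z <= M + M `^ (1 - p) * z `^ p.
  move=> z0; have [zM|Mz] := leP z M.
    by apply: (le_trans zM); rewrite lerDl mulr_ge0 ?powR_ge0.
  have z0' : 0 < z by exact: lt_trans Mz.
  rewrite -[leLHS]add0r; apply: lerD; first exact: ltW.
  have {1}-> : z = z `^ (1 - p) * z `^ p.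
    rewrite -powRD; last by rewrite (gt_eqF z0') implybT.
    by rewrite subrK powRr1.
  rewrite ler_wpM2r ?powR_ge0// -[1 - p]opprB !powRN lef_pV2 ?posrE ?powR_gt0//.
  by rewrite ge0_ler_powR ?nnegrE// ltW.
have int1 : (\int[mu]_(x in B) `|w x - c|%:E <= (2 * M * V)%:E)%E.
  apply: (@le_trans _ _ (\int[mu]_(x in B) (M%:E + (M `^ (1 - p))%:E * (`|w x - c| `^ p)%:E))%E).
    by apply: le_lower_integral => x _; rewrite lee_fin// z_le.
  rewrite ge0_integralD//; last 3 first.
  - by move=> x _; rewrite lee_fin ltW.
  - by move=> x _; rewrite -EFinM lee_fin mulr_ge0 ?powR_ge0.
  - by apply: emeasurable_funM.
  rewrite lower_integralZl ?powR_ge0//.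
  rewrite integral_cst// muB.
  apply: (@le_trans _ _ (M%:E * V%:E + (M `^ (1 - p))%:E * (A `^ p)%:E)%E).
    by rewrite leeD2l// lee_wpmul2l// lee_fin powR_ge0.
  rewrite -!EFinM -EFinD lee_fin -MV mulrA -powRD; last by rewrite (gt_eqF M0) implybT.
  rewrite subrK powRr1 ?(ltW M0)// le_eqVlt; apply/orP; left; apply/eqP; ring.
have close : `|a - c| <= 2 * M.
  have -> : a - c = V^-1 * \int[mu]_(x in B) (w x - c).
    rewrite RintegralB//; last exact: icst.
    rewrite Rintegral_cst// muB /= mulrBr mulrCA mulVf ?gt_eqF// mulr1//.
  rewrite normrM gtr0_norm ?invr_gt0// mulrC ler_pdivrMr//.
  apply: (le_trans (le_normr_Rintegral mB iwc)).
  rewrite -lee_fin fineK//; apply: integrable_fin_num => //.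
  exact: (integrable_norm iwc).
have split_le x : `|w x - a| `^ p <= 2 `^ p * (`|w x - c| `^ p + (2 * M) `^ p).
  have := ler_distD c (w x) a; rewrite [`|c - a|]distrC => tri.
  have M20 : 0 <= 2 * M by rewrite mulr_ge0// ltW.
  have [h|h] := leP `|w x - c| (2 * M).
    apply: (@le_trans _ _ ((2 * (2 * M)) `^ p)).
      have tri' : `|w x - a| <= 2 * (2 * M).
        by apply: (le_trans tri); rewrite [leRHS](mulr_natl _ 2) mulr2n lerD.
      apply: ge0_ler_powR => //; rewrite ?nnegrE ?(ltW p0)//.
      by rewrite mulr_ge0.
    by rewrite (powRM _ (ler0n _ 2) M20) ler_wpM2l ?powR_ge0// lerDr powR_ge0.
  apply: (@le_trans _ _ ((2 * `|w x - c|) `^ p)).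
    have tri' : `|w x - a| <= 2 * `|w x - c|.
      apply: (le_trans tri); rewrite [leRHS](mulr_natl _ 2) mulr2n lerD2l.
      exact: (le_trans close (ltW h)).
    by apply: ge0_ler_powR => //; rewrite ?nnegrE ?(ltW p0).
  by rewrite (powRM _ (ler0n _ 2) (normr_ge0 _)) ler_wpM2l ?powR_ge0// lerDl powR_ge0.
apply: (@le_trans _ _ (\int[mu]_(x in B) ((2 `^ p)%:E *
    ((`|w x - c| `^ p)%:E + ((2 * M) `^ p)%:E)))%E).
  by apply: le_lower_integral => x _; rewrite -?EFinD -?EFinM lee_fin ?powR_ge0.
rewrite lower_integralZl ?powR_ge0//; last first.
  by move=> x _; rewrite -EFinD lee_fin addr_ge0 ?powR_ge0.
rewrite ge0_integralD//; last by move=> x _; rewrite lee_fin powR_ge0.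
rewrite integral_cst// muB.
apply: (@le_trans _ _ ((2 `^ p)%:E * ((A `^ p)%:E + ((2 * M) `^ p)%:E * V%:E))%E).
  by rewrite lee_wpmul2l ?lee_fin ?powR_ge0// leeD2r.
rewrite -(EFinM (_ `^ _) V) -EFinD -EFinM lee_fin (powRM _ (ler0n _ 2) (ltW M0)) -mulrA MV.
(* The 6 arises as 2^p (1 + 2^p) <= 2^p 3^p. *)
have -> : A `^ p + 2 `^ p * A `^ p = (1 + 2 `^ p) * A `^ p by ring.
have -> : 6 * A = 2 * (3 * A) by ring.
rewrite powRM ?mulr_ge0 ?(ltW A0)// ler_wpM2l ?powR_ge0//.
rewrite powRM ?(ltW A0)// ler_wpM2r ?powR_ge0//.
have := powRD_ge p1 (ler0n R 1) (ler0n R 2); rewrite powR1.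
by have -> : 1 + 2 = 3 :> R by ring.
Qed.

End median_mean.

Section strong_type.
Context {R : realType} {X : completeMetricType R}.
Variables (mu : {outer_measure set X -> \bar R}) (Cmu : R).
Hypothesis breg : borel_regular mu.
Hypothesis dbl : doubling mu Cmu.
Implicit Types (x y z : X) (r s : R) (S D : set X).
Variable theta : R.
Hypothesis th : 0 < theta < 1.

Lemma frac_energy_ge0 S (u : X -> \bar R) : (0 <= frac_energy mu theta S u)%E.
Proof.
apply: integral_ge0 => x _; apply: integral_ge0 => y _; exact: (frac_kernel_ge0 dbl).
Qed.

Lemma le_frac_energy S S' (u u' : X -> \bar R) : S `<=` S' ->
  (forall x y, (`|u x - u y| <= `|u' x - u' y|)%E) ->
  (frac_energy mu theta S u <= frac_energy mu theta S' u')%E.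
Proof.
move=> SS uu; have k0 u1 x y := frac_kernel_ge0 dbl theta u1 x y.
apply: (@le_trans _ _ (\int[mu_measure mu]_(x in S)
    \int[mu_measure mu]_(y in S') frac_kernel mu theta u' x y)%E).
  apply: le_lower_integral => x Sx; first by apply: integral_ge0.
  apply: (@le_trans _ _ (\int[mu_measure mu]_(y in S) frac_kernel mu theta u' x y)%E).
    apply: le_lower_integral => // y _.
    rewrite /frac_kernel; case: ifPn => // xy; apply: lee_wpmul2r => //.
    have d0 : 0 < mdist x y by rewrite mdist_gt0.
    rewrite (mu_ballE dbl) -EFinM inver gt_eqF ?mulr_gt0 ?powR_gt0 ?(vol_gt0 dbl)//.
    by rewrite lee_fin invr_ge0 mulr_ge0 ?powR_ge0 ?vol_ge0.
  exact: lower_integral_subset.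
apply: lower_integral_subset => // x _; exact: integral_ge0.
Qed.

(** Superadditivity of the lower integral in each variable; the kernel being linear in |u x - u y|,
    the pointwise hypothesis does the rest. *)
Lemma sum_frac_energy_le S (u : X -> \bar R) n (c : nat -> R) (F : nat -> X -> R) :
  (forall j, 0 <= c j) ->
  (forall x y, ((\sum_(0 <= j < n) c j * `|F j x - F j y|)%:E <= `|u x - u y|)%E) ->
  (\sum_(0 <= j < n) (c j)%:E * frac_energy mu theta S (EFin \o F j) <=
   frac_energy mu theta S u)%E.
Proof.
move=> c0 cF; have k0 u1 x y := frac_kernel_ge0 dbl theta u1 x y.
have ck0 j x y : (0 <= (c j)%:E * frac_kernel mu theta (EFin \o F j) x y)%E.
  by rewrite mule_ge0// lee_fin.
rewrite (eq_bigr (fun j => \int[mu_measure mu]_(x in S) \int[mu_measure mu]_(y in S)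
    ((c j)%:E * frac_kernel mu theta (EFin \o F j) x y))%E); last first.
  move=> j _; rewrite -lower_integralZl//; last by move=> x _; exact: integral_ge0.
  apply: eq_integral => x _; rewrite lower_integralZl//.
apply: le_trans (lower_integral_sum_ge _ _ _) _.
  by move=> j x _; apply: integral_ge0.
apply: le_lower_integral => x _.
  by apply: sume_ge0 => j _; apply: integral_ge0.
apply: le_trans (lower_integral_sum_ge _ _ _) _; first by [].
apply: le_lower_integral => y _; first by apply: sume_ge0.
have [xy|xy] := eqVneq x y.
  by rewrite big1 ?k0// => j _; rewrite /frac_kernel xy eqxx mule0.
pose W := (mdist x y `^ theta * vol mu x (mdist x y))^-1.
have d0 : 0 < mdist x y by rewrite mdist_gt0.
have W0 : 0 <= W by rewrite invr_ge0 mulr_ge0 ?powR_ge0 ?vol_ge0.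
have -> : frac_kernel mu theta u x y = (`|u x - u y| * W%:E)%E.
  rewrite /frac_kernel (negbTE xy) (mu_ballE dbl) -EFinM inver gt_eqF//.
  by rewrite mulr_gt0 ?powR_gt0// (vol_gt0 dbl).
rewrite (eq_bigr (fun j => (c j * `|F j x - F j y| * W)%:E)); last first.
  by move=> j _; rewrite (frac_kernelE dbl)// -EFinM mulrA.
rewrite sumEFin -mulr_suml EFinM lee_wpmul2r// lee_fin//.
Qed.

Variables (Q : R) (D S : set X) (K1 : R) (h : X -> R) (u : X -> \bar R).
Hypothesis Q1 : 1 < Q.
Hypothesis mD : measurable (D : set (caratheodory_type mu)).
Hypothesis K10 : 0 <= K1.
Hypothesis mh : measurable_fun [set: caratheodory_type mu] h.
Hypothesis h0 : forall x, 0 <= h x.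
Hypothesis hfin : forall c : R, 0 < c -> (mu (D `&` [set x | (c <= h x)%R]) < +oo)%E.
Hypothesis hu : forall x y, (`|h x - h y|%:E <= `|u x - u y|)%E.
Hypothesis ufin : (frac_energy mu theta S u < +oo)%E.
Hypothesis weak : forall (l m : R), 0 < l -> 0 < m ->
  mu (D `&` [set x | (2 * l <= h x)%R]) = m%:E ->
  ((m `^ ((Q - theta) / Q))%:E <=
   K1%:E * frac_energy mu theta S (EFin \o (trunc_step l \o h)))%E.

(* Maz'ya truncation: the truncations of h at dyadic levels have total energy at
   most that of h, so the weak estimates add up to a strong one. *)
Lemma weak_to_strong :
  (\int[mu_measure mu]_(x in D) (h x `^ (Q / (Q - theta)))%:E <=
   ((4 * (K1 * fine (frac_energy mu theta S u))) `^ (Q / (Q - theta)))%:E)%E.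
Proof.
have [th0 th1] : 0 < theta /\ theta < 1 by case/andP: th.
have Qt : 0 < Q - theta by rewrite subr_gt0 (lt_trans th1).
have Q0 : 0 < Q by rewrite (lt_trans _ Q1).
apply: (@layer_cake _ _ _ (mu_measure mu)) => //.
  by rewrite ler_pdivlMr// mul1r gerBl ltW.
move=> a n a0.
have l0 j : 0 < a * 2 ^+ j by rewrite mulr_gt0// exprn_gt0.
have EK : frac_energy mu theta S u = (fine (frac_energy mu theta S u))%:E.
  by rewrite fineK// ge0_fin_numE ?frac_energy_ge0.
rewrite -lee_fin EFinM -EK.
apply: (@le_trans _ _ (K1%:E * \sum_(0 <= j < n) (a * 2 ^+ j)%:E *
    frac_energy mu theta S (EFin \o (trunc_step (a * 2 ^+ j) \o h)))%E); last first.
  apply: lee_wpmul2l; first by rewrite lee_fin.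
  apply: sum_frac_energy_le => [j|x y]; first exact: ltW.
  by apply: le_trans (hu x y); rewrite lee_fin sum_trunc_step_dist.
rewrite ge0_sume_distrr; last first.
  by move=> j _; rewrite mule_ge0 ?frac_energy_ge0// lee_fin ltW.
rewrite -sumEFin; apply: lee_sum => j _.
rewrite EFinM muleCA; apply: lee_wpmul2l; first by rewrite lee_fin ltW.
rewrite invf_div.
set m := fine _.
have m0 : 0 <= m by rewrite fine_ge0.
move: m0; rewrite le_eqVlt => /predU1P[m0|m0].
  rewrite -m0 powR0 ?gt_eqF ?divr_gt0// mule_ge0 ?frac_energy_ge0//.
apply: weak => //.
by rewrite /m fineK// ge0_fin_numE// hfin// mulr_gt0.
Qed.

End strong_type.

(** * The fractional Sobolev and Poincaré inequalities *)

Lemma poweR_inv_le {R : realType} (I : \bar R) (a p : R) : 0 <= a -> 0 < p ->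
  (0 <= I)%E -> (I <= (a `^ p)%:E)%E -> (I `^ p^-1 <= a%:E)%E.
Proof.
move=> a0 p0; case: I => [r| |]//; rewrite !lee_fin => r0 ra.
rewrite -[leRHS]powRr1// -(mulfV (lt0r_neq0 p0)) powRrM.
by rewrite ge0_ler_powR ?nnegrE ?invr_ge0 ?(ltW p0) ?powR_ge0.
Qed.

Section ahlfors_forward.
Context {R : realType} {X : completeMetricType R}.
Variables (mu : {outer_measure set X -> \bar R}) (Cmu CP tauP c0 Q : R).
Hypothesis breg : borel_regular mu.
Hypothesis dbl : doubling mu Cmu.
Hypothesis poin : poincare11 mu CP tauP.
Hypothesis muT : mu [set: X] = +oo%E.
Hypothesis Q1 : 1 < Q.

(** A space of finite diameter is a single ball, of finite measure. Hence every r > 0 is admissible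
    in lower regularity. *)
Lemma diam_infty : diam (X := X) = +oo%E :> \bar R.
Proof.
apply/eqP; rewrite -leye_eq leNgt; apply/negP => dfin.
have le_diam (p : X * X) : ((mdist p.1 p.2)%:E <= diam (X := X))%E.
  by apply: ereal_sup_ubound; exists p.
pose x : X := point.
have d0 : (0 <= diam (X := X) :> \bar R)%E.
  by have := le_diam (x, x); rewrite /= mdistxx.
have dE : diam (X := X) = (fine (diam (X := X)))%:E :> \bar R.
  by rewrite fineK// ge0_fin_numE.
have : (mu [set: X] <= mu (ball x (fine (diam (X := X)) + 1)))%E.
  apply: le_outer_measure => y _; rewrite ballEmdist/=.
  have := le_diam (x, y); rewrite dE lee_fin/= => h.
  by apply: (le_lt_trans h); rewrite ltrDl.
by rewrite muT (mu_ballE dbl) leye_eq.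
Qed.

Section L1_representative.
Variable u : X -> \bar R.
Hypothesis uL1 : L1 mu u.
Let w := fine \o u.

Lemma L1_measurable_fine : measurable_fun [set: caratheodory_type mu] w.
Proof.
apply: (measurableT_comp (@fine_measurable R setT measurableT)).
exact: measurable_int uL1.
Qed.

Lemma L1_ae_fine (F : \bar R -> \bar R) (D : set (caratheodory_type mu)) :
  measurable_fun [set: \bar R] F -> measurable D ->
  (\int[mu_measure mu]_(x in D) F (u x) = \int[mu_measure mu]_(x in D) F (w x)%:E)%E.
Proof.
move=> mF mD; apply: ae_eq_integral => //.
- apply: measurable_funTS; apply: measurableT_comp => //.
  exact: measurable_int uL1.
- apply: measurable_funTS; apply: measurableT_comp => //.
  by apply/measurable_EFinP; exact: L1_measurable_fine.
- apply: filterS (integrable_ae measurableT uL1) => x /(_ I) ux Dx.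
  by rewrite /w /= fineK.
Qed.

Lemma L1_integrable_fine : (mu_measure mu).-integrable setT (EFin \o w).
Proof.
apply/integrableP; split.
  by apply/measurable_EFinP; exact: L1_measurable_fine.
rewrite -(@L1_ae_fine abse)//; by have /integrableP[] := uL1.
Qed.

(** For the energies u is compared with its finite representative pointwise, not almost everywhere.
    This works because [|u x - u y|] is +oo as soon as one value is infinite, even if both are
    equal. *)
Lemma fine_dist_le x y : (`|w x - w y|%:E <= `|u x - u y|)%E.
Proof. by rewrite /w/=; case: (u x) => [r| |]; case: (u y) => [s| |]//=; rewrite leey. Qed.

Lemma L1_superlevel_lty c : 0 < c -> (mu [set x | (c <= `|w x|)%R] < +oo)%E.
Proof.
move=> c0'.
have mA : measurable ([set x | (c <= `|w x|)%R] : set (caratheodory_type mu)).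
  apply: measurable_superlevel; apply: measurableT_comp => //.
  exact: L1_measurable_fine.
have h := @lower_integral_ge_cst _ _ _ (mu_measure mu) _ setT
  (fun x => `|w x|%:E) c (ltW c0') mA (@subsetT _ _)
  (fun x _ => ltac:(by rewrite lee_fin)) (fun x h => ltac:(by rewrite lee_fin)).
have fin : (\int[mu_measure mu]_x `|w x|%:E < +oo)%E.
  by have /integrableP[_] := L1_integrable_fine.
have := le_lt_trans h fin; rewrite /mu_measure /=.
by case: (mu _) => [r| |]//; rewrite ?ltry// gt0_muley ?lte_fin.
Qed.

End L1_representative.

Hypothesis c00 : 0 < c0.
Hypothesis ahl : forall x r, 0 < r -> c0 * r `^ Q <= vol mu x r.

Let Co := osc_cst Cmu CP c0 Q.
Let Co0 : 0 < Co. Proof. exact: (osc_cst_gt0 dbl poin c00 Q1). Qed.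
Let C4 : 0 < Cmu ^+ 4. Proof. by rewrite exprn_gt0// (Cmu_gt0 dbl). Qed.
Let CC0 : 0 < Co * Cmu ^+ 4. Proof. exact: mulr_gt0. Qed.

Variables (theta : R) (u : X -> \bar R).
Hypothesis th : 0 < theta < 1.
Hypothesis uL1 : L1 mu u.
Let w := fine \o u.
Let mw : measurable_fun [set: caratheodory_type mu] w := L1_measurable_fine uL1.
Let p := Q / (Q - theta).

Let th0 : 0 < theta. Proof. by case/andP: th. Qed.
Let th1 : 0 < 1 - theta. Proof. by rewrite subr_gt0; case/andP: th. Qed.
Let Q0 : 0 < Q. Proof. exact: lt_trans Q1. Qed.
Let Qt : 0 < Q - theta.
Proof. by rewrite subr_gt0 (lt_trans _ Q1)//; case/andP: th. Qed.
Let p0 : 0 < p. Proof. exact: divr_gt0. Qed.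
Let p1 : 1 <= p. Proof. by rewrite ler_pdivlMr// mul1r gerBl ltW. Qed.

Let pV : (Q - theta) / Q = p^-1. Proof. by rewrite invf_div. Qed.

Let mpow : measurable_fun [set: \bar R] (fun z : \bar R => (`|z| `^ p)%E).
Proof. exact: (measurableT_comp (measurable_poweR _)). Qed.

(** [weak_to_strong] for the absolute value of the finite representative; 128 is the 4 of the layer
    cake times the 32 of the weak type. *)
Lemma fractional_sobolev :
  ((\int[mu_measure mu]_(x in [set: X]) (`|u x| `^ p)) `^ ((Q - theta) / Q)
    <= (128 * (Co * Cmu ^+ 4) * theta * (1 - theta))%:E *
       frac_energy mu theta [set: X] u)%E.
Proof.
rewrite pV.
have Kp : 0 < 128 * (Co * Cmu ^+ 4) * theta * (1 - theta) :=
  mulr_gt0 (mulr_gt0 (mulr_gt0 (ltr0Sn R 127) CC0) th0) th1.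
have [->|ufin] := eqVneq (frac_energy mu theta setT u) +oo%E.
  by rewrite gt0_muley ?leey// lte_fin.
have {}ufin : (frac_energy mu theta setT u < +oo)%E by rewrite ltey.
have e0 := frac_energy_ge0 dbl theta setT u.
pose K1 := 32 * Co * Cmu ^+ 4 * (theta * (1 - theta)).
have K10 : 0 < K1 :=
  mulr_gt0 (mulr_gt0 (mulr_gt0 (ltr0Sn R 31) Co0) C4) (mulr_gt0 th0 th1).
have -> : ((128 * (Co * Cmu ^+ 4) * theta * (1 - theta))%:E *
    frac_energy mu theta setT u = (4 * (K1 * fine (frac_energy mu theta setT u)))%:E)%E.
  rewrite -{1}(fineK (x := frac_energy mu theta setT u)) ?ge0_fin_numE//.
  rewrite -EFinM /K1; congr EFin; ring.
apply: poweR_inv_le => //.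
- exact: (mulr_ge0 (ler0n _ 4) (mulr_ge0 (ltW K10) (fine_ge0 e0))).
- by apply: integral_ge0 => x _; exact: poweR_ge0.
rewrite (L1_ae_fine uL1 mpow measurableT).
have mnw : measurable_fun [set: caratheodory_type mu] (fun x => `|w x|).
  exact: measurableT_comp.
apply: (@weak_to_strong _ _ mu Cmu dbl theta th Q setT setT K1 (fun x => `|w x|) u) => //.
- exact: ltW.
- by move=> c c0'; rewrite setTI; exact: (L1_superlevel_lty uL1).
- move=> x y; apply: le_trans (fine_dist_le u x y); rewrite lee_fin.
  exact: ler_dist_dist.
move=> l m l0 m0; rewrite setTI => mE.
apply: (weak_type_global breg dbl poin muT c00 Q1 ahl) => //.
- apply: (measurableT_comp (measurable_trunc_step l)).
  exact: mnw.
- by move=> x; exact: trunc_step01.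
- rewrite -mE (_ : [set x | _] = [set x | 2 * l <= `|w x|])//.
  by apply/seteqP; split => x /= /(trunc_step1 _ l0).
(* An integrable function exceeds l on a set of finite measure only, so the truncation vanishes on a
   set of infinite measure. *)
- apply/eqP; rewrite -leye_eq leNgt; apply/negP => hfin.
  have : (mu [set: X] < +oo)%E.
    apply: le_lt_trans (lte_add_pinfty hfin (L1_superlevel_lty uL1 l0)).
    apply: le_trans (outer_measureU2 _ _ _); apply: le_outer_measure => x _.
    by have [h|h] := leP l `|w x|; [right|left => /=; rewrite trunc_step0// ltW].
  by rewrite muT ltxx.
Qed.

Section excess.
Variables (x0 : X) (r0 : R).
Hypothesis r00 : 0 < r0.
Let D := ball x0 r0.
Let S := ball x0 ((5 + 2 * tauP) * r0).
Let K1 := 8 * Co * Cmu ^+ 4 * (1 - theta).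
Hypothesis ufin : (frac_energy mu theta S u < +oo)%E.
Let e := fine (frac_energy mu theta S u).

Let K10 : 0 < K1. Proof. by rewrite /K1 -(mulrA 8) mulr_gt0// mulr_gt0. Qed.

(** Used for w with c and for - w with - c. The truncations vanish where v <= c, which is at least
    half of the ball, as [weak_type_local] requires. *)
Lemma excess_powR (v : X -> R) (c : R) :
  measurable_fun [set: caratheodory_type mu] v ->
  (forall x y, (`|v x - v y|%:E <= `|u x - u y|)%E) ->
  ((vol mu x0 r0)%:E <= 2%:E * mu (D `&` [set x | (v x <= c)%R]))%E ->
  (\int[mu_measure mu]_(x in D) ((Num.max 0 (v x - c)) `^ p)%:E <=
    ((4 * (K1 * e)) `^ p)%:E)%E.
Proof.
move=> mv vu vc.
apply: (@weak_to_strong _ _ mu Cmu dbl theta th Q D S K1 (fun x => Num.max 0 (v x - c)) u) => //.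
- exact: (cara_ball breg).
- exact: ltW.
- by apply: measurable_maxr => //; exact: measurable_funB.
- by move=> x; rewrite le_max lexx.
- move=> c' _; apply: (@le_lt_trans _ _ (mu D)); first exact: le_outer_measure.
  by rewrite (mu_ballE dbl) ltry.
- move=> x y; apply: le_trans (vu x y); rewrite lee_fin.
  apply: (le_trans (max0_dist _ _)).
  by rewrite opprD opprK addrACA addNr addr0.
move=> l m l0 m0 mE.
apply: (weak_type_local breg dbl poin muT c00 Q1 ahl) => //.
- apply: (measurableT_comp (measurable_trunc_step l)).
  by apply: measurable_maxr => //; exact: measurable_funB.
- by move=> x; exact: trunc_step01.
- rewrite -mE setIC (_ : [set x | trunc_step _ _ = _] = [set x | 2 * l <= Num.max 0 (v x - c)])//.
  by apply/seteqP; split => x /= /(trunc_step1 _ l0).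
- apply: (@le_trans _ _ (vol mu x0 r0)%:E).
    by rewrite -mE -(mu_ballE dbl); apply: le_outer_measure => x [].
  apply: (le_trans vc); apply: lee_wpmul2l => //.
  apply: le_outer_measure => x [Dx /= vx]; split => //=.
  by rewrite trunc_step0// (max_idPl _) ?subr_le0// ltW.
Qed.

(** 384 = 6 * 8 * 8: the 6 for replacing the median by the mean, twice the 4 of the layer cake for
    the two sides of the median, and the 8 of the weak type. *)
Lemma fractional_poincare_fin :
  ((\int[mu_measure mu]_(x in D) (`|u x - mean mu D u| `^ p)) `^ ((Q - theta) / Q)
    <= (384 * (Co * Cmu ^+ 4) * (1 - theta))%:E * frac_energy mu theta S u)%E.
Proof.
have e0 := frac_energy_ge0 dbl theta S u.
have mD : measurable (D : set (caratheodory_type mu)) by exact: (cara_ball breg).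
have V0 : 0 < vol mu x0 r0 by exact: (vol_gt0 dbl).
have mDV : mu_measure mu D = (vol mu x0 r0)%:E by exact: (mu_ballE dbl).
have iw : (mu_measure mu).-integrable D (EFin \o w).
  exact: integrableS (L1_integrable_fine uL1).
have [c [c1 c2]] := @median_exists _ _ _ (mu_measure mu) D w (vol mu x0 r0) mD mw V0 mDV.
have h1 := excess_powR mw (fine_dist_le u) c1.
have h2 : (\int[mu_measure mu]_(x in D) ((Num.max 0 (- w x - - c)) `^ p)%:E <=
    ((4 * (K1 * e)) `^ p)%:E)%E.
  apply: (@excess_powR (fun x => - w x)).
  - exact: measurableT_comp.
  - by move=> x y; rewrite -opprD normrN; exact: fine_dist_le.
  - rewrite (_ : [set x | (- w x <= - c)%R] = [set x | (c <= w x)%R])//.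
    by apply/seteqP; split => x /=; rewrite lerN2.
have Ke : 0 <= K1 * e by rewrite mulr_ge0 ?fine_ge0// ltW.
have h : (\int[mu_measure mu]_(x in D) (`|w x - c| `^ p)%:E <= ((8 * (K1 * e)) `^ p)%:E)%E.
  have mmax (v : X -> R) (c' : R) : measurable_fun [set: caratheodory_type mu] v ->
      measurable_fun (D : set (caratheodory_type mu))
        (fun x : caratheodory_type mu => ((Num.max 0 (v x - c')) `^ p)%:E).
    move=> mv; apply/measurable_EFinP; apply: measurable_funTS.
    apply: (measurableT_comp (measurable_powR p)).
    by apply: measurable_maxr => //; exact: measurable_funB.
  apply: (@le_trans _ _ (\int[mu_measure mu]_(x in D)
     (((Num.max 0 (w x - c)) `^ p)%:E + ((Num.max 0 (- w x - - c)) `^ p)%:E))%E).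
    apply: le_lower_integral => x _; rewrite -?EFinD lee_fin ?powR_ge0//.
    have [wc|cw] := leP c (w x).
      rewrite ger0_norm ?subr_ge0// [X in _ <= X `^ _ + _](max_idPr _) ?subr_ge0//.
      by rewrite lerDl powR_ge0.
    have cw0 : 0 <= - w x - - c by lra.
    rewrite ltr0_norm ?subr_lt0// opprB [X in _ <= _ + X `^ _](max_idPr _)//.
    by rewrite opprK (addrC (- w x)) lerDr powR_ge0.
  rewrite ge0_integralD//; last 4 first.
  - by move=> x _; rewrite lee_fin powR_ge0.
  - exact: mmax.
  - by move=> x _; rewrite lee_fin powR_ge0.
  - by apply: (mmax (fun x => - w x)); exact: measurableT_comp.
  apply: (le_trans (leeD h1 h2)); rewrite -EFinD lee_fin.
  have -> : 8 * (K1 * e) = 4 * (K1 * e) + 4 * (K1 * e) by ring.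
  by apply: powRD_ge; rewrite // mulr_ge0.
have mean_w : mean mu D u = ((vol mu x0 r0)^-1 * \int[mu_measure mu]_(y in D) w y)%:E.
  rewrite /mean (mu_ballE dbl) inver gt_eqF//.
  rewrite (@L1_ae_fine u uL1 id D)// EFinM; congr (_ * _)%E.
  by rewrite fineK// integrable_fin_num.
rewrite pV mean_w.
pose F (z : \bar R) := (`|z - ((vol mu x0 r0)^-1 * \int[mu_measure mu]_(y in D) w y)%:E| `^ p)%E.
have mF : measurable_fun setT F.
  apply: (measurableT_comp (measurable_poweR _)); apply: measurableT_comp => //.
  exact: emeasurable_funB.
rewrite (L1_ae_fine uL1 mF mD).
(* The energy may be 0, whereas [mean_dist_powR] asks for a positive A. *)
apply/lee_addgt0Pr => eps eps0.
have -> : ((384 * (Co * Cmu ^+ 4) * (1 - theta))%:E * frac_energy mu theta S u =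
   (6 * (8 * (K1 * e)))%:E)%E.
  rewrite -{1}(fineK (x := frac_energy mu theta S u)) ?ge0_fin_numE//.
  rewrite -EFinM /K1; congr EFin; rewrite /e; ring.
rewrite -EFinD.
have -> : 6 * (8 * (K1 * e)) + eps = 6 * (8 * (K1 * e) + eps / 6) by field.
have A0 : 0 < 8 * (K1 * e) + eps / 6.
  by rewrite ltr_wpDl ?divr_gt0// mulr_ge0.
apply: poweR_inv_le => //.
- by rewrite mulr_ge0// ltW.
- by apply: integral_ge0 => x _; exact: poweR_ge0.
apply: (@mean_dist_powR _ _ _ (mu_measure mu) D w (vol mu x0 r0) mD mw V0 mDV c p) => //.
apply: (le_trans h); rewrite lee_fin ge0_ler_powR ?nnegrE ?(ltW p0) ?(ltW A0)//.
  by rewrite mulr_ge0.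
by rewrite lerDl divr_ge0// ltW.
Qed.

End excess.

Lemma fractional_poincare x0 r0 : 0 < r0 ->
  ((\int[mu_measure mu]_(x in ball x0 r0) (`|u x - mean mu (ball x0 r0) u| `^ p))
     `^ ((Q - theta) / Q)
    <= (384 * (Co * Cmu ^+ 4) * (1 - theta))%:E *
       frac_energy mu theta (ball x0 ((5 + 2 * tauP) * r0)) u)%E.
Proof.
move=> r00.
have Kp : 0 < 384 * (Co * Cmu ^+ 4) * (1 - theta) :=
  mulr_gt0 (mulr_gt0 (ltr0Sn R 383) CC0) th1.
have [->|ufin] := eqVneq (frac_energy mu theta (ball x0 ((5 + 2 * tauP) * r0)) u) +oo%E.
  by rewrite gt0_muley ?leey// lte_fin.
by apply: fractional_poincare_fin => //; rewrite ltey.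
Qed.

End ahlfors_forward.

(** * Energy of a cutoff function *)

Section step_majorant.
Context d (T : measurableType d) (R : realType).
Variable mu : {measure set T -> \bar R}.

Lemma lower_integral_support (D : set T) (f : T -> \bar R) :
  (forall y, ~ D y -> f y = 0%E) ->
  (\int[mu]_(y in D) f y = \int[mu]_y f y)%E.
Proof.
move=> h; rewrite integral_mkcond; apply: eq_integral => y _.
by rewrite /patch; case: ifPn => //; rewrite notin_setE => /h ->.
Qed.

(** Lower integrals are only superadditive, so a piecewise upper bound has to pass through a
    measurable majorant, which can be integrated term by term. *)
Lemma step_majorant (A : nat -> set T) (c b : nat -> R) (C : R) :
  (forall j, measurable (A j)) -> (forall j, 0 <= c j) ->
  (forall j, ((c j)%:E * mu (A j) <= (b j)%:E)%E) ->
  (forall n, \sum_(0 <= j < n) b j <= C) ->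
  exists G : T -> \bar R, [/\ measurable_fun [set: T] G, (forall x, 0 <= G x)%E,
    (forall j x, A j x -> (c j)%:E <= G x)%E & (\int[mu]_x G x <= C%:E)%E].
Proof.
move=> mA c0 cb bC.
pose F j x := (c j * \1_(A j) x)%:E.
have F0 j x : (0 <= F j x)%E by rewrite lee_fin mulr_ge0.
have mF j : measurable_fun [set: T] (F j).
  by apply/measurable_EFinP; apply: measurable_funM => //; exact: measurable_indic.
exists (fun x => \sum_(0 <= j <oo) F j x)%E; split.
- exact: ge0_emeasurable_sum.
- by move=> x; apply: nneseries_ge0.
- move=> j x Ax; apply: (@le_trans _ _ (\sum_(0 <= i < j.+1) F i x)%E).
    rewrite big_nat_recr//=; apply: (@le_trans _ _ (F j x)); last first.
      by rewrite leeDr// sume_ge0.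
    by rewrite /F indicE mem_set// mulr1.
  exact: nneseries_lim_ge.
- rewrite integral_nneseries//; apply: lime_le.
    by apply: is_cvg_nneseries => j _ _; exact: integral_ge0.
  apply: nearW => n; apply: (@le_trans _ _ (\sum_(0 <= j < n) (b j)%:E)%E).
    apply: lee_sum => j _; apply: le_trans (cb j).
    rewrite /F; under eq_integral do rewrite EFinM.
    rewrite ge0_integralZl_EFin//; last first.
    - by apply/measurable_EFinP; exact: measurable_indic.
    by rewrite integral_indic// setIT.
  by rewrite sumEFin lee_fin.
Qed.

End step_majorant.

Section dyadic.
Variable R : realType.
Implicit Types a t : R.

Let lt_exp2 t : exists n : nat, t < 2 ^+ n.
Proof.
exists (Num.truncn t).+1; apply: (lt_le_trans (truncnS_gt t)).
by rewrite -natrX ler_nat ltnW// ltn_expl.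
Qed.

Lemma dyadic_up a t : 0 < a -> a <= t ->
  exists j : nat, a * 2 ^+ j <= t < a * 2 ^+ j.+1.
Proof.
move=> a0 at_; have [n hn] := lt_exp2 (t / a).
have ex : exists n : nat, t < a * 2 ^+ n by exists n; rewrite mulrC -ltr_pdivrMr.
case: (ex_minnP ex) => -[|j] tj hj.
  by move: tj; rewrite expr0 mulr1 ltNge at_.
exists j; rewrite tj andbT leNgt; apply/negP => /hj.
by rewrite ltnn.
Qed.

Lemma dyadic_down a t : 0 < t -> t < a ->
  exists j : nat, a / 2 ^+ j.+1 <= t < a / 2 ^+ j.
Proof.
move=> t0 ta; have [n hn] := lt_exp2 (a / t).
have e0 n' : 0 < 2 ^+ n' :> R by rewrite exprn_gt0.
have ex : exists n : nat, a / 2 ^+ n <= t.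
  by exists n; rewrite ler_pdivrMr// mulrC -ler_pdivrMr// ltW.
case: (ex_minnP ex) => -[|j] tj hj.
  by move: tj; rewrite expr0 divr1 leNgt ta.
exists j; rewrite tj/= ltNge; apply/negP => /hj.
by rewrite ltnn.
Qed.

Let q : R := 2 `^ (- 2^-1).

Lemma sqrt_half_sqr : q ^+ 2 = 2^-1.
Proof.
rewrite expr2 -powRD ?pnatr_eq0 ?implybT//.
have -> : - 2^-1 - 2^-1 = - 1 :> R by lra.
by rewrite powR_inv1.
Qed.

(** The upper bound makes the geometric sums at most 4; the lower one compensates a shift of index
    by the factor 2. *)
Lemma sqrt_half_bounds : 2^-1 <= q <= 3 / 4.
Proof.
have q0 : 0 < q by rewrite powR_gt0.
have q2 := sqrt_half_sqr; rewrite expr2 in q2.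
by apply/andP; split; nra.
Qed.

Lemma sum_sqrt_half (B : R) n : 0 <= B -> \sum_(0 <= j < n) B * q ^+ j <= 4 * B.
Proof.
move=> B0; have /andP[_ q34] := sqrt_half_bounds.
have q0 : 0 < q by rewrite powR_gt0.
have h : (1 - q) * \sum_(0 <= j < n) B * q ^+ j = B * (1 - q ^+ n).
  elim: n => [|n ih]; first by rewrite big_geq// expr0 subrr !mulr0.
  by rewrite big_nat_recr//= mulrDr ih exprS; ring.
have qn : 0 <= q ^+ n by rewrite exprn_ge0// ltW.
have S0 : 0 <= \sum_(0 <= j < n) B * q ^+ j.
  by apply: sumr_ge0 => j _; rewrite mulr_ge0// exprn_ge0// ltW.
by nra.
Qed.

Lemma powR_half_dyadic a j : 0 <= a ->
  (a * 2 ^+ j) `^ (- 2^-1) = a `^ (- 2^-1) * q ^+ j.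
Proof. by move=> a0; rewrite powRM ?exprn_ge0// powR_exprn. Qed.

End dyadic.

Section cutoff.
Context {R : realType} {X : completeMetricType R}.
Variables (mu : {outer_measure set X -> \bar R}) (Cmu : R).
Hypothesis breg : borel_regular mu.
Hypothesis dbl : doubling mu Cmu.
Variables (x0 : X) (r : R).
Hypothesis r0 : 0 < r.

Definition cutoff (x : X) : R := Num.min 1 (Num.max 0 (2 - mdist x0 x / r)).

Lemma cutoff01 x : 0 <= cutoff x <= 1.
Proof. by rewrite /cutoff ge_min lexx le_min ler01 le_max lexx. Qed.

Lemma cutoff1 x : ball x0 r x -> cutoff x = 1.
Proof.
rewrite ballEmdist/= => xr; apply/min_idPl; rewrite le_max; apply/orP; right.
have : mdist x0 x / r <= 1 by rewrite ler_pdivrMr// mul1r ltW.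
by lra.
Qed.

Lemma cutoff0 x : 2 * r <= mdist x0 x -> cutoff x = 0.
Proof.
move=> h; rewrite /cutoff (max_idPl _) ?(min_idPr _)//.
by rewrite subr_le0 ler_pdivlMr.
Qed.

Lemma cutoff_lip x y : `|cutoff x - cutoff y| <= mdist x y / r.
Proof.
have min1 (a b : R) : `|Num.min 1 a - Num.min 1 b| <= `|a - b|.
  have minE z : Num.min 1 z = 1 - Num.max 0 (1 - z) :> R.
    by rewrite /Num.min /Num.max; case: ltP => h1; case: ltP => h2; lra.
  have -> : Num.min 1 a - Num.min 1 b = - (Num.max 0 (1 - a) - Num.max 0 (1 - b)).
    by rewrite !minE; ring.
  rewrite normrN; apply: (le_trans (max0_dist _ _)).
  rewrite (_ : 1 - a - (1 - b) = - (a - b)) ?normrN//; ring.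
apply: (le_trans (min1 _ _)); apply: (le_trans (max0_dist _ _)).
have -> : 2 - mdist x0 x / r - (2 - mdist x0 y / r) =
  - ((mdist x0 x - mdist x0 y) / r) by ring.
rewrite normrN normrM [X in _ * X]gtr0_norm ?invr_gt0// ler_pM2r ?invr_gt0//.
exact: mdist_lip.
Qed.

Lemma cutoff_dist_le1 x y : `|cutoff x - cutoff y| <= 1.
Proof. exact: norm_f_le cutoff01 x y. Qed.

Lemma measurable_cutoff : measurable_fun [set: caratheodory_type mu] cutoff.
Proof.
apply: (@cara_lipschitz_fun _ _ _ breg _ 1 r^-1) => // x y _.
by rewrite mulrC cutoff_lip.
Qed.

Lemma L1_cutoff : L1 mu (EFin \o cutoff).
Proof.
apply/integrableP; split; first by apply/measurable_EFinP; exact: measurable_cutoff.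
rewrite -(@lower_integral_support _ _ _ _ (ball x0 (2 * r) : set (caratheodory_type mu))); last first.
  move=> y; rewrite ballEmdist/= => /negP; rewrite -leNgt => /cutoff0 ->.
  by rewrite normr0.
have := @ball_integrable _ _ _ _ breg dbl 1 x0 (2 * r) _ measurable_cutoff.
case/(_ _)/integrableP => // y.
by have /andP[a b] := cutoff01 y; rewrite ger0_norm.
Qed.

Let k := frac_kernel mu 2^-1 (EFin \o cutoff).
Let k0 x y : (0 <= k x y)%E := frac_kernel_ge0 dbl _ _ x y.
Let q : R := 2 `^ (- 2^-1).
Let rr : R := r `^ (- 2^-1).
Let rr0 : 0 < rr. Proof. by rewrite powR_gt0. Qed.
Let q0 : 0 < q. Proof. by rewrite powR_gt0. Qed.
Let C1 : 1 <= Cmu := Cmu_ge1 dbl.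
Let C0 : 0 < Cmu := Cmu_gt0 dbl.
Let e0 j : 0 < 2 ^+ j :> R. Proof. by rewrite exprn_gt0. Qed.
Let qj0 j : 0 < q ^+ j. Proof. by rewrite exprn_gt0. Qed.

Let kernel_le (N s : R) x y : x != y -> 0 < s -> s <= mdist x y -> 0 <= N ->
  `|cutoff x - cutoff y| <= N ->
  (k x y <= (N * (s `^ (- 2^-1) / vol mu x s))%:E)%E.
Proof.
move=> xy s0 sd N0 hN; rewrite /k (frac_kernelE dbl)// lee_fin.
have vs := vol_gt0 dbl x s0.
rewrite powRN -invfM ler_pM ?invr_ge0 ?mulr_ge0 ?powR_ge0 ?vol_ge0//.
have d0 : 0 < mdist x y by exact: lt_le_trans sd.
rewrite lef_pV2 ?posrE ?mulr_gt0 ?powR_gt0 ?(vol_gt0 dbl)//.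
apply: ler_pM; rewrite ?powR_ge0 ?vol_ge0//.
  by rewrite ge0_ler_powR ?nnegrE ?(ltW s0) ?(ltW d0)// invr_ge0.
by apply: (vol_le dbl); rewrite mdistxx add0r.
Qed.

Let annulus (x : X) (s t : R) : set X := [set y | s <= mdist x y < t].

Let mannulus x s t : measurable (annulus x s t : set (caratheodory_type mu)).
Proof.
have := cara_mdist breg x measurableT (measurable_itv `[s, t[).
by rewrite setTI.
Qed.

Let mu_annulus x s t : (mu (annulus x s t) <= (vol mu x t)%:E)%E.
Proof.
rewrite -(mu_ballE dbl); apply: le_outer_measure => y /= /andP[_ h].
by rewrite ballEmdist.
Qed.

(** At distances at least r the difference of values is at most 1 and the power -1/2 decays; below r
    the Lipschitz bound d / r outweighs the singularity. The two dyadic sums contribute 4 and 8. *)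
Lemma int_kernel_cutoff_le x :
  (\int[mu_measure mu]_y k x y <= (12 * Cmu * rr)%:E)%E.
Proof.
have Crr : 0 <= Cmu * rr by rewrite ltW// mulr_gt0.
have [G1 [mG1 G10 hG1 iG1]] : exists G : X -> \bar R,
    [/\ measurable_fun [set: caratheodory_type mu] G, (forall y, 0 <= G y)%E,
     (forall j y, annulus x (r * 2 ^+ j) (r * 2 ^+ j.+1) y ->
        ((rr * q ^+ j / vol mu x (r * 2 ^+ j))%:E <= G y)%E) &
     (\int[mu_measure mu]_y G y <= (4 * (Cmu * rr))%:E)%E].
  apply: (@step_majorant _ _ _ (mu_measure mu) _ _
    (fun j => Cmu * rr * q ^+ j)) => //.
  - by move=> j; rewrite divr_ge0 ?vol_ge0// mulr_ge0 ?ltW.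
  - move=> j; have rj : 0 < r * 2 ^+ j by rewrite mulr_gt0.
    have V0 := vol_gt0 dbl x rj.
    apply: (@le_trans _ _ ((rr * q ^+ j / vol mu x (r * 2 ^+ j))%:E *
      (vol mu x (r * 2 ^+ j.+1))%:E)%E).
      apply: lee_wpmul2l; last exact: mu_annulus.
      by rewrite lee_fin divr_ge0 ?(ltW V0)// mulr_ge0 ?ltW.
    rewrite -EFinM lee_fin mulrAC ler_pdivrMr//.
    have -> : Cmu * rr * q ^+ j * vol mu x (r * 2 ^+ j) =
      rr * q ^+ j * (Cmu * vol mu x (r * 2 ^+ j)) by ring.
    apply: ler_wpM2l; first by rewrite mulr_ge0 ?ltW.
    by rewrite exprS mulrCA; exact: (vol_double dbl).
  - by move=> n; exact: sum_sqrt_half.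
have [G2 [mG2 G20 hG2 iG2]] : exists G : X -> \bar R,
    [/\ measurable_fun [set: caratheodory_type mu] G, (forall y, 0 <= G y)%E,
     (forall j y, annulus x (r / 2 ^+ j.+1) (r / 2 ^+ j) y ->
        (((2 ^+ j)^-1 * ((r / 2 ^+ j.+1) `^ (- 2^-1) / vol mu x (r / 2 ^+ j.+1)))%:E
           <= G y)%E) &
     (\int[mu_measure mu]_y G y <= (4 * (2 * (Cmu * rr)))%:E)%E].
  apply: (@step_majorant _ _ _ (mu_measure mu) _ _
    (fun j => 2 * (Cmu * rr) * q ^+ j)) => //.
  - by move=> j; rewrite mulr_ge0 ?invr_ge0 ?(ltW (e0 _))// divr_ge0 ?vol_ge0 ?powR_ge0.
  - move=> j; have rj : 0 < r / 2 ^+ j.+1 by rewrite divr_gt0.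
    have V0 := vol_gt0 dbl x rj.
    apply: (@le_trans _ _ (((2 ^+ j)^-1 * ((r / 2 ^+ j.+1) `^ (- 2^-1) /
      vol mu x (r / 2 ^+ j.+1)))%:E * (Cmu * vol mu x (r / 2 ^+ j.+1))%:E)%E).
      apply: lee_wpmul2l.
        by rewrite lee_fin mulr_ge0 ?invr_ge0 ?(ltW (e0 _))// divr_ge0 ?vol_ge0 ?powR_ge0.
      apply: (le_trans (mu_annulus _ _ _)); rewrite lee_fin.
      have -> : r / 2 ^+ j = 2 * (r / 2 ^+ j.+1).
        by rewrite exprS; field; rewrite expf_neq0.
      exact: (vol_double dbl).
    rewrite -EFinM lee_fin.
    have hr : (r / 2 ^+ j.+1) `^ (- 2^-1) * q ^+ j.+1 = rr.
      by rewrite -powR_half_dyadic ?(ltW rj)// divfK// gt_eqF.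
    have q2 : (2 ^+ j)^-1 = q ^+ j * q ^+ j.
      by rewrite -exprMn -expr2 (sqrt_half_sqr R) exprVn.
    have /andP[qh _] := sqrt_half_bounds R.
    rewrite q2 -hr; move: V0.
    set V := vol _ _ _; set a := _ `^ _ => V0.
    rewrite exprS; have a0 : 0 <= a by exact: powR_ge0.
    have -> : q ^+ j * q ^+ j * (a / V) * (Cmu * V) = (a * q ^+ j * q ^+ j * Cmu) * 1.
      by field; rewrite gt_eqF.
    have -> : 2 * (Cmu * (a * (q * q ^+ j))) * q ^+ j =
      (a * q ^+ j * q ^+ j * Cmu) * (2 * q) by ring.
    rewrite ler_wpM2l//; last by rewrite -/q in qh; lra.
    by rewrite (mulr_ge0 (mulr_ge0 (mulr_ge0 a0 (ltW (qj0 j))) (ltW (qj0 j))) (ltW C0)).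
  - by move=> n; apply: sum_sqrt_half; rewrite mulr_ge0.
apply: (@le_trans _ _ (\int[mu_measure mu]_y (G1 y + G2 y))%E).
  apply: le_lower_integral => // y _.
  have [<-|xy] := eqVneq x y.
    by rewrite /k /frac_kernel eqxx adde_ge0.
  have d0 : 0 < mdist x y by rewrite mdist_gt0.
  have [rd|dr] := leP r (mdist x y).
    have [j hj] := dyadic_up r0 rd.
    apply: le_trans (leeDl _ (G20 y)); apply: le_trans (hG1 j y hj).
    case/andP: hj => hj _.
    have := @kernel_le 1 (r * 2 ^+ j) x y xy (mulr_gt0 r0 (e0 j)) hj ler01
      (cutoff_dist_le1 x y).
    by rewrite mul1r powR_half_dyadic// ltW.
  have [j hj] := dyadic_down d0 dr.
  apply: le_trans (leeDr _ (G10 y)); apply: le_trans (hG2 j y hj).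
  case/andP: hj => hj hj'.
  apply: kernel_le => //; first by rewrite divr_gt0.
  by apply: (le_trans (cutoff_lip x y)); rewrite ler_pdivrMr// mulrC ltW.
rewrite ge0_integralD//; apply: (le_trans (leeD iG1 iG2)).
by rewrite -EFinD lee_fin; lra.
Qed.

(** The cutoff vanishes at x, so only y in B(x0, 2 r) count, and these are at distance at least
    d(x0, x) / 2 from x. *)
Lemma int_kernel_cutoff_far (x : X) : 4 * r <= mdist x0 x ->
  (\int[mu_measure mu]_y k x y <=
    ((mdist x0 x / 2) `^ (- 2^-1) / vol mu x (mdist x0 x / 2) * vol mu x0 (2 * r))%:E)%E.
Proof.
move=> far; have d0 : 0 < mdist x0 x / 2 by rewrite divr_gt0// (lt_le_trans _ far)// mulr_gt0.
have ux : cutoff x = 0 by rewrite cutoff0// (le_trans _ far)// ler_pM2r// ler_nat.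
rewrite -(@lower_integral_support _ _ _ _ (ball x0 (2 * r) : set (caratheodory_type mu))); last first.
  move=> y; rewrite ballEmdist/= => /negP; rewrite -leNgt => /cutoff0 uy.
  have [<-|xy] := eqVneq x y; first by rewrite /k /frac_kernel eqxx.
  by rewrite /k (frac_kernelE dbl)// ux uy subrr normr0 mul0r.
apply: (@le_trans _ _ (\int[mu_measure mu]_(y in ball x0 (2 * r))
    ((mdist x0 x / 2) `^ (- 2^-1) / vol mu x (mdist x0 x / 2))%:E)%E).
  apply: le_lower_integral => // y; rewrite ballEmdist/= => yr.
  have tri := metric_triangle x0 y x.
  have dxy : mdist x0 x / 2 <= mdist x y by rewrite [mdist x y]metric_sym; lra.
  rewrite -(mul1r (_ / vol _ _ _)).
  apply: kernel_le => //; last exact: cutoff_dist_le1.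
  by rewrite -mdist_gt0 (lt_le_trans d0).
rewrite integral_cst; last exact: (cara_ball breg).
by rewrite (mu_measure_ballE dbl) EFinM.
Qed.

(** The uniform bound on B(x0, 4 r) contributes 12, the decay over the dyadic annuli around it 4. *)
Lemma frac_energy_cutoff_le :
  (frac_energy mu 2^-1 [set: X] (EFin \o cutoff) <=
   (16 * Cmu ^+ 4 * rr * vol mu x0 r)%:E)%E.
Proof.
set V := vol mu x0 r; have V0 : 0 < V by exact: (vol_gt0 dbl).
have V2 : vol mu x0 (2 * r) <= Cmu * V by exact: (vol_double dbl).
have r4 : 0 < 4 * r by rewrite mulr_gt0.
pose A (j : nat) : set X := if j is j'.+1
  then annulus x0 (4 * r * 2 ^+ j') (4 * r * 2 ^+ j'.+1) else ball x0 (4 * r).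
(* The volume of the ball around x is traded, for [Cmu ^+ 3], against that of the ball around x0
   containing the annulus, which then cancels its measure. *)
pose c (j : nat) : R := if j is j'.+1
  then Cmu ^+ 3 * (rr * q ^+ j') / vol mu x0 (4 * r * 2 ^+ j'.+1) * (Cmu * V)
  else 12 * Cmu * rr.
pose b (j : nat) : R := if j is j'.+1 then Cmu ^+ 4 * rr * V * q ^+ j'
  else 12 * Cmu * rr * (Cmu ^+ 2 * V).
have C4rr : 0 <= Cmu ^+ 4 * rr * V.
  by rewrite (mulr_ge0 (mulr_ge0 (exprn_ge0 _ (ltW C0)) (ltW rr0)) (ltW V0)).
have c0 j : 0 <= c j.
  case: j => [|j]; first exact: (mulr_ge0 (mulr_ge0 (ler0n _ 12) (ltW C0)) (ltW rr0)).
  have h1 : 0 <= Cmu ^+ 3 * (rr * q ^+ j).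
    by rewrite mulr_ge0 ?exprn_ge0 ?(ltW C0)// mulr_ge0 ?ltW.
  by rewrite /c mulr_ge0 ?divr_ge0 ?vol_ge0// mulr_ge0 ?ltW.
have [G [mG G0 hG iG]] : exists G : X -> \bar R,
    [/\ measurable_fun [set: caratheodory_type mu] G, (forall y, 0 <= G y)%E,
     (forall j y, A j y -> ((c j)%:E <= G y)%E) &
     (\int[mu_measure mu]_y G y <= (16 * Cmu ^+ 4 * rr * V)%:E)%E].
  apply: (@step_majorant _ _ _ (mu_measure mu) A c b) => //.
  - by case=> [|j]; [exact: (cara_ball breg)|exact: mannulus].
  - case=> [|j].
      rewrite (mu_measure_ballE dbl) -EFinM lee_fin; apply: (ler_wpM2l (c0 0%N)).
      by apply: (vol_cmp dbl) => //; rewrite mdistxx add0r -natrX.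
    have rj : 0 < 4 * r * 2 ^+ j.+1 by rewrite mulr_gt0.
    have Vj := vol_gt0 dbl x0 rj.
    apply: (@le_trans _ _ ((c j.+1)%:E * (vol mu x0 (4 * r * 2 ^+ j.+1))%:E)%E).
      by apply: lee_wpmul2l; [rewrite lee_fin c0|exact: mu_annulus].
    rewrite -EFinM lee_fin /c /b le_eqVlt; apply/orP; left; apply/eqP.
    by rewrite exprS; field; rewrite gt_eqF.
  - move=> [|n].
      rewrite big_geq//; have -> : 16 * Cmu ^+ 4 * rr * V = 16 * (Cmu ^+ 4 * rr * V) by ring.
      exact: (mulr_ge0 (ler0n _ 16) C4rr).
    rewrite big_nat_recl//=; have := sum_sqrt_half n C4rr; rewrite -/q.
    have : Cmu * (Cmu ^+ 2 * (rr * V)) <= Cmu ^+ 2 * (Cmu ^+ 2 * (rr * V)).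
      apply: ler_wpM2r; last by rewrite expr2 ler_peMl// ltW.
      by rewrite mulr_ge0 ?exprn_ge0 ?(ltW C0)// mulr_ge0 ?ltW.
    set S := \sum_(_ <= _ < _) _ => h1 h2.
    have -> : 16 * Cmu ^+ 4 * rr * V = 12 * (Cmu ^+ 2 * (Cmu ^+ 2 * (rr * V))) +
      4 * (Cmu ^+ 4 * rr * V) by ring.
    have -> : 12 * Cmu * rr * (Cmu ^+ 2 * V) = 12 * (Cmu * (Cmu ^+ 2 * (rr * V))) by ring.
    by apply: lerD => //; apply: (ler_wpM2l (ler0n _ 12)).
apply: le_trans iG; rewrite /frac_energy; apply: le_lower_integral.
  by move=> x _; apply: integral_ge0 => y _; exact: k0.
move=> x _; have [far|near] := leP (4 * r) (mdist x0 x); last first.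
  apply: le_trans (hG 0%N x _); last by rewrite /A ballEmdist.
  exact: int_kernel_cutoff_le.
have [j hj] := dyadic_up r4 far.
apply: le_trans (hG j.+1 x hj); apply: (le_trans (int_kernel_cutoff_far far)).
case/andP: hj => hj1 hj2; rewrite lee_fin /c; set D := mdist x0 x in hj1 hj2 far *.
have rj : 0 < 4 * r * 2 ^+ j.+1 by rewrite mulr_gt0.
have D2 : r * 2 ^+ j <= D / 2 by rewrite ler_pdivlMr//; move: hj1; rewrite -!mulrA; have := e0 j; nra.
have D20 : 0 < D / 2 by apply: lt_le_trans D2; rewrite mulr_gt0.
have VD : vol mu x0 (4 * r * 2 ^+ j.+1) <= Cmu ^+ 3 * vol mu x (D / 2).
  apply: (vol_cmp dbl) => //; rewrite [mdist x x0]metric_sym -/D.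
  have -> : 2 ^+ 3 * (D / 2) = D + (D + (D + D)) :> R by field.
  have -> : 4 * r * 2 ^+ j.+1 = 4 * r * 2 ^+ j + 4 * r * 2 ^+ j by rewrite exprS; ring.
  by lra.
have VD0 := vol_gt0 dbl x D20.
have Vj := vol_gt0 dbl x0 rj.
apply: ler_pM; rewrite ?vol_ge0//.
  by rewrite divr_ge0 ?powR_ge0 ?vol_ge0.
rewrite ler_pdivrMr// mulrAC ler_pdivlMr//.
have Dq : (D / 2) `^ (- 2^-1) <= rr * q ^+ j.
  rewrite -powR_half_dyadic ?(ltW r0)// !powRN lef_pV2 ?posrE ?powR_gt0// ?mulr_gt0//.
  by rewrite ge0_ler_powR ?nnegrE ?(ltW D20)// ?invr_ge0// mulr_ge0 ?ltW.
have -> : Cmu ^+ 3 * (rr * q ^+ j) * vol mu x (D / 2) =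
  rr * q ^+ j * (Cmu ^+ 3 * vol mu x (D / 2)) by ring.
by apply: ler_pM; rewrite ?powR_ge0 ?vol_ge0.
Qed.

End cutoff.

(** * Lower regularity from the fractional inequalities *)

Section ahlfors_converse.
Context {R : realType} {X : completeMetricType R}.
Variables (mu : {outer_measure set X -> \bar R}) (Cmu Q : R).
Hypothesis breg : borel_regular mu.
Hypothesis dbl : doubling mu Cmu.
Hypothesis muT : mu [set: X] = +oo%E.
Hypothesis Q1 : 1 < Q.

Let th : 0 < (2^-1 : R) < 1.
Proof. by rewrite invr_gt0 ltr0n/= invf_lt1// ltr1n. Qed.
Let Q0 : 0 < Q. Proof. exact: lt_trans Q1. Qed.
Let p := Q / (Q - 2^-1).
Let p0 : 0 < p.
Proof. by rewrite divr_gt0// subr_gt0 (lt_trans _ Q1)//; case/andP: th. Qed.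
Let pV : (Q - 2^-1) / Q = p^-1. Proof. by rewrite invf_div. Qed.

(** Dividing by V leaves r^(1/2) <= K V^(1/(2 Q)), to be raised to the power 2 Q. *)
Lemma vol_lower_bound (K V r : R) : 0 < K -> 0 < V -> 0 < r ->
  V `^ ((Q - 2^-1) / Q) <= K * r `^ (- 2^-1) * V ->
  K `^ (- (2 * Q)) * r `^ Q <= V.
Proof.
move=> K0 V0 r0.
have -> : (Q - 2^-1) / Q = 1 - (2 * Q)^-1 by field; rewrite gt_eqF.
rewrite powR_1B// powRN -mulrA mulrCA => h.
have a0 : 0 < V `^ (2 * Q)^-1 by rewrite powR_gt0.
have b0 : 0 < r `^ 2^-1 by rewrite powR_gt0.
have {h} h : r `^ 2^-1 <= K * V `^ (2 * Q)^-1.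
  move: h; rewrite ler_pdivrMr// mulrA [_ * V]mulrC -!mulrA -{1}[V]mulr1 ler_pM2l//.
  by rewrite powRN ler_pdivlMl// mulr1.
have Q20 : 0 < 2 * Q by rewrite mulr_gt0.
have -> : r `^ Q = (r `^ 2^-1) `^ (2 * Q) by rewrite -powRrM mulrA mulVf// mul1r.
rewrite mulrC ler_pdivrMr ?powR_gt0//.
have {1}-> : V = (V `^ (2 * Q)^-1) `^ (2 * Q).
  by rewrite -powRrM mulVf ?gt_eqF// powRr1// ltW.
rewrite -powRM ?(ltW a0) ?(ltW K0)// [X in _ <= X `^ _]mulrC.
by rewrite ge0_ler_powR ?nnegrE ?(ltW Q20) ?(ltW b0) ?mulr_ge0 ?(ltW a0) ?(ltW K0).
Qed.

Let poweR_inv_ge (I : \bar R) (a V : R) : 0 <= a -> 0 <= V ->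
  ((a `^ p * V)%:E <= I)%E -> ((a * V `^ p^-1)%:E <= I `^ p^-1)%E.
Proof.
move=> a0 V0; case: I => [I| |]//; last first.
  by move=> _; rewrite poweRyr ?leey// invr_eq0 gt_eqF.
rewrite !lee_fin => h.
have -> : a * V `^ p^-1 = (a `^ p * V) `^ p^-1.
  by rewrite powRM ?powR_ge0// -powRrM mulfV ?gt_eqF// powRr1.
rewrite ge0_ler_powR ?nnegrE ?invr_ge0 ?(ltW p0)// ?mulr_ge0 ?powR_ge0//.
by apply: le_trans h; rewrite mulr_ge0 ?powR_ge0.
Qed.

(** The cutoff function is 1 on B(x0, r). At theta = 1/2 the factor theta (1 - theta) = 1/4 turns
    the 16 of its energy into 4. *)
Lemma sobolev_lower_ahlfors (C : R) : frac_sobolev_with mu Q C ->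
  lower_ahlfors_with mu Q ((4 * C * Cmu ^+ 4) `^ (- (2 * Q))).
Proof.
case=> C1 sob; have C0 : 0 < C by exact: lt_le_trans C1.
have Cm0 := Cmu_gt0 dbl.
have K0 : 0 < 4 * C * Cmu ^+ 4 by rewrite mulr_gt0 ?exprn_gt0// mulr_gt0.
split; first by rewrite powR_gt0.
move=> x0 r r0 _; rewrite (mu_ballE dbl) lee_fin.
have V0 := vol_gt0 dbl x0 r0.
apply: vol_lower_bound => //; rewrite -lee_fin.
have := sob 2^-1 th _ (L1_cutoff breg dbl x0 r0).
set I := (\int[_]_(x in _) _)%E => h.
have : ((1 * vol mu x0 r `^ p^-1)%:E <= I `^ p^-1)%E.
  apply: poweR_inv_ge => //; first exact: ltW.
  rewrite powR1 EFinM -(mu_ballE dbl).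
  apply: (@lower_integral_ge_cst _ _ _ (mu_measure mu) (ball x0 r) setT) => //.
  - exact: (cara_ball breg).
  - by move=> x _; exact: poweR_ge0.
  - by move=> x xr /=; rewrite (cutoff1 r0 xr) normr1 powR1.
rewrite mul1r pV => /le_trans; apply; rewrite -pV; apply: (le_trans h).
apply: (@le_trans _ _ ((C * 2^-1 * (1 - 2^-1))%:E *
  (16 * Cmu ^+ 4 * r `^ (- 2^-1) * vol mu x0 r)%:E)%E).
  apply: lee_wpmul2l; last exact: (frac_energy_cutoff_le breg dbl).
  by rewrite lee_fin; lra.
by rewrite -EFinM lee_fin le_eqVlt; apply/orP; left; apply/eqP; field.
Qed.

(** Subtracting the mean must not destroy the cutoff function. On a ball of more than twice the
    measure of B(x0, 2 r), which exists as mu(X) = +oo, the mean is at most 1/2, so the difference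
    is at least 1/2 on B(x0, r). The energy over the dilated ball is bounded by that over X, however
    large the ball. *)
Lemma poincare_lower_ahlfors (C tau : R) : frac_poincare_with mu Q C tau ->
  lower_ahlfors_with mu Q ((16 * C * Cmu ^+ 4) `^ (- (2 * Q))).
Proof.
case=> C1 tau1 poi; have C0 : 0 < C by exact: lt_le_trans C1.
have Cm0 := Cmu_gt0 dbl.
have K0 : 0 < 16 * C * Cmu ^+ 4 := mulr_gt0 (mulr_gt0 (ltr0Sn R 15) C0) (exprn_gt0 4 Cm0).
split; first by rewrite powR_gt0.
move=> x0 r r0 _; rewrite (mu_ballE dbl) lee_fin.
have V0 := vol_gt0 dbl x0 r0.
apply: vol_lower_bound => //; rewrite -lee_fin.
have [s s0 hs] := vol_unbounded breg dbl x0 (2 * vol mu x0 (2 * r)) muT.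
have VS0 := vol_gt0 dbl x0 s0.
have r20 : 0 < 2 * r by rewrite mulr_gt0.
have rs : 2 * r <= s.
  rewrite leNgt; apply/negP => sr.
  have : vol mu x0 s <= vol mu x0 (2 * r) by apply: (vol_le dbl); rewrite mdistxx add0r ltW.
  have := vol_gt0 dbl x0 r20; lra.
have mu_ := measurable_cutoff breg x0 r0.
have u1 y : `|cutoff x0 r y| <= 1.
  by have /andP[a b] := cutoff01 x0 r y; rewrite ger0_norm.
have mean_u : mean mu (ball x0 s) (EFin \o cutoff x0 r) =
    (average mu (cutoff x0 r) x0 s)%:E.
  exact: (mean_average breg dbl _ s0 mu_ u1).
have avg_half : average mu (cutoff x0 r) x0 s <= 2^-1.
  have out A : ball x0 (2 * r) `<=` A -> forall y, ~ A y -> cutoff x0 r y = 0.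
    move=> sub y /(contra_not (@sub y)); rewrite ballEmdist/= => /negP.
    by rewrite -leNgt => /(cutoff0 r0).
  have sub : ball x0 (2 * r) `<=` ball x0 s by apply: ball_sub; rewrite mdistxx add0r.
  rewrite /average (@Rintegral_support _ _ mu _ _ (out (ball x0 s) sub)).
  rewrite -(@Rintegral_support _ _ mu _ _ (out (ball x0 (2 * r)) (@subset_refl _ _))).
  rewrite mulrC ler_pdivrMr//.
  apply: (@le_trans _ _ (vol mu x0 (2 * r))); last by lra.
  rewrite -[leRHS]mul1r -Rintegral_cst; last exact: (cara_ball breg).
  apply: le_Rintegral => //; first exact: (cara_ball breg).
  - exact: (ball_integrable breg dbl 1).
  - by apply: (ball_integrable breg dbl 1) => // y; rewrite normr1.
  - by move=> y _; case/andP: (cutoff01 x0 r y).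
have := poi 2^-1 th x0 s s0 _ (L1_cutoff breg dbl x0 r0).
set I := (\int[_]_(x in _) _)%E => h.
have : ((2^-1 * vol mu x0 r `^ p^-1)%:E <= I `^ p^-1)%E.
  apply: poweR_inv_ge => //; first exact: ltW.
  rewrite EFinM -(mu_ballE dbl).
  apply: (@lower_integral_ge_cst _ _ _ (mu_measure mu) (ball x0 r) (ball x0 s)) => //.
  - exact: (cara_ball breg).
  - by apply: ball_sub; rewrite mdistxx add0r (le_trans _ rs)//; lra.
  - by move=> x _; exact: poweR_ge0.
  - move=> x xr /=; rewrite mean_u (cutoff1 r0 xr) -EFinB abse_EFin poweR_EFin lee_fin.
    rewrite ge0_ler_powR ?nnegrE ?(ltW p0)// ger0_norm; lra.
have E1 : (frac_energy mu 2^-1 (ball x0 (tau * s)) (EFin \o cutoff x0 r) <=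
   (16 * Cmu ^+ 4 * r `^ (- 2^-1) * vol mu x0 r)%:E)%E.
  apply: le_trans (frac_energy_cutoff_le breg dbl x0 r0).
  exact: (le_frac_energy dbl).
have K1 : (0 <= (C * (1 - 2^-1))%:E)%E by rewrite lee_fin; lra.
rewrite -pV => /le_trans/(_ (le_trans h (lee_wpmul2l K1 E1))).
rewrite -EFinM !lee_fin; set W := vol mu x0 r `^ _; set Z := 16 * _ * _ * _ => h2.
have -> : 16 * C * Cmu ^+ 4 * r `^ (- 2^-1) * vol mu x0 r = C * Z by rewrite /Z; ring.
by lra.
Qed.

End ahlfors_converse.

(** * Explicit constants for the implications from lower regularity *)

Section constants.
Context {R : realType} {X : completeMetricType R}.
Variables (mu : {outer_measure set X -> \bar R}) (Cmu CP tauP Q : R).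
Hypothesis Q1 : 1 < Q.
Hypothesis st : standing mu Cmu CP tauP.

Let Q0 : 0 < Q. Proof. exact: lt_trans Q1. Qed.

Lemma lower_ahlfors_vol (c0 : R) : lower_ahlfors_with mu Q c0 ->
  forall x r, 0 < r -> c0 * r `^ Q <= vol mu x r.
Proof.
case: st => _ dbl _ muT [_ ahl] x r r0.
rewrite -lee_fin -(mu_ballE dbl); apply: ahl => //.
by rewrite (diam_infty dbl muT) gt0_muley ?ltry// lte_fin.
Qed.

Lemma lower_ahlfors_sobolev (c0 : R) : lower_ahlfors_with mu Q c0 ->
  frac_sobolev_with mu Q (Num.max 1 (128 * (osc_cst Cmu CP c0 Q * Cmu ^+ 4))).
Proof.
move=> ahl; have ahlv := lower_ahlfors_vol ahl; case: ahl => c00 _.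
case: st => breg dbl poin muT; split; first by rewrite le_max lexx.
move=> theta th u uL1.
apply: le_trans (fractional_sobolev breg dbl poin muT Q1 c00 ahlv th uL1) _.
apply: lee_wpmul2r; first exact: (frac_energy_ge0 dbl).
case/andP: th => th0 th1; rewrite lee_fin.
rewrite ler_wpM2r ?subr_ge0 ?(ltW th1)// ler_wpM2r ?(ltW th0)//.
by rewrite le_max lexx orbT.
Qed.

Lemma lower_ahlfors_poincare (c0 : R) : lower_ahlfors_with mu Q c0 ->
  frac_poincare_with mu Q (Num.max 1 (384 * (osc_cst Cmu CP c0 Q * Cmu ^+ 4)))
    (5 + 2 * tauP).
Proof.
move=> ahl; have ahlv := lower_ahlfors_vol ahl; case: ahl => c00 _.
case: st => breg dbl poin muT; split; first by rewrite le_max lexx.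
  by case: poin => _ tau1 _; lra.
move=> theta th x0 r0 r00 u uL1.
apply: le_trans (fractional_poincare breg dbl poin muT Q1 c00 ahlv th uL1 x0 r00) _.
apply: lee_wpmul2r; first exact: (frac_energy_ge0 dbl).
case/andP: th => th0 th1; rewrite lee_fin.
rewrite ler_wpM2r ?subr_ge0 ?(ltW th1)//.
by rewrite le_max lexx orbT.
Qed.

End constants.

Theorem theorem1p8 (R : realType) (Q : R) (hQ : 1 < Q)
    (Cmu CP tauP : R) :
  (* equivalence of (i), (ii) and (iii) *)
  (forall (X : completeMetricType R) (mu : {outer_measure set X -> \bar R}),
     standing mu Cmu CP tauP ->
     (lower_ahlfors mu Q <-> frac_sobolev mu Q) /\
     (lower_ahlfors mu Q <-> frac_poincare mu Q)) /\
  (* dependence of the constants *)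
  [/\ (* (i) => (ii) *)
      forall c0 : R, 0 < c0 -> exists C : R,
        forall (X : completeMetricType R)
               (mu : {outer_measure set X -> \bar R}),
          standing mu Cmu CP tauP ->
          lower_ahlfors_with mu Q c0 -> frac_sobolev_with mu Q C,
      (* (i) => (iii) *)
      forall c0 : R, 0 < c0 -> exists C tau : R,
        forall (X : completeMetricType R)
               (mu : {outer_measure set X -> \bar R}),
          standing mu Cmu CP tauP ->
          lower_ahlfors_with mu Q c0 -> frac_poincare_with mu Q C tau,
      (* (ii) => (i) *)
      forall C : R, 1 <= C -> exists c0 : R,
        forall (X : completeMetricType R)
               (mu : {outer_measure set X -> \bar R}),
          standing mu Cmu CP tauP ->
          frac_sobolev_with mu Q C -> lower_ahlfors_with mu Q c0 &
      (* (iii) => (i) *)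
      forall C tau : R, 1 <= C -> 1 <= tau -> exists c0 : R,
        forall (X : completeMetricType R)
               (mu : {outer_measure set X -> \bar R}),
          standing mu Cmu CP tauP ->
          frac_poincare_with mu Q C tau -> lower_ahlfors_with mu Q c0].
Proof.
split.
  move=> X mu st; have [breg dbl _ muT] := st; split; split.
  - by case=> c0 /(lower_ahlfors_sobolev hQ st) h; exact: ex_intro h.
  - by case=> C /(sobolev_lower_ahlfors breg dbl hQ) h; exact: ex_intro h.
  - by case=> c0 /(lower_ahlfors_poincare hQ st) h; do 2!eexists; exact: h.
  - by case=> C [tau] /(poincare_lower_ahlfors breg dbl muT hQ) h; exact: ex_intro h.
(* The witnesses are left to unification with the explicit constants of the lemmas; being created
   before X and mu, they cannot depend on them. *)
split=> [c0 _|c0 _|C _|C tau _ _].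
- eexists => X mu st; exact: (lower_ahlfors_sobolev hQ st).
- eexists; eexists => X mu st; exact: (lower_ahlfors_poincare hQ st).
- eexists => X mu [breg dbl _ _]; exact: (sobolev_lower_ahlfors breg dbl hQ).
- eexists => X mu [breg dbl _ muT]; exact: (poincare_lower_ahlfors breg dbl muT hQ).
Qed.
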